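(* Let $\mathcal{L}$ be the directional geodesic tree of exponential last-passage percolation on $\mathbb{Z}^2$ in direction $(1,1)$, $\mathcal{L}^*$ its dual system, and $\mathcal{L}^{\downarrow}$ the collection of down-left semi-infinite geodesics in direction $-(1,1)$. Then $$\mathcal{L}^*\stackrel{dist.}{=}\mathcal{L}^{\downarrow},$$ as random sets of edges, where the dual lattice is identified with $\mathbb{Z}^2$ by the translation $\mathbf z+\tfrac12(1,1)\mapsto\mathbf z$. In particular, $\mathcal{L}^*$ is a.s. a tree, and a.s. there is no bi-infinite maximizing path in $\mathcal{L}$.
   Context: Notation: $\mathbf e_1=(1,0)$, $\mathbf e_2=(0,1)$, $\mathbf d=(1,1)$, $\mathbf 0=(0,0)$; for $\mathbf x,\mathbf y\in\mathbb{Z}^2$, $\mathbf x\le \mathbf y$ means $x(i)\le y(i)$ for $i=1,2$. Last-passage percolation. Let $\{W_{\mathbf x}:\mathbf x\in\mathbb{Z}^2\}$ be i.i.d. exponential random variables of parameter $1$. For $\mathbf x\le\mathbf y$, let $\Gamma(\mathbf x,\mathbf y)$ be the set of up-right paths $\gamma=(\mathbf x_0,\dots,\mathbf x_k)$ with $\mathbf x_0=\mathbf x$, $\mathbf x_k=\mathbf y$, $\mathbf x_{j+1}-\mathbf x_j\in\{\mathbf e_1,\mathbf e_2\}$; put $W(\gamma)=\sum_{j=1}^k W_{\mathbf x_j}$ and $L(\mathbf x,\mathbf y)=\max_{\gamma\in\Gamma(\mathbf x,\mathbf y)}W(\gamma)$. The geodesic $\gamma(\mathbf x,\mathbf y)$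 is the a.s. unique maximizing path. Semi-infinite geodesics. It is known that a.s., for each $\mathbf x\in\mathbb{Z}^2$ there is a unique semi-infinite up-right path $\gamma(\mathbf x)=(\mathbf x_n)_{n\ge0}$ such that $\mathbf x_0=\mathbf x$, $\gamma(\mathbf x_k,\mathbf x_n)=(\mathbf x_k,\dots,\mathbf x_n)$ for all $k<n$, and $\gamma(\mathbf x,\mathbf x+\mathbf y_n)\to\gamma(\mathbf x)$ (eventual coincidence on each finite set) for every lattice sequence $\mathbf y_n\ge\mathbf 0$ with $|\mathbf y_n|\to\infty$ and $y_n(2)/y_n(1)\to1$; and that a.s. any two of these paths coalesce (they coincide from some common point on). Similarly, a.s. for each $\mathbf x$ there is a unique semi-infinite down-left path $\gamma^{\downarrow}(\mathbf x)=(\mathbf x_n)_{n\ge0}$ (steps $-\mathbf e_1$ or $-\mathbf e_2$) with $\mathbf x_0=\mathbf x$, whose finite segments $\mathbf x_k,\dots,\mathbf x_n$ are (reversed) the geodesics $\gamma(\mathbf x_n,\mathbf x_k)$, and with $\gamma(\mathbf x-\mathbf y_n,\mathbf x)\to\gamma^{\downarrow}(\mathbf x)$ (eventual coincidence on each finite set) for every lattice sequence $\mathbf y_n\ge\mathbf 0$ with $|\mathbf y_n|\to\infty$ and $y_n(2)/y_n(1)\to1$; these also coalesce a.s. Trees and duality. $\mathcal{L}=\{\gamma(\mathbf x):\mathbf x\in\mathbb{Z}^2\}$ is a.s. a tree (viewed as the set of lattice edges used by these paths), called the directional geodesic tree, and $\mathcal{L}^{\downarrow}=\{\gamma^{\downarrow}(\mathbf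 x):\mathbf x\in\mathbb{Z}^2\}$ is viewed likewise. The dual lattice $\mathbb{Z}^{2*}$ has vertices $\mathbf z^*=\mathbf z+\frac12\mathbf d$, $\mathbf z\in\mathbb{Z}^2$, with dual edges joining vertices at distance $1$; each edge of $\mathbb{Z}^2$ is bisected by exactly one dual edge. The dual system $\mathcal{L}^*$ is the set of dual edges whose corresponding edge of $\mathbb{Z}^2$ is not in $\mathcal{L}$. A bi-infinite maximizing path in $\mathcal{L}$ is a bi-infinite up-right path all of whose edges belong to $\mathcal{L}$. *)

(* Defs.v *)
From HB Require Import structures.
From mathcomp Require Import all_boot all_order all_algebra.
From mathcomp Require Import all_classical all_reals all_analysis.
From mathcomp Require Import zify.

Set Implicit Arguments.
Unset Strict Implicit.
Unset Printing Implicit Defensive.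

Import Order.TTheory GRing.Theory Num.Theory.
Import numFieldNormedType.Exports.

Local Open Scope classical_set_scope.
Local Open Scope ring_scope.

Notation site := (int * int)%type.

Definition unit_vec (i : bool) : site := if i then (0, 1) else (1, 0).

(* The undirected edge {z, z + unit_vec i} is represented by (z, i). *)
Notation edge := (site * bool)%type.

Definition joins (e : edge) (u v : site) : Prop :=
  (u = e.1 /\ v = e.1 + unit_vec e.2) \/ (v = e.1 /\ u = e.1 + unit_vec e.2).

Definition edges_of (I : Type) (succ : I -> I) (g : I -> site) : set edge :=
  [set e | exists n, joins e (g n) (g (succ n))].

Section tree.
Variable E : set edge.

Definition adj : rel site := fun u v => `[< exists2 e, E e & joins e u v >].

Definition connected_graph : Prop :=
  forall u v : site, exists2 p, path adj u p & last u p = v.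

Definition acyclic_graph : Prop :=
  forall c : seq site, (2 < size c)%N -> cycle adj c -> ~ uniq c.

(* The vertex set is the whole lattice: a tree here is a spanning tree. *)
Definition is_tree : Prop := connected_graph /\ acyclic_graph.

End tree.

(* The dual vertex z + (1/2, 1/2) is represented by z, hence the dual edge
   joining z + (1/2, 1/2) and z + (1/2, 1/2) + unit_vec i by (z, i).  Midpoints
   of edges and of dual edges are given in coordinates multiplied by 2. *)
Definition midpoint2 (e : edge) : site := e.1 + (e.1 + unit_vec e.2).

Definition dual_midpoint2 (f : edge) : site :=
  f.1 + (f.1 + unit_vec f.2) + (1, 1).

Definition dual_system (E : set edge) : set edge :=
  [set f | forall e : edge, midpoint2 e = dual_midpoint2 f -> ~ E e].

(* The edge of the lattice bisected by a dual edge exists and is unique. *)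
Definition crossed (f : edge) : edge := (f.1 + unit_vec f.2, ~~ f.2).

Lemma crossedP (e f : edge) :
  midpoint2 e = dual_midpoint2 f <-> e = crossed f.
Proof.
case: e f => [[a b] i] [[c d] j].
rewrite /midpoint2 /dual_midpoint2 /crossed /=; split.
  move=> h; have {h}[] := (congr1 fst h, congr1 snd h) => /=.
  case: i; case: j => /= h1 h2; [lia | | | lia].
    have -> : a = c + 1 by lia.
    by have -> : b = d + 0 by lia.
  have -> : a = c + 0 by lia.
  by have -> : b = d + 1 by lia.
by case=> -> -> ->; case: j; apply: injective_projections => /=; lia.
Qed.

Definition upstep : rel site :=
  fun u v => (v == u + unit_vec false) || (v == u + unit_vec true).

Definition up_path (x y : site) (p : seq site) : bool :=
  if p is x0 :: q then [&& x0 == x, path upstep x0 q & last x0 q == y]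
  else false.

Section last_passage.
Variables (R : realType) (w : site -> R).

(* The weight of the initial site of the path is not counted. *)
Definition weight (p : seq site) : R := \sum_(z <- behead p) w z.

Definition maximizing (x y : site) (p : seq site) : Prop :=
  up_path x y p /\ forall q, up_path x y q -> weight q <= weight p.

Definition geodesic (x y : site) (p : seq site) : Prop :=
  maximizing x y p /\ forall q, maximizing x y q -> q = p.

Definition diagonal_seq (y : nat -> site) : Prop :=
  [/\ forall n, 0 <= (y n).1 /\ 0 <= (y n).2,
      (fun n => (`|(y n).1| + `|(y n).2|)%:~R : R) @ \oo --> +oo &
      (fun n => (y n).2%:~R / (y n).1%:~R : R) @ \oo --> (1 : R)].

(* p (a sequence of finite paths, given as relations) eventually coincides
   with the infinite path g on each finite set of points. *)
Definition paths_cvg (p : nat -> seq site -> Prop) (g : nat -> site) : Prop :=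
  forall A : seq site, \forall n \near \oo,
    exists2 s, p n s & forall z, z \in A -> (z \in s <-> range g z).

Definition segment (g : nat -> site) (k n : nat) : seq site :=
  [seq g i | i <- iota k (n - k).+1].

Definition up_geodesic (x : site) (g : nat -> site) : Prop :=
  [/\ g 0%N = x,
      forall n, upstep (g n) (g n.+1),
      forall k n, (k < n)%N -> geodesic (g k) (g n) (segment g k n) &
      forall y, diagonal_seq y ->
        paths_cvg (fun n => geodesic x (x + y n)) g].

Definition down_geodesic (x : site) (g : nat -> site) : Prop :=
  [/\ g 0%N = x,
      forall n, upstep (g n.+1) (g n),
      forall k n, (k < n)%N -> geodesic (g n) (g k) (rev (segment g k n)) &
      forall y, diagonal_seq y ->
        paths_cvg (fun n => geodesic (x - y n) x) g].

Definition geodesic_tree : set edge :=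
  [set e | exists x g, up_geodesic x g /\ edges_of succn g e].

Definition down_geodesic_tree : set edge :=
  [set e | exists x g, down_geodesic x g /\ edges_of succn g e].

End last_passage.

Definition biinfinite_path_in (E : set edge) (g : int -> site) : Prop :=
  (forall n, upstep (g n) (g (n + 1))) /\ edges_of (fun n => n + 1) g `<=` E.

(* The product sigma-algebra on {0,1}^edge. *)
Definition edge_events : set (set (set edge)) :=
  [set [set E | E e] | e in [set: edge]].

Notation edge_sets := (g_sigma_algebraType edge_events).

Section probability.
Context {d : measure_display} {T : measurableType d} {R : realType}.
Variable P : probability T R.

Definition mutually_independent (X : site -> {RV P >-> R}) : Prop :=
  forall (s : seq site) (A : site -> set R),
    uniq s -> (forall x, measurable (A x)) ->
    P (\big[setI/setT]_(x <- s) (X x @^-1` A x)) =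
    (\big[mule/1%E]_(x <- s) P (X x @^-1` A x))%E.

Definition iid_exponential (X : site -> {RV P >-> R}) : Prop :=
  (forall x (A : set R), measurable A ->
     distribution P (X x) A = exponential_prob 1 A) /\
  mutually_independent X.

(* The random sets of edges considered here are only defined up to null sets,
   so equality in distribution is that of measurable modifications. *)
Definition eq_in_distribution (X Y : T -> set edge) : Prop :=
  exists X' Y' : {mfun T >-> edge_sets},
    [/\ {ae P, forall t, X t = X' t},
        {ae P, forall t, Y t = Y' t} &
        forall S : set edge_sets, measurable S ->
          pushforward P X' S = pushforward P Y' S].

End probability.

(* Main.v *)
(* Last passage values on a quadrant whose axes carry independent exponential
   increments of rates l and 1 - l are stationary: by Burke's theorem the
   increments along any down-right path, together with the minima of the two
   increments leaving each site already passed, are again independent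
   exponentials.  Comparison with rates slightly below and above 1/2 shows that
   the increments of last passage values from far away points in the direction
   -(1, 1) converge to the stationary increments of rate 1/2 (Busemann
   functions).  The geodesic arriving at a site takes its last step along the
   smaller of the two Busemann increments.

   The minima above, the dual weights, are i.i.d. exponential, and reading the box
   backwards, the Busemann increments of the dual weights in the direction (1, 1)
   are those of the original weights in the direction -(1, 1).  As the directions
   of the steps of both families of geodesics are read off the same increments,
   the dual of the tree of one family is the tree of the other.

   If a bi-infinite path of the tree went up from row r to row r + 1 at x, a
   symmetric random walk, the difference of the sums of the Busemann increments
   along the two rows in opposite directions, would stay nonpositive forever on
   one side of x. A dual system with two components would trap a bi-infinite path
   of the tree between them. *)
Require Import Defs.
From HB Require Import structures.
From mathcomp Require Import all_boot all_order all_algebra.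
From mathcomp Require Import all_classical all_reals all_analysis.
From mathcomp Require Import ring lra zify.
From mathcomp Require Import measurable_realfun.
Set Implicit Arguments.
Unset Strict Implicit.
Unset Printing Implicit Defensive.
Import Order.TTheory GRing.Theory Num.Theory.
Import numFieldNormedType.Exports.
Local Open Scope classical_set_scope.
Local Open Scope ring_scope.

(** * Independent exponential families *)

(** Every stationary field is built from the given weights: the boundary increments of a box are the
    weights on its axes divided by [l] and [1 - l]. No further randomness is introduced, and fields
    of different rates are ordered pointwise. The price is that a field is tied to the corner of its
    box and is only close in probability to the limiting increments. The estimates therefore bound
    outer probabilities, uniformly over starting points in a cone up to distance K. For fixed K the
    corner may recede as far as needed; the bound does not depend on K, so the union over K costs
    nothing.

    Rates are compared through the mean A / l + B / (1 - l) of the stationary field over an A by B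
    rectangle. It is convex in l and, for A = B, critical at l = 1/2. Moving l by 1/m gains order A
    / m^2 in mean, linear in A, whereas fluctuations at that scale are exponentially unlikely in A.
    The same order of gain pays for a cone of opening 1/m around the diagonal.

    Equality in law then reduces to one measurable function of the weights, evaluated at two i.i.d.
    fields. *)

Lemma pi_transfer {d} {T : measurableType d} {R : realType}
    (P : probability T R) (O : pointedType) (G : set (set O)) (X Y : T -> O)
    (E F : set T) (c : R) :
  setI_closed G -> G setT -> 0 <= c -> measurable E -> measurable F ->
  (forall A, G A -> measurable (X @^-1` A) /\ measurable (Y @^-1` A)) ->
  (forall A, G A -> P (X @^-1` A `&` E) = (c%:E * P (Y @^-1` A `&` F))%E) ->
  forall A, <<s G >> A ->
    [/\ measurable (X @^-1` A), measurable (Y @^-1` A) &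
        P (X @^-1` A `&` E) = (c%:E * P (Y @^-1` A `&` F))%E].
Proof.
move=> GI GT c0 mE mF mXY XY.
have mX : measurable_fun setT (X : T -> g_sigma_algebraType G).
  apply: (@measurability _ _ T (g_sigma_algebraType G) setT X G erefl) => // _ [A GA <-]; rewrite setTI.
  by have [] := mXY _ GA.
have mY : measurable_fun setT (Y : T -> g_sigma_algebraType G).
  apply: (@measurability _ _ T (g_sigma_algebraType G) setT Y G erefl) => // _ [A GA <-]; rewrite setTI.
  by have [] := mXY _ GA.
(* Both sides are finite measures in A that agree on the pi-system G. The events E, F and the factor
   c make it possible to compare a law restricted to an event with a multiple of another restricted
   law. *)
pose m1 := pushforward (mrestr P mE) (X : T -> g_sigma_algebraType G).
pose m2 := mscale (NngNum c0)
  (pushforward (mrestr P mF) (Y : T -> g_sigma_algebraType G)).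
move=> A sA.
have mA : measurable (A : set (g_sigma_algebraType G)) by [].
split.
- by rewrite -[X in measurable X]setTI; exact: mX.
- by rewrite -[X in measurable X]setTI; exact: mY.
have := @measure_unique _ R (g_sigma_algebraType G) G (fun=> setT) erefl GI
  (fun=> GT) _ m1 (m2 mY) _ _ A mA.
rewrite /m1 /m2 /mscale /pushforward /mrestr /=; apply.
- by rewrite bigcup_const//; exists 0%N.
- exact: mX.
- by move=> B GB; exact: XY.
- move=> _; rewrite /pushforward /mrestr preimage_setT setTI.
  by rewrite (le_lt_trans (probability_le1 _ mE)) ?ltry.
Qed.

Section iidexp.
Context {d} {T : measurableType d} {R : realType} (P : probability T R).

Definition cylinder (K : eqType) (s : seq K) (A : K -> set R)
  (X : K -> T -> R) : set T := [set t | forall k, k \in s -> A k (X k t)].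

(** One product formula encodes both the exponential marginals and the independence. The index type
    is left free so that sites, quadrants and pairs of rows are handled alike. *)
Definition iidexp (K : eqType) (X : K -> T -> R) : Prop :=
  (forall k, measurable_fun setT (X k)) /\
  forall (s : seq K) (A : K -> set R), uniq s -> (forall k, measurable (A k)) ->
    P (cylinder s A X) = (\big[mule/1%E]_(k <- s) exponential_prob 1 (A k))%E.

Lemma cylinder_cons (K : eqType) k (s : seq K) A (X : K -> T -> R) :
  cylinder (k :: s) A X = X k @^-1` A k `&` cylinder s A X.
Proof.
apply/seteqP; split => t /=.
  by move=> h; split=> [|j js]; apply: h; rewrite inE ?eqxx ?js ?orbT.
by move=> [h1 h2] j; rewrite inE => /predU1P[->//|/h2].
Qed.

Lemma cylinder_bigsetI (K : eqType) (s : seq K) A (X : K -> T -> R) :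
  cylinder s A X = \big[setI/setT]_(k <- s) (X k @^-1` A k).
Proof.
elim: s => [|k s ih]; last by rewrite cylinder_cons big_cons ih.
by rewrite big_nil; apply/seteqP; split => t.
Qed.

Lemma measurable_preimage d' (U : measurableType d') (f : T -> U) A :
  measurable_fun setT f -> measurable A -> measurable (f @^-1` A).
Proof. by move=> mf mA; rewrite -[X in measurable X]setTI; exact: mf. Qed.

Lemma measurable_cylinder (K : eqType) (s : seq K) A (X : K -> T -> R) :
  (forall k, measurable_fun setT (X k)) -> (forall k, measurable (A k)) ->
  measurable (cylinder s A X).
Proof.
move=> mX mA; rewrite cylinder_bigsetI.
by apply: bigsetI_measurable => k _; exact: measurable_preimage.
Qed.

Lemma exponential_probT : exponential_prob (1 : R) setT = 1%E.
Proof. by rewrite /exponential_prob integral_exponential_pdf. Qed.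

Definition cylinders (K : eqType) (D : {pred K}) : set (set (K -> R)) :=
  [set C | exists s A, [/\ {subset s <= D}, uniq s,
     (forall k, measurable (A k)), (forall k, k \notin s -> A k = setT) &
     C = [set x | forall k, A k (x k)]]].

Lemma cylindersI (K : eqType) (D : {pred K}) : setI_closed (cylinders D).
Proof.
move=> _ _ [s1 [A1 [sD1 us1 mA1 n1 ->]]] [s2 [A2 [sD2 us2 mA2 n2 ->]]].
exists (undup (s1 ++ s2)), (fun k => A1 k `&` A2 k); split.
- by move=> k; rewrite mem_undup mem_cat => /orP[/sD1|/sD2].
- exact: undup_uniq.
- by move=> k; exact: measurableI.
- move=> k; rewrite mem_undup mem_cat negb_or => /andP[k1 k2].
  by rewrite n1// n2// setTI.
- by apply/seteqP; split=> x /=; [move=> [h1 h2] k|move=> h; split=> k; have [] := h k].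
Qed.

Lemma cylindersT (K : eqType) (D : {pred K}) : cylinders D setT.
Proof. by exists [::], (fun=> setT); split => //; apply/seteqP; split. Qed.

Lemma preimage_cylinders (K : eqType) (s : seq K) (A : K -> set R) X :
  (forall k, k \notin s -> A k = setT) ->
  [set t | forall k, A k (X k t)] = cylinder s A X.
Proof.
move=> n; apply/seteqP; split=> t /= h k; first by [].
by have [/h//|/n ->] := boolP (k \in s).
Qed.

(** The sigma-algebra lives on configurations rather than on T, so that one event can be evaluated
    at different families. *)
Definition depends_on (K : eqType) (D : {pred K}) (S : set (K -> R)) :=
  <<s cylinders D >> S.

Let ev (K : Type) (X : K -> T -> R) (t : T) (k : K) : R := X k t.

Lemma measurable_cylinders (K : eqType) (D : {pred K}) (X : K -> T -> R) A :
  (forall k, measurable_fun setT (X k)) -> cylinders D A ->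
  measurable (ev X @^-1` A).
Proof.
move=> mX [s [B [sD us mB n ->]]].
rewrite (_ : _ @^-1` _ = cylinder s B X); first exact: measurable_cylinder.
exact: preimage_cylinders.
Qed.

Lemma measurable_depends_on (K : eqType) (D : {pred K}) (X : K -> T -> R) S :
  (forall k, measurable_fun setT (X k)) -> depends_on D S ->
  measurable [set t | S (X^~ t)].
Proof.
move=> mX DS.
have [] := @pi_transfer _ _ _ P (K -> R) (cylinders D) (ev X) (ev X)
   setT setT 1 (@cylindersI K D) (@cylindersT K D) ler01 measurableT measurableT _ _ S DS => //.
- by move=> A DA; split; exact: measurable_cylinders DA.
- by move=> A DA; rewrite mul1e.
Qed.

(** For two cylinders the product formula splits, their bases being disjoint. The pi-system argument
    then extends each of the two events in turn. *)
Lemma iidexp_blocks (K : eqType) (X : K -> T -> R) (D1 D2 : {pred K}) S1 S2 :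
  iidexp X -> (forall k, k \in D1 -> k \notin D2) ->
  depends_on D1 S1 -> depends_on D2 S2 ->
  P [set t | S1 (X^~ t) /\ S2 (X^~ t)] =
  (P [set t | S1 (X^~ t)] * P [set t | S2 (X^~ t)])%E.
Proof.
move=> [mX iX] D12 DS1 DS2.
have fP S : 0 <= fine (P S) by exact: fine_ge0.
have cyl C1 C2 : cylinders D1 C1 -> cylinders D2 C2 ->
    P (ev X @^-1` C1 `&` ev X @^-1` C2) =
    (P (ev X @^-1` C1) * P (ev X @^-1` C2))%E.
  move=> [s1 [A1 [sD1 us1 mA1 n1 ->]]] [s2 [A2 [sD2 us2 mA2 n2 ->]]].
  have us : uniq (s1 ++ s2).
    rewrite cat_uniq us1 us2 andbT /=; apply/hasPn => k /sD2 k2.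
    by apply: contraL k2 => /sD1/D12.
  rewrite [X in P X = _](_ : _ = cylinder (s1 ++ s2) (fun k => A1 k `&` A2 k) X).
    have e1 : ev X @^-1` [set x | forall k, A1 k (x k)] = cylinder s1 A1 X :=
      preimage_cylinders X n1.
    have e2 : ev X @^-1` [set x | forall k, A2 k (x k)] = cylinder s2 A2 X :=
      preimage_cylinders X n2.
    rewrite e1 e2 !iX// => [|k]; last exact: measurableI.
    rewrite big_cat /=; congr (_ * _)%E; apply: eq_big_seq => k ks.
      by rewrite n2 ?setIT//; apply/negP => /sD2; apply/negP/D12/sD1.
    by rewrite n1 ?setTI//; apply/negP => /sD1/D12; rewrite sD2.
  rewrite -preimage_cylinders => [|k].
    apply/seteqP; split=> t /=; first by move=> [h1 h2] k.
    by move=> h; split => k; have [] := h k.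
  by rewrite mem_cat negb_or => /andP[k1 k2]; rewrite n1// n2// setTI.
have half C2 : cylinders D2 C2 ->
    P (ev X @^-1` S1 `&` ev X @^-1` C2) =
    (P (ev X @^-1` S1) * P (ev X @^-1` C2))%E.
  move=> DC2; have mC2 := measurable_cylinders mX DC2.
  have [] := @pi_transfer _ _ _ P (K -> R) (cylinders D1) (ev X) (ev X)
    (ev X @^-1` C2) setT (fine (P (ev X @^-1` C2)))
    (@cylindersI K D1) (@cylindersT K D1) (fP _) mC2 measurableT _ _ S1 DS1.
  - by move=> A DA; split; exact: measurable_cylinders DA.
  - by move=> A DA; rewrite setIT fineK ?fin_num_measure// muleC cyl.
  - by move=> _ _ ->; rewrite setIT fineK ?fin_num_measure// muleC.
have mS1 := measurable_depends_on mX DS1.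
have [] := @pi_transfer _ _ _ P (K -> R) (cylinders D2) (ev X) (ev X)
  (ev X @^-1` S1) setT (fine (P (ev X @^-1` S1)))
  (@cylindersI K D2) (@cylindersT K D2) (fP _) mS1 measurableT _ _ S2 DS2.
- by move=> A DA; split; exact: measurable_cylinders DA.
- by move=> A DA; rewrite setIT fineK ?fin_num_measure// setIC half.
- by move=> _ _; rewrite setIT fineK ?fin_num_measure// setIC.
Qed.

Lemma iidexp_same_law (K : eqType) (X Y : K -> T -> R) S :
  iidexp X -> iidexp Y -> depends_on predT S ->
  P [set t | S (X^~ t)] = P [set t | S (Y^~ t)].
Proof.
move=> [mX iX] [mY iY] DS.
have [] := @pi_transfer _ _ _ P (K -> R) (cylinders predT) (ev X) (ev Y)
   setT setT 1 (@cylindersI K predT) (@cylindersT K predT) ler01 measurableT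
   measurableT _ _ S DS.
- by move=> A DA; split; exact: measurable_cylinders DA.
- move=> _ [s [B [sD us mB n ->]]]; rewrite !setIT mul1e.
  have e1 : ev X @^-1` [set x | forall k, B k (x k)] = cylinder s B X :=
    preimage_cylinders X n.
  have e2 : ev Y @^-1` [set x | forall k, B k (x k)] = cylinder s B Y :=
    preimage_cylinders Y n.
  by rewrite e1 e2 iX// iY.
- by move=> _ _; rewrite !setIT mul1e.
Qed.

End iidexp.

(** * Exponential laws and transfer principles *)

Section exponential.
Context {d} {T : measurableType d} {R : realType} (P : probability T R).

Definition exp_law (X : T -> R) := measurable_fun setT X /\
  forall A, measurable A -> P (X @^-1` A) = exponential_prob 1 A.

Lemma iidexp_exp_law (K : eqType) (X : K -> T -> R) k :
  iidexp P X -> exp_law (X k).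
Proof.
move=> [mX iX]; split=> // A mA.
have := iX [:: k] (fun=> A) isT (fun=> mA).
by rewrite big_seq1 cylinder_bigsetI big_seq1.
Qed.

Lemma integral_exp_law (X : T -> R) (g : R -> R) : exp_law X ->
  measurable_fun setT g -> (forall x, 0 <= g x) ->
  (\int[P]_t (g (X t))%:E =
   \int[lebesgue_measure]_x (g x * exponential_pdf 1 x)%:E)%E.
Proof.
move=> [mX lX] mg g0.
pose X' : {mfun T >-> measurableTypeR R} :=
  HB.pack (X : T -> measurableTypeR R)
    (@isMeasurableFun.Build _ _ T (measurableTypeR R) X mX).
have mG : measurable_fun setT (EFin \o g) by exact/measurable_EFinP.
transitivity (\int[distribution P X']_x (g x)%:E)%E.
  by rewrite ge0_integral_pushforward//= => x _; rewrite lee_fin.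
(* The law of X is the integral of the exponential density, so it is absolutely continuous and its
   Radon-Nikodym derivative agrees with that density almost everywhere. *)
have dom : distribution P X' `<< (@lebesgue_measure R).
  apply/null_content_dominatesP => A mA A0.
  rewrite /distribution /pushforward lX// /exponential_prob.
  apply: (@null_set_integral _ _ _ lebesgue_measure) => //.
  by apply/measurable_EFinP/measurable_funTS; exact: measurable_exponential_pdf.
rewrite -(Radon_Nikodym_SigmaFinite.change_of_variables dom)//=.
apply: ae_eq_integral => //.
- apply: emeasurable_funM => //.
  exact: measurable_int (Radon_Nikodym_SigmaFinite.f_integrable dom).
- by apply/measurable_EFinP/measurable_funM => //; exact: measurable_exponential_pdf.
- rewrite [X in ae_eq _ _ _ X](_ : _ =
      (fun x => (g x)%:E * (exponential_pdf 1 x)%:E)%E); last first.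
    by apply/funext => x; rewrite EFinM.
  apply: ae_eqe_mul2l; apply: integral_ae_eq => //.
  + exact: Radon_Nikodym_SigmaFinite.f_integrable.
  + by apply/measurable_EFinP; exact: measurable_exponential_pdf.
  + move=> E _ mE; rewrite -Radon_Nikodym_SigmaFinite.f_integral//.
    exact: lX.
Qed.

Lemma exp_mgf (X : T -> R) (th : R) : exp_law X -> th < 1 ->
  (\int[P]_t (expR (th * X t))%:E = ((1 - th)^-1)%:E)%E.
Proof.
move=> lX th1; have th0 : 0 < 1 - th by rewrite subr_gt0.
rewrite (@integral_exp_law X (fun x => expR (th * x)))//=; last first.
- by apply: (measurableT_comp (@measurable_expR R)); exact: mulrl_measurable.
(* Exponential tilting: the factor [expR (th * x)] turns the density of rate 1 into (1 - th)^-1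
   times the density of rate 1 - th. *)
transitivity (\int[lebesgue_measure]_x
   ((1 - th)^-1%:E * (exponential_pdf (1 - th) x)%:E))%E.
  apply: eq_integral => x _; rewrite -EFinM; congr EFin.
  have [x0|x0] := ltP x 0; first by rewrite !lt0_exponential_pdf// !mulr0.
  rewrite !exponential_pdfE// mul1r mulrA mulVf ?gt_eqF// mul1r -expRD.
  by congr expR; ring.
rewrite ge0_integralZl//=; last 3 first.
- by apply/measurable_EFinP; exact: measurable_exponential_pdf.
- by move=> x _; rewrite lee_fin exponential_pdf_ge0// ltW.
- by rewrite lee_fin invr_ge0 ltW.
by rewrite integral_exponential_pdf// mule1.
Qed.

Lemma exponential_prob_gt (r x : R) : 0 < r -> 0 <= x ->
  exponential_prob r `]x, +oo[%classic = (expR (- r * x))%:E.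
Proof.
move=> r0 x0.
have p0 y : 0 <= exponential_pdf r y by exact/exponential_pdf_ge0/ltW.
have mp D : measurable_fun D (EFin \o exponential_pdf r).
  by apply/measurable_EFinP/measurable_funTS; exact: measurable_exponential_pdf.
have h : (exponential_prob r `[0%R, x] + exponential_prob r `]x, +oo[ = 1)%E.
  rewrite -(integral_exponential_pdf r0) /exponential_prob.
  have -> : [set: measurableTypeR R] = `]-oo, 0%R[%classic `|` (`[0%R, x]%classic `|` `]x, +oo[%classic).
    by apply/esym/seteqP; split => y //= _; rewrite !in_itv/= !andbT; lra.
  rewrite [RHS]ge0_integral_setU//=.
  - rewrite [in RHS]ge0_integral_setU//=.
    + rewrite [X in _ = (X + _)%E]integral0_eq ?add0e// => y.
      by rewrite /= in_itv/= => y0; rewrite lt0_exponential_pdf.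
    + exact: mp.
    + by move=> y _; rewrite lee_fin.
    + by apply/disj_setPS => y /= []; rewrite !in_itv/= andbT; lra.
  - by apply: measurableU.
  - exact: mp.
  - by move=> y _; rewrite lee_fin.
  - by apply/disj_setPS => y /= []; rewrite !in_itv/= !andbT; lra.
move: x0; rewrite le_eqVlt => /predU1P[x0|x0].
  rewrite -x0 mulr0 expR0 -[RHS]h -x0 set_itv1.
  rewrite [X in _ = (X + _)%E](@null_set_integral _ _ _ lebesgue_measure) ?add0e//.
    exact: mp.
  exact: lebesgue_measure_set1.
rewrite exponential_prob_itv0c// in h.
move: h; case: (exponential_prob r `]x, +oo[) => [p| |]; rewrite -EFinB//.
by rewrite -EFinD => -[h]; congr EFin; lra.
Qed.

Lemma exp_law_gt (X : T -> R) (x : R) : exp_law X -> 0 <= x ->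
  P [set t | x < X t] = (expR (- x))%:E.
Proof.
move=> [mX lX] x0; rewrite -(mul1r (- x)) mulrN -mulNr -exponential_prob_gt//.
rewrite -lX//; congr (P _); apply/seteqP; split=> t /=; rewrite in_itv/= andbT//.
Qed.

Lemma exp_law_lt0 (X : T -> R) : exp_law X -> P [set t | X t < 0] = 0%E.
Proof.
move=> [mX lX].
have -> : [set t | X t < 0] = X @^-1` `]-oo, 0[%classic.
  by apply/seteqP; split=> t /=; rewrite in_itv/=.
rewrite lX// /exponential_prob integral0_eq// => x /=; rewrite in_itv/= => x0.
by rewrite lt0_exponential_pdf.
Qed.

Lemma exp_law_eq (X : T -> R) (x : R) : exp_law X -> P [set t | X t = x] = 0%E.
Proof.
move=> [mX lX].
have -> : [set t | X t = x] = X @^-1` [set x].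
  by apply/seteqP; split=> t /=.
rewrite lX; last exact: measurable_set1.
rewrite /exponential_prob; apply: (@null_set_integral _ _ _ lebesgue_measure).
- exact: measurable_set1.
- by apply/measurable_EFinP/measurable_funTS; exact: measurable_exponential_pdf.
- exact: lebesgue_measure_set1.
Qed.

Lemma exp_law_ge (X : T -> R) (x : R) : exp_law X -> 0 <= x ->
  P [set t | x <= X t] = (expR (- x))%:E.
Proof.
move=> lX x0; rewrite -(exp_law_gt lX x0).
have -> : [set t | x <= X t] = [set t | x < X t] `|` [set t | X t = x].
  apply/seteqP; split=> t /=.
    by rewrite le_eqVlt => /predU1P[->|]; [right|left].
  by move=> [/ltW//|->].
have mX := lX.1.
rewrite measureU; last 3 first.
- rewrite (_ : [set _ | _] = X @^-1` `]x, +oo[%classic).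
    exact: measurable_preimage.
  by apply/seteqP; split=> t /=; rewrite in_itv/= andbT.
- rewrite (_ : [set _ | _] = X @^-1` [set x]); last by apply/seteqP; split.
  by apply: measurable_preimage => //; exact: measurable_set1.
- by apply/seteqP; split=> t //= -[+ e]; rewrite e ltxx.
by rewrite [X in (_ + X)%E]exp_law_eq// adde0.
Qed.

Definition mkmfun d' (U : measurableType d') (X : T -> U)
    (mX : measurable_fun setT X) : {mfun T >-> U} :=
  HB.pack X (@isMeasurableFun.Build _ _ T U X mX).

Definition indep2 (E : set T) (X Z : T -> R) :=
  forall A B, measurable A -> measurable B ->
  P (X @^-1` A `&` Z @^-1` B `&` E) = (P (X @^-1` A) * P (Z @^-1` B) * P E)%E.

Lemma indep2_fubini (X Z : T -> R) (S : set (R * R)) :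
  measurable_fun setT X -> measurable_fun setT Z ->
  indep2 setT Z X -> measurable S ->
  P [set t | S (Z t, X t)] = (\int[P]_t P [set s | S (Z t, X s)])%E.
Proof.
move=> mX mZ i2 mS.
pose m := distribution P (mkmfun (measurable_fun_pair mZ mX)).
pose mu := distribution P (mkmfun mX).
pose nu := distribution P (mkmfun mZ).
have e : (nu \x mu)%E S = m S.
  apply: product_measure_unique => // A B mA mB.
  have := i2 A B mA mB; rewrite setIT probability_setT mule1 => <-.
  by rewrite /m /distribution /pushforward; congr (P _); apply/seteqP; split.
transitivity (m S); first by [].
rewrite -e /product_measure1 /nu ge0_integral_pushforward//=.
  apply: eq_integral => t _ /=; rewrite /mu /distribution /pushforward.
  by congr (P _); apply/seteqP; split => s /=; rewrite ?mem_xsection ?inE /xsection/= ?inE.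
exact: measurable_fun_xsection.
Qed.

Lemma pair_transfer (X Z X' Z' : T -> R) (E F : set T) (c : R) (S : set (R * R)) :
  measurable_fun setT X -> measurable_fun setT Z ->
  measurable_fun setT X' -> measurable_fun setT Z' ->
  measurable E -> measurable F -> 0 <= c ->
  (forall A B, measurable A -> measurable B ->
    P (X @^-1` A `&` Z @^-1` B `&` E) =
    (c%:E * P (X' @^-1` A `&` Z' @^-1` B `&` F))%E) ->
  measurable S ->
  P ([set t | S (X t, Z t)] `&` E) =
  (c%:E * P ([set t | S (X' t, Z' t)] `&` F))%E.
Proof.
move=> mX mZ mX' mZ' mE mF c0 h mS.
pose G := [set A `*` B | A in (measurable : set (set R)) & B in (measurable : set (set R))].
have [] // := @pi_transfer _ _ _ P (R * R)%type G
  (fun t => (X t, Z t)) (fun t => (X' t, Z' t)) E F c _ _ c0 mE mF _ _ S.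
- move=> _ _ [A1 mA1 [B1 mB1 <-]] [A2 mA2 [B2 mB2 <-]].
  rewrite -setXI; exists (A1 `&` A2); first exact: measurableI.
  by exists (B1 `&` B2) => //; exact: measurableI.
- by exists setT => //; exists setT => //; rewrite setXTT.
- move=> _ [A mA [B mB <-]]; split.
    rewrite (_ : _ @^-1` _ = X @^-1` A `&` Z @^-1` B).
      by apply: measurableI; exact: measurable_preimage.
    by apply/seteqP; split.
  rewrite (_ : _ @^-1` _ = X' @^-1` A `&` Z' @^-1` B).
    by apply: measurableI; exact: measurable_preimage.
  by apply/seteqP; split.
- move=> _ [A mA [B mB <-]].
  by rewrite -h//; congr (P (_ `&` _)); apply/seteqP; split.
by move: mS; rewrite measurable_prod_measurableType.
Qed.

(** Closed half-lines are stable under intersection and generate the Borel sets. The full line is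
    added to the pi-system, which is where the relation between P E and P F enters. *)
Lemma ray_transfer (X Y : T -> R) (E F : set T) (c : R) (A : set R) :
  measurable_fun setT X -> measurable_fun setT Y ->
  measurable E -> measurable F -> 0 <= c -> P E = (c%:E * P F)%E ->
  (forall x, P ([set t | (x <= X t)%R] `&` E) =
    (c%:E * P ([set t | (x <= Y t)%R] `&` F))%E) ->
  measurable A ->
  P (X @^-1` A `&` E) = (c%:E * P (Y @^-1` A `&` F))%E.
Proof.
move=> mX mY mE mF c0 EF h mA.
pose G : set (set R) := [set B | B = setT \/ exists x, B = `[x, +oo[%classic].
have mG B : G B -> measurable B by move=> [->//|[x ->]].
have [] // := @pi_transfer _ _ _ P R G X Y E F c _ _ c0 mE mF _ _ A.
- move=> B1 B2 [->|[x ->]]; first by rewrite setTI.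
  move=> [->|[y ->]]; first by rewrite setIT; right; exists x.
  right; exists (Order.max x y); apply/seteqP; split => z /=;
  by rewrite !in_itv/= !andbT ge_max => /andP.
- by left.
- by move=> B /mG mB; split; exact: measurable_preimage.
- move=> B [->|[x ->]]; first by rewrite !preimage_setT !setTI.
  have e Z : Z @^-1` `[x, +oo[%classic = [set t | x <= Z t] :> set T.
    by apply/seteqP; split => t /=; rewrite in_itv/= andbT.
  by rewrite !e h.
have : (@ocitv R).-sigma.-measurable A by exact: mA.
rewrite RGenCInfty.measurableE; apply: sub_sigma_algebra2.
by move=> B [x ->]; right; exists x.
Qed.

End exponential.

(** * One cell of Burke's theorem *)

Section cell.
Context {d} {T : measurableType d} {R : realType} (P : probability T R).

Lemma measurable_ge_expR (c a : R) :
  measurable_fun setT (fun x : R => (a <= x)%R%:R * expR (- (c * x))).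
Proof.
  apply: measurable_funM; last first.
    apply: (measurableT_comp (@measurable_expR R)).
    by apply: measurableT_comp => //; exact: mulrl_measurable.
  rewrite [X in measurable_fun _ X](_ : _ = \1_(`[a, +oo[%classic)).
    exact: measurable_indic.
  by apply/funext => x; rewrite indicE mem_setE in_itv/= andbT.
Qed.

Lemma integral_exp_law_ge (V : T -> R) (c a : R) : exp_law P V -> 0 <= c -> 0 <= a ->
  (\int[P]_t ((a <= V t)%R%:R * expR (- (c * V t)))%:E =
   ((1 + c)^-1 * expR (- (1 + c) * a))%:E)%E.
Proof.
move=> lV c0 a0; have c1 : 0 < 1 + c by rewrite ltr_pwDl.
rewrite (integral_exp_law lV (measurable_ge_expR c a)); last first.
  by move=> x; rewrite mulr_ge0 ?expR_ge0.
transitivity (\int[lebesgue_measure]_(x in `[a, +oo[)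
   ((1 + c)^-1%:E * (exponential_pdf (1 + c) x)%:E))%E.
  rewrite [RHS]integral_mkcond/=; apply: eq_integral => x _.
  rewrite patchE mem_setE in_itv/= andbT.
  case: ifPn => ax; last by rewrite !mul0r.
  have x0 := le_trans a0 ax.
  rewrite !exponential_pdfE// -EFinM; congr EFin.
  rewrite !mul1r mulrA mulVf ?gt_eqF// mul1r -expRD.
  by congr expR; ring.
rewrite ge0_integralZl//=; last 3 first.
- by apply/measurable_EFinP/measurable_funTS; exact: measurable_exponential_pdf.
- by move=> x _; rewrite lee_fin exponential_pdf_ge0// ltW.
- by rewrite lee_fin invr_ge0 ltW.
rewrite -integral_itv_obnd_cbnd; last first.
  by apply/measurable_EFinP/measurable_funTS; exact: measurable_exponential_pdf.
by rewrite -[X in (_ * X)%E]/(exponential_prob (1 + c) _) exponential_prob_gt.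
Qed.

Lemma measurable_ge (x : R) (f : T -> R) : measurable_fun setT f ->
  measurable [set t | x <= f t].
Proof.
move=> mf; rewrite (_ : [set _ | _] = f @^-1` `[x, +oo[%classic).
  exact: measurable_preimage.
by apply/seteqP; split=> t /=; rewrite in_itv/= andbT.
Qed.

Lemma measurable_lt (x : R) (f : T -> R) : measurable_fun setT f ->
  measurable [set t | f t < x].
Proof.
move=> mf; rewrite (_ : [set _ | _] = f @^-1` `]-oo, x[%classic).
  exact: measurable_preimage.
by apply/seteqP; split=> t /=; rewrite in_itv/=.
Qed.

Lemma prob_eq_null (A B N : set T) : measurable A -> measurable B ->
  measurable N -> P N = 0%E -> (forall t, ~ N t -> A t <-> B t) -> P A = P B.
Proof.
move=> mA mB mN N0 AB.
have h C : measurable C -> P C = P (C `&` ~` N).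
  move=> mC; rewrite -{1}(setIT C) -(setUv N) setIUr measureU//.
  - suff CN0 : P (C `&` N) = 0%E by rewrite [X in (X + _)%E]CN0 add0e.
    apply/eqP; rewrite eq_le measure_ge0 andbT -N0.
    by apply: le_measure; rewrite ?inE//; exact: measurableI.
  - exact: measurableI.
  - by apply: measurableI => //; exact: measurableC.
  - by rewrite setIACA setICr setI0.
rewrite (h A)// (h B)//; congr (P _); apply/seteqP; split=> t [? ?]; split=> //;
by apply/AB.
Qed.

Section half.
Variables (U V : T -> R) (l1 l2 : R).
Hypotheses (lU : exp_law P U) (lV : exp_law P V) (UV : indep2 P setT V U).
Hypotheses (l10 : 0 < l1) (l20 : 0 < l2) (l12 : l1 + l2 = 1).
Let I t := U t / l1.
Let J t := V t / l2.
Let m t := Num.min (I t) (J t).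
Let dd t := I t - J t.

Let mI : measurable_fun setT I.
Proof. by apply: measurable_funM => //; exact: lU.1. Qed.
Let mJ : measurable_fun setT J.
Proof. by apply: measurable_funM => //; exact: lV.1. Qed.
Let mm : measurable_fun setT m.
Proof. exact: measurable_minr. Qed.
Let mdd : measurable_fun setT dd.
Proof. exact: measurable_funB. Qed.

(** Given V, the event asks for U to exceed l1 (J + s); integrating this tail against the law of V
    factorises because l1 + l2 = 1. The first factor is written as a tail of V, so that
    [ray_transfer] can identify the law of the minimum with that of V. *)
Let joint (u s : R) : 0 <= s ->
  P [set t | u <= J t /\ s <= dd t] =
  (P [set t | (u <= V t)%R] * (l2 * expR (- (l1 * s)))%:E)%E.
Proof.
move=> s0.
have mV0 := measurable_lt 0 lV.1; have nV0 := exp_law_lt0 lV.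
(* V is nonnegative only almost surely; truncating u at 0 gives the tail formulas the nonnegative
   argument they require. *)
pose u' := Num.max u 0.
have u'0 : 0 <= u' by rewrite le_max lexx orbT.
pose S := [set z : R * R | l2 * u' <= z.1 /\ s <= z.2 / l1 - z.1 / l2].
have mS : measurable S.
  apply: measurableI.
    by rewrite -[X in measurable X]setTI; apply: measurable_fun_le.
  rewrite -[X in measurable X]setTI; apply: measurable_fun_le => //.
  by apply: measurable_funB; apply: measurable_funM.
have e t : (l2 * u' <= V t) = (u <= J t) && (0 <= V t).
  by rewrite mulrC -ler_pdivlMr// /u' ge_max [0 <= _ / _]pmulr_lge0 ?invr_gt0.
rewrite (@prob_eq_null _ [set t | S (V t, U t)] _ _ _ mV0 nV0)//; last 3 first.
- by apply: measurableI; apply: measurable_ge.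
- exact: (measurable_preimage (measurable_fun_pair lV.1 lU.1) mS).
- move=> t /negP; rewrite -leNgt => V0.
  by rewrite /S /= e V0 andbT.
rewrite (indep2_fubini lU.1 lV.1 UV mS) /=.
transitivity (\int[P]_t ((expR (- (l1 * s)))%:E *
   ((l2 * u' <= V t)%R%:R * expR (- (l1 / l2 * V t)))%:E))%E.
  apply: eq_integral => t _ /=; rewrite /S /=.
  have [h|h] := boolP (l2 * u' <= V t); last first.
    rewrite mul0r mule0 (_ : [set _ | _] = set0) ?measure0//.
    by apply/seteqP; split=> r //= -[].
  have V0 : 0 <= V t by apply: le_trans h; rewrite mulr_ge0// ltW.
  rewrite (_ : [set _ | _] = [set r | l1 * (V t / l2 + s) <= U r]).
    rewrite (exp_law_ge lU); last first.
      by rewrite mulr_ge0 ?addr_ge0 ?divr_ge0// ltW.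
    rewrite mul1r -EFinM -expRD; congr (expR _)%:E.
    by field; rewrite !gt_eqF.
  apply/seteqP; split => r /=.
    by move=> [_]; rewrite lerBrDr addrC ler_pdivlMr// mulrC.
  by move=> h'; split=> //; rewrite lerBrDr addrC ler_pdivlMr// mulrC.
rewrite ge0_integralZl//=; last first.
  apply/measurable_EFinP.
  exact: (measurableT_comp (measurable_ge_expR (l1 / l2) (l2 * u')) lV.1).
rewrite (integral_exp_law_ge lV); last 2 first.
- by rewrite divr_ge0// ltW.
- by rewrite mulr_ge0// ltW.
have -> : P [set t | u <= V t] = (expR (- u'))%:E.
  rewrite -(exp_law_ge lV u'0).
  apply: (@prob_eq_null _ _ _ _ _ mV0 nV0); [exact: (measurable_ge u lV.1)|exact: (measurable_ge u' lV.1)|].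
  by move=> t /negP; rewrite -leNgt => V0 /=; rewrite ge_max V0 andbT.
rewrite -!EFinM; congr EFin.
have -> : 1 + l1 / l2 = l2^-1.
  by rewrite -(divff (lt0r_neq0 l20)) -mulrDl addrC l12 mul1r.
have -> : - l2^-1 * (l2 * u') = - u' by field; rewrite gt_eqF.
by rewrite invrK; ring.
Qed.

Let P_dd (s : R) : 0 <= s -> P [set t | s <= dd t] = (l2 * expR (- (l1 * s)))%:E.
Proof.
move=> s0; have := joint 0 s0.
rewrite (exp_law_ge lV (lexx 0)) oppr0 expR0 mul1e => <-.
apply: (prob_eq_null _ _ (measurable_lt 0 lV.1) (exp_law_lt0 lV)).
- exact: measurable_ge.
- by apply: measurableI; exact: measurable_ge.
- by move=> t /negP; rewrite -leNgt => V0; split => [|[]]//; split => //; rewrite divr_ge0// ltW.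
Qed.

Lemma min_diff_half (C D : set R) : measurable C -> measurable D ->
  P (m @^-1` C `&` dd @^-1` D `&` [set t | 0 <= dd t]) =
  (exponential_prob 1 C * P (dd @^-1` D `&` [set t | (0 <= dd t)%R]))%E.
Proof.
move=> mC mD.
have fP A : 0 <= fine (P A) by exact: fine_ge0.
have mE (s : R) : measurable ([set t | s <= dd t] `&` [set t | 0 <= dd t]).
  by apply: measurableI; exact: measurable_ge.
have md0 : measurable [set t | 0 <= dd t] by exact: measurable_ge.
have rayC (s : R) : P (m @^-1` C `&` ([set t | s <= dd t] `&` [set t | 0 <= dd t])) =
    (exponential_prob 1 C * P ([set t | (s <= dd t)%R] `&` [set t | (0 <= dd t)%R]))%E.
  have := @ray_transfer _ _ _ P m V _ setT _ C mm lV.1 (mE s) measurableT (fP _) _ _ mC.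
  move=> /(_ ([set t | s <= dd t] `&` [set t | 0 <= dd t])).
  rewrite fineK ?fin_num_measure// setIT probability_setT mule1 lV.2// muleC; apply => // u.
  pose s' := Num.max s 0; have s'0 : 0 <= s' by rewrite le_max lexx orbT.
  have e : [set t | s <= dd t] `&` [set t | 0 <= dd t] = [set t | s' <= dd t].
    by apply/seteqP; split=> t /=; rewrite ge_max => /andP.
  rewrite setIT e P_dd// muleC -joint//; congr (P _); apply/seteqP; split => t /=.
    move=> [h1 h2]; split=> //; by rewrite (le_trans h1)// /m ge_min lexx orbT.
  move=> [h1 h2]; split=> //; rewrite /m le_min h1 andbT (le_trans h1)//.
  by rewrite -subr_ge0 (le_trans s'0).
have fC : 0 <= fine (exponential_prob 1 C) by rewrite -lV.2.
have := @ray_transfer _ _ _ P dd dd (m @^-1` C `&` [set t | 0 <= dd t])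
  [set t | 0 <= dd t] (fine (exponential_prob 1 C)) D mdd mdd _ md0 fC _ _ mD.
have -> : (fine (exponential_prob 1 C))%:E = exponential_prob 1 C.
  rewrite -lV.2// fineK//; apply: fin_num_measure.
  exact: (measurable_preimage lV.1).
rewrite setICA setIA => -> //.
- by apply: measurableI => //; exact: measurable_preimage.
- have := rayC 0; rewrite !setIid => -> //.
- by move=> x; rewrite setICA -rayC.
Qed.

Lemma diff_ge0 : P [set t | 0 <= dd t] = l2%:E.
Proof. by rewrite P_dd// mulr0 oppr0 expR0 mulr1. Qed.

End half.

Lemma min_diff_indep (U V : T -> R) (l1 l2 : R) (C D : set R) :
  exp_law P U -> exp_law P V -> indep2 P setT V U ->
  0 < l1 -> 0 < l2 -> l1 + l2 = 1 -> measurable C -> measurable D ->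
  P ((fun t => Num.min (U t / l1) (V t / l2)) @^-1` C `&`
     (fun t => U t / l1 - V t / l2) @^-1` D) =
  (exponential_prob 1 C * P ((fun t => (U t / l1 - V t / l2)%R) @^-1` D))%E.
Proof.
move=> lU lV VU l10 l20 l12 mC mD.
set m := fun t => _; set dd := fun t => _ - _.
have UV : indep2 P setT U V.
  by move=> A B mA mB; rewrite (setIC (U @^-1` A)) VU// (muleC (P (V @^-1` B))).
have mdd : measurable_fun setT dd.
  by apply: measurable_funB; apply: measurable_funM => //; [exact: lU.1|exact: lV.1].
have mdd' : measurable_fun setT (fun t => - dd t) by exact: measurable_funN.
have mm : measurable_fun setT m.
  by apply: measurable_minr; apply: measurable_funM => //; [exact: lU.1|exact: lV.1].
have l21 : l2 + l1 = 1 by rewrite addrC.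
have eN t : V t / l2 - U t / l1 = - dd t by rewrite opprB.
have mge : measurable [set t | 0 <= dd t] by exact: measurable_ge.
have mge' : measurable [set t | 0 <= - dd t] by exact: measurable_ge.
have meq : measurable [set t | dd t = 0].
  rewrite (_ : [set _ | _] = dd @^-1` [set 0]); last by apply/seteqP; split.
  by apply: measurable_preimage => //; exact: measurable_set1.
(* The events 0 <= dd and dd <= 0 have probabilities l2 and l1, which already add up to 1, so their
   overlap is null. *)
have n0 : P [set t | dd t = 0] = 0%E.
  have h1 : P [set t | 0 <= dd t] = l2%:E := diff_ge0 lU lV VU l10 l20 l12.
  have h2 : P [set t | 0 <= - dd t] = l1%:E.
    by have := diff_ge0 lV lU UV l20 l10 l21; under eq_set do rewrite eN.
  have h3 : P (~` [set t | 0 <= dd t]) = l1%:E.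
    by rewrite probability_setC// [X in (_ - X)%E]h1 -EFinB; congr EFin; lra.
  have : P [set t | 0 <= - dd t] =
      (P (~` [set t | (0 <= dd t)%R]) + P [set t | dd t = 0%R])%E.
    rewrite -measureU//; last 2 first.
    - exact: measurableC.
    - by apply/seteqP; split=> t //= -[h h']; apply: h; rewrite h'.
    congr (P _); apply/seteqP; split=> t /=.
      rewrite oppr_ge0 le_eqVlt => /predU1P[|h]; [by right|left].
      by apply/negP; rewrite -ltNge.
    by move=> [/negP|->]; rewrite ?oppr0// -ltNge oppr_ge0 => /ltW.
  rewrite h2 [X in _ = (X + _)%E -> _]h3.
  have : P [set t | dd t = 0] \is a fin_num by exact: fin_num_measure.
  case: (P _) => // p _; rewrite -EFinD => -[h]; congr EFin; lra.
have split S : measurable S ->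
    P S = (P (S `&` [set t | (0 <= dd t)%R]) + P (S `&` [set t | (0 <= - dd t)%R]))%E.
  move=> mS; rewrite -{1}(setIT S) -(setUv [set t | 0 <= dd t]) setIUr measureU//; last 3 first.
  - exact: measurableI.
  - by apply: measurableI => //; exact: measurableC.
  - by rewrite setIACA setICr setI0.
  congr (_ + _)%E; apply: (prob_eq_null _ _ meq n0).
  - by apply: measurableI => //; exact: measurableC.
  - exact: measurableI.
  move=> t /eqP t0; rewrite /= oppr_ge0; split=> -[h1 h2]; split=> //.
    by move/negP: h2; rewrite -ltNge => /ltW.
  by apply/negP; rewrite -ltNge lt_neqAle h2 t0.
have mC' : measurable (m @^-1` C) by exact: measurable_preimage.
have mD' : measurable (dd @^-1` D) by exact: measurable_preimage.
rewrite split; last exact: measurableI.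
rewrite [in RHS]split// ge0_muleDr//; congr (_ + _)%E.
  exact: (min_diff_half lU lV VU l10 l20 l12 mC mD).
have mND : measurable ((fun x : R => - x) @^-1` D).
  by rewrite -[X in measurable X]setTI; exact: (measurable_funN (@measurable_id _ _ setT)).
have := min_diff_half lV lU UV l20 l10 l21 mC mND.
under eq_fun do rewrite minC.
have -> : (fun t => V t / l2 - U t / l1) @^-1` ((fun x : R => - x) @^-1` D) = dd @^-1` D.
  by apply/seteqP; split=> t /=; rewrite eN opprK.
have -> : [set t | 0 <= V t / l2 - U t / l1] = [set t | 0 <= - dd t].
  by apply/seteqP; split=> t /=; rewrite eN.
by move=> ->; congr (_ * P (_ `&` _))%E; apply/seteqP; split=> t /=; rewrite eN.
Qed.

(** A finite set of indices is completed to one starting with r, the added indices being constrained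
    to the full line only. *)
Lemma iidexp_on_superseq (K : eqType) (r : seq K) (Y : K -> T -> R) :
  uniq r -> (forall k, measurable_fun setT (Y k)) ->
  (forall s A, uniq (r ++ s) -> (forall k, measurable (A k)) ->
    P (cylinder (r ++ s) A Y) =
    (\big[mule/1%E]_(k <- r ++ s) exponential_prob 1 (A k))%E) ->
  iidexp P Y.
Proof.
move=> ur mY h; split=> // s A us mA.
pose s1 := [seq k <- s | k \notin r].
pose A' k := if k \in s then A k else setT.
have u1 : uniq (r ++ s1).
  rewrite cat_uniq ur filter_uniq// andbT; apply/hasPn => k /=.
  by rewrite mem_filter => /andP[].
have sub : {subset s <= r ++ s1}.
  by move=> k ks; rewrite mem_cat mem_filter ks andbT orbN.
have -> : cylinder s A Y = cylinder (r ++ s1) A' Y.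
  apply/seteqP; split=> t /= ht k kin; rewrite /A'.
    by case: ifPn => // /ht.
  by have := ht k (sub _ kin); rewrite /A' kin.
rewrite h//; last by move=> k; rewrite /A'; case: ifP.
rewrite (eq_bigr (fun k => if k \in s then exponential_prob 1 (A k) else 1%E)).
  rewrite -big_mkcond -big_filter; apply: perm_big; apply: uniq_perm => //.
    exact: filter_uniq.
  move=> k; rewrite mem_filter.
  by case: (boolP (k \in s)) => // /sub ->.
move=> k _; rewrite /A'; case: ifP => // _; exact: exponential_probT.
Qed.

Lemma measurable_coord (K : eqType) (D : {pred K}) k : k \in D ->
  measurable_fun setT
    (fun x : g_sigma_algebraType (@cylinders R K D) => x k : R).
Proof.
move=> kD _ A mA; rewrite setTI; apply: sub_sigma_algebra.
exists [:: k], (fun j => if j == k then A else setT); split => //.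
- by move=> j; rewrite inE => /eqP ->.
- by move=> j; case: ifP.
- by move=> j; rewrite inE => /negPf ->.
apply/seteqP; split => x /=; last by move/(_ k); rewrite eqxx.
by move=> Ax j; case: eqP => // ->.
Qed.

Lemma depends_on_cylinder (K : eqType) (D : {pred K}) (s : seq K) (A : K -> set R) :
  {subset s <= D} -> (forall k, measurable (A k)) ->
  depends_on D [set x | forall k, k \in s -> A k (x k)].
Proof.
move=> sD mA.
rewrite (_ : [set _ | _] = \big[setI/setT]_(k <- s) [set x : K -> R | A k (x k)]).
  rewrite big_seq.
  apply: (@bigsetI_measurable _ (g_sigma_algebraType (@cylinders R K D))) => k ks.
  by have := measurable_coord (sD _ ks) measurableT (mA k); rewrite setTI.
elim: s {sD} => [|k s ih]; first by rewrite big_nil; apply/seteqP; split.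
rewrite big_cons -ih; apply/seteqP; split=> x /=.
  by move=> h; split=> [|j js]; apply: h; rewrite inE ?eqxx ?js ?orbT.
by move=> [h1 h2] j; rewrite inE => /predU1P[->//|/h2].
Qed.

Lemma iidexp_indep2 (K : eqType) (X : K -> T -> R) a b : iidexp P X ->
  a != b -> indep2 P setT (X a) (X b).
Proof.
move=> iX ab A B mA mB; have [mX h] := iX.
rewrite setIT probability_setT mule1 (iidexp_exp_law a iX).2// (iidexp_exp_law b iX).2//.
have := h [:: a; b] (fun k => if k == a then A else B).
rewrite /= inE ab => /(_ isT); rewrite !big_cons big_nil eqxx eq_sym (negPf ab) mule1.
move=> <-; last by move=> k; case: ifP.
rewrite !cylinder_cons eqxx eq_sym (negPf ab); congr (P _).
by apply/seteqP; split=> t /=; [move=> [? ?]; split=> //; split|move=> [? []]].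
Qed.

Section cell_update.
Variables (K : eqType) (X Y : K -> T -> R) (a b c : K) (l1 l2 : R).
Hypotheses (iX : iidexp P X) (uabc : uniq [:: a; b; c]).
Hypotheses (l10 : 0 < l1) (l20 : 0 < l2) (l12 : l1 + l2 = 1).
Hypothesis YX : forall k, k \notin [:: a; b; c] -> Y k = X k.
Hypothesis Ya : Y a = fun t => l1 * (X c t + Num.max 0 (X a t / l1 - X b t / l2)).
Hypothesis Yb : Y b = fun t => l2 * (X c t + Num.max 0 (X b t / l2 - X a t / l1)).
Hypothesis Yc : Y c = fun t => Num.min (X a t / l1) (X b t / l2).

Let ab : a != b. Proof. by move: uabc; rewrite /= !inE; case: eqP. Qed.
Let ac : a != c.
Proof. by move: uabc; rewrite /= !inE negb_or => /andP[/andP[]]. Qed.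
Let bc : b != c. Proof. by move: uabc; rewrite /= !inE; case: (b == c); rewrite ?andbF. Qed.

Let mX k : measurable_fun setT (X k). Proof. exact: iX.1. Qed.

Let upd_meas d' (U : measurableType d') (x y w : U -> R) (l l' l'' : R) :
  measurable_fun setT x -> measurable_fun setT y -> measurable_fun setT w ->
  measurable_fun setT (fun t => l * (w t + Num.max 0 (x t / l' - y t / l''))).
Proof.
move=> mx my mw; apply: measurable_funM => //; apply: measurable_funD => //.
by apply: measurable_maxr => //; apply: measurable_funB; apply: measurable_funM.
Qed.

Let min_meas d' (U : measurableType d') (x y : U -> R) (l l' : R) :
  measurable_fun setT x -> measurable_fun setT y ->
  measurable_fun setT (fun t => Num.min (x t / l) (y t / l')).
Proof. by move=> mx my; apply: measurable_minr; apply: measurable_funM. Qed.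

Let mY k : measurable_fun setT (Y k).
Proof.
have [->|ka] := eqVneq k a; first by rewrite Ya; exact: upd_meas.
have [->|kb] := eqVneq k b; first by rewrite Yb; exact: upd_meas.
have [->|kc] := eqVneq k c; first by rewrite Yc; exact: min_meas.
by rewrite YX// !inE !negb_or ka kb.
Qed.

(** The minimum is independent of the difference [dd] and has the law of the weight X c, which is
    itself independent of both. Hence, on an event of [Y c], the pair (X c, dd) can be exchanged for
    (Y c, dd) at the cost of the factor [exponential_prob 1 C]. Since the minimum plus the positive
    part of the difference is the original increment, the exchange restores X a and X b. *)
Let law3 (A B C : set R) : measurable A -> measurable B -> measurable C ->
  P (Y a @^-1` A `&` (Y b @^-1` B `&` Y c @^-1` C)) =
  (exponential_prob 1 A * (exponential_prob 1 B * exponential_prob 1 C))%E.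
Proof.
move=> mA mB mC.
have [lXa lXb lXc] : [/\ exp_law P (X a), exp_law P (X b) & exp_law P (X c)].
  by split; exact: iidexp_exp_law.
pose dd t := X a t / l1 - X b t / l2.
have mdd : measurable_fun setT dd by apply: measurable_funB; apply: measurable_funM.
have UV : indep2 P setT (X b) (X a) by apply: iidexp_indep2 => //; rewrite eq_sym.
pose S := [set z : R * R | A (l1 * (z.1 + Num.max 0 z.2)) /\ B (l2 * (z.1 + Num.max 0 (- z.2)))].
have mS : measurable S.
  have m1 : measurable_fun setT (fun z : R * R => l1 * (z.1 + Num.max 0 z.2)).
    by apply: measurable_funM => //; apply: measurable_funD => //; exact: measurable_maxr.
  have m2 : measurable_fun setT (fun z : R * R => l2 * (z.1 + Num.max 0 (- z.2))).
    apply: measurable_funM => //; apply: measurable_funD => //.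
    by apply: measurable_maxr => //; exact: measurable_funN.
  rewrite (_ : S = (fun z : R * R => l1 * (z.1 + Num.max 0 z.2)) @^-1` A `&`
    (fun z : R * R => l2 * (z.1 + Num.max 0 (- z.2))) @^-1` B); last by apply/seteqP; split.
  by apply: measurableI; rewrite -[X in measurable X]setTI; [exact: m1|exact: m2].
have fC : 0 <= fine (exponential_prob 1 C).
  by rewrite -lXc.2// fine_ge0.
have eC : (fine (exponential_prob 1 C))%:E = exponential_prob 1 C.
  rewrite -lXc.2// fineK//; apply: fin_num_measure; exact: (measurable_preimage lXc.1).
have mYc : measurable (Y c @^-1` C) by exact: measurable_preimage.
have := @pair_transfer _ _ _ P (X c) dd (Y c) dd (Y c @^-1` C) setT _ S
  (mX c) mdd (mY c) mdd mYc measurableT fC _ mS.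
rewrite !setIT => h.
transitivity (P ([set t | S (X c t, dd t)] `&` Y c @^-1` C)).
  congr (P _); rewrite setIA; congr (_ `&` _).
  apply/seteqP; split=> t /=; rewrite Ya Yb /S /dd /= opprB//.
rewrite h; last first.
  move=> A' D mA' mD; rewrite eC setIT.
  rewrite {2}Yc (min_diff_indep lXa lXb UV)// -setIA.
  rewrite [LHS](_ : _ = P [set t | [set x : K -> R | A' (x c)] (X^~ t) /\
    [set x : K -> R | D (x a / l1 - x b / l2) /\ C (Num.min (x a / l1) (x b / l2))] (X^~ t)]); last first.
    by congr (P _); apply/seteqP; split=> t /=; rewrite Yc.
  rewrite (@iidexp_blocks _ _ _ P K X (mem [:: c]) (mem [:: a; b]))//.
  - rewrite (_ : [set t | _] = X c @^-1` A')// lXc.2//.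
    rewrite [X in (_ * P X)%E](_ : _ = Y c @^-1` C `&` dd @^-1` D); last first.
      by apply/seteqP; split=> t /=; rewrite Yc => -[? ?]; split.
    by rewrite Yc (min_diff_indep lXa lXb UV)// muleCA.
  - by move=> k; rewrite !inE => /eqP ->; rewrite !(eq_sym c) (negPf ac) (negPf bc).
  - have := measurable_coord (D := mem [:: c]) (mem_head c [::]) measurableT mA'.
    by rewrite setTI.
  - have ma : measurable_fun setT (fun x : g_sigma_algebraType (@cylinders R K (mem [:: a; b])) => x a : R).
      by apply: measurable_coord; rewrite mem_head.
    have mb : measurable_fun setT (fun x : g_sigma_algebraType (@cylinders R K (mem [:: a; b])) => x b : R).
      by apply: measurable_coord; rewrite !inE eqxx orbT.
    apply: (@measurableI _ (g_sigma_algebraType (@cylinders R K (mem [:: a; b])))).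
      rewrite -[X in measurable X]setTI.
      by apply: (measurable_funB (measurable_funM ma (measurable_cst l1^-1)) (measurable_funM mb (measurable_cst l2^-1))).
    by rewrite -[X in measurable X]setTI; apply: (min_meas l1 l2 ma mb).
rewrite eC (_ : [set t | _] = X a @^-1` A `&` X b @^-1` B).
  have := iidexp_indep2 iX ab mA mB; rewrite setIT probability_setT mule1 => ->.
  by rewrite lXa.2// lXb.2// muleC -muleA.
have min_max (x y : R) : Num.min x y + Num.max 0 (x - y) = x.
  by case: (leP x y) => xy; case: (leP 0 (x - y)) => xy'; lra.
have e1 t : l1 * (Y c t + Num.max 0 (dd t)) = X a t.
  by rewrite Yc /dd min_max mulrC divfK// gt_eqF.
have e2 t : l2 * (Y c t + Num.max 0 (- dd t)) = X b t.
  by rewrite Yc /dd opprB minC min_max mulrC divfK// gt_eqF.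
by apply/seteqP; split=> t /=; rewrite /S /= e1 e2.
Qed.

Lemma iidexp_cell_update : iidexp P Y.
Proof.
apply: (iidexp_on_superseq uabc mY) => s A us mA.
pose D := mem [:: a; b; c].
pose S1 := [set x : K -> R |
  [/\ A a (l1 * (x c + Num.max 0 (x a / l1 - x b / l2))),
     A b (l2 * (x c + Num.max 0 (x b / l2 - x a / l1))) &
     A c (Num.min (x a / l1) (x b / l2))]].
pose S2 := [set x : K -> R | forall k, k \in s -> A k (x k)].
have sD k : k \in s -> k \in predC D.
  by move=> ks; move: us; rewrite cat_uniq => /and3P[_ /hasPn/(_ k ks)].
rewrite [LHS](_ : _ = P [set t | S1 (X^~ t) /\ S2 (X^~ t)]); last first.
  congr (P _); rewrite /= !cylinder_cons Ya Yb Yc; apply/seteqP; split => t /=.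
    move=> [h1 [h2 [h3 h4]]]; split => // k ks.
    by rewrite -(YX (sD _ ks)); apply: h4.
  move=> [[h1 h2 h3] h4]; do 3 split=> //; move=> k ks.
  by rewrite (YX (sD _ ks)); apply: h4.
have cs k : k \in [:: a; b; c] -> measurable_fun setT
    (fun x : g_sigma_algebraType (@cylinders R K D) => x k : R).
  by move=> h; exact: measurable_coord.
have ma := cs a (mem_head _ _).
have mb : measurable_fun setT (fun x : g_sigma_algebraType (@cylinders R K D) => x b : R).
  by apply: cs; rewrite !inE eqxx orbT.
have mc : measurable_fun setT (fun x : g_sigma_algebraType (@cylinders R K D) => x c : R).
  by apply: cs; rewrite !inE eqxx !orbT.
rewrite (@iidexp_blocks _ _ _ P K X D (predC D))//.
- rewrite /= !big_cons.
  rewrite [X in (X * _)%E](_ : _ = P (Y a @^-1` A a `&` (Y b @^-1` A b `&` Y c @^-1` A c))); last first.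
    congr (P _); rewrite Ya Yb Yc; apply/seteqP; split => t /=.
      by move=> [h1 h2 h3].
    by move=> [h1 [h2 h3]].
  rewrite law3// !muleA; congr (_ * _)%E.
  by rewrite -(iX.2 s A)//; move: us; rewrite cat_uniq => /and3P[].
- by move=> k kD; rewrite inE /= negbK.
- rewrite /depends_on (_ : S1 = [set x | A a (l1 * (x c + Num.max 0 (x a / l1 - x b / l2)))] `&`
     ([set x | A b (l2 * (x c + Num.max 0 (x b / l2 - x a / l1)))] `&`
      [set x | A c (Num.min (x a / l1) (x b / l2))])); last first.
    by apply/seteqP; split=> x /=; [move=> []|move=> [? []]; split].
  apply: (@measurableI _ (g_sigma_algebraType (@cylinders R K D))).
    by rewrite -[X in measurable X]setTI; apply: (upd_meas l1 l1 l2 ma mb mc).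
  apply: (@measurableI _ (g_sigma_algebraType (@cylinders R K D))).
    by rewrite -[X in measurable X]setTI; apply: (upd_meas l2 l2 l1 mb ma mc).
  by rewrite -[X in measurable X]setTI; apply: (min_meas l1 l2 ma mb).
- exact: depends_on_cylinder.
Qed.

End cell_update.

End cell.

(** * Last passage fields and Burke's theorem *)

Section field.
Context {R : realType}.
Implicit Types (u v : nat -> R) (w : nat -> nat -> R).

(** The recursion along one row, split off so that [lpp] recurses on the row index alone. *)
Fixpoint next_row (prev w : nat -> R) (a : R) (i : nat) : R :=
  if i is i'.+1 then w i' + Num.max (next_row prev w a i') (prev i) else a.

(* u and v are the increments along the two axes, and w i j sits at the point
   (i + 1, j + 1). *)
Fixpoint lpp u v w (i j : nat) {struct j} : R :=
  if j is j'.+1 then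
    next_row (fun i' => lpp u v w i' j') (fun i' => w i' j') (lpp u v w 0 j' + v j') i
  else \sum_(k < i) u k.

Definition hinc u v w i j := lpp u v w i.+1 j - lpp u v w i j.
Definition vinc u v w i j := lpp u v w i j.+1 - lpp u v w i j.

Lemma lpp00 u v w : lpp u v w 0 0 = 0.
Proof. by rewrite /= big_ord0. Qed.

Lemma lppS0 u v w i : lpp u v w i.+1 0 = lpp u v w i 0 + u i.
Proof. by rewrite /= big_ord_recr. Qed.

Lemma lpp0S u v w j : lpp u v w 0 j.+1 = lpp u v w 0 j + v j.
Proof. by []. Qed.

Lemma lppSS u v w i j :
  lpp u v w i.+1 j.+1 = w i j + Num.max (lpp u v w i j.+1) (lpp u v w i.+1 j).
Proof. by []. Qed.

Lemma hinc0 u v w i : hinc u v w i 0 = u i.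
Proof. by rewrite /hinc lppS0 addrAC subrr add0r. Qed.

Lemma vinc0 u v w j : vinc u v w 0 j = v j.
Proof. by rewrite /vinc lpp0S addrAC subrr add0r. Qed.

(** Together with [vincS], this is the cell map whose invariance is [iidexp_cell_update]. *)
Lemma hincS u v w i j :
  hinc u v w i j.+1 = w i j + Num.max 0 (hinc u v w i j - vinc u v w i j).
Proof.
rewrite /hinc /vinc lppSS; move: (lpp _ _ _ i.+1 j) (lpp _ _ _ i j.+1) => a b.
by case: (leP b a) => ab; case: (leP 0) => h; lra.
Qed.

Lemma vincS u v w i j :
  vinc u v w i.+1 j = w i j + Num.max 0 (vinc u v w i j - hinc u v w i j).
Proof.
rewrite /hinc /vinc lppSS; move: (lpp _ _ _ i.+1 j) (lpp _ _ _ i j.+1) => a b.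
by case: (leP b a) => ab; case: (leP 0) => h; lra.
Qed.

Lemma lpp_ext u v w u' v' w' m n :
  (forall i, (i < m)%N -> u i = u' i) -> (forall j, (j < n)%N -> v j = v' j) ->
  (forall i j, (i < m)%N -> (j < n)%N -> w i j = w' i j) ->
  forall i j, (i <= m)%N -> (j <= n)%N -> lpp u v w i j = lpp u' v' w' i j.
Proof.
move=> eu ev ew i j; elim: j i => [|j ihj].
  by elim=> [|i ihi] im _; rewrite ?lpp00// !lppS0 ihi ?eu// ltnW.
elim=> [|i ihi] im jn; first by rewrite !lpp0S ihj ?ev// ltnW.
by rewrite !lppSS ihi ?ihj ?ew// ltnW.
Qed.

(** Each outgoing increment in [hincS] and [vincS] is nondecreasing in the incoming increment of its
    own direction and nonincreasing in the other one, so the order on the boundary propagates cell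
    by cell. *)
Lemma inc_monotone u v u' v' w m n :
  (forall i, (i < m)%N -> u' i <= u i) -> (forall j, (j < n)%N -> v j <= v' j) ->
  forall i j,
  ((i < m)%N -> (j <= n)%N -> hinc u' v' w i j <= hinc u v w i j) /\
  ((i <= m)%N -> (j < n)%N -> vinc u v w i j <= vinc u' v' w i j).
Proof.
move=> hu hv i j; elim: j i => [|j ihj].
  elim=> [|i [ihh ihv]]; split; rewrite ?hinc0 ?vinc0 ?vincS.
  - by move=> h _; exact: hu.
  - by move=> _ h; exact: hv.
  - by move=> h _; exact: hu.
  - move=> im n0; rewrite lerD2l !hinc0.
    have := hu _ im; have := ihv (ltnW im) n0.
    move: (vinc _ _ _ i 0) (vinc _ _ _ i 0) => a b ba uu.
    by rewrite ge_max !le_max lexx/=; apply/orP; right; lra.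
have hstep i : (forall i0, ((i0 < m)%N -> (j <= n)%N -> hinc u' v' w i0 j <= hinc u v w i0 j)) ->
   ((i <= m)%N -> (j < n)%N -> vinc u v w i j <= vinc u' v' w i j) ->
   (i < m)%N -> (j.+1 <= n)%N -> hinc u' v' w i j.+1 <= hinc u v w i j.+1.
  move=> hh hvv im jn; rewrite !hincS lerD2l.
  have h1 := hh _ im (ltnW jn); have h2 := hvv (ltnW im) jn.
  by rewrite ge_max !le_max lexx/=; apply/orP; right; lra.
have hj i0 := (ihj i0).1.
elim=> [|i [ihh ihv]]; split.
- by apply: hstep => //; exact: (ihj 0%N).2.
- by rewrite !vinc0 => _; exact: hv.
- by apply: hstep => //; exact: (ihj i.+1).2.
- move=> im jn; rewrite !vincS lerD2l.
  have h1 := ihh im (ltnW jn); have h2 := ihv (ltnW im) jn.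
  by rewrite ge_max !le_max lexx/=; apply/orP; right; lra.
Qed.

Lemma lpp_transpose u v w i j : lpp v u (fun a b => w b a) j i = lpp u v w i j.
Proof.
elim: j i => [|j ihj].
  by elim=> [|i ihi]; rewrite ?lpp00// lppS0 lpp0S ihi.
elim=> [|i ihi]; first by rewrite lppS0 lpp0S ihj.
by rewrite !lppSS ihi ihj maxC.
Qed.

Lemma lpp_shift u v w a b i j :
  lpp u v w (a + i) (b + j) = lpp u v w a b +
  lpp (fun k => hinc u v w (a + k) b) (fun k => vinc u v w a (b + k))
      (fun k l => w (a + k)%N (b + l)%N) i j.
Proof.
elim: j i => [|j ihj].
  elim=> [|i ihi]; first by rewrite lpp00 !addn0 addr0.
  by rewrite lppS0 addrA -ihi addnS /hinc addn0 addrC subrK.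
elim=> [|i ihi].
  by rewrite lpp0S addrA -ihj addnS /vinc addn0 addrC subrK.
by rewrite [in RHS]lppSS addrCA addr_maxr -ihi -ihj !addnS lppSS.
Qed.

Lemma hinc_ge u v w i j : w i j <= hinc u v w i j.+1.
Proof. by rewrite hincS lerDl le_max lexx. Qed.

Lemma vinc_ge u v w i j : w i j <= vinc u v w i.+1 j.
Proof. by rewrite vincS lerDl le_max lexx. Qed.

End field.

Section burke.
Context {d} {T : measurableType d} {R : realType} (P : probability T R).
Variables (K : eqType) (key : nat * nat -> K) (unkey : K -> option (nat * nat)).
Hypothesis keyK : pcancel key unkey.
Hypothesis unkeyK : forall k p, unkey k = Some p -> key p = k.
Variables (X : K -> T -> R) (l1 l2 : R).
Hypotheses (iX : iidexp P X) (l10 : 0 < l1) (l20 : 0 < l2) (l12 : l1 + l2 = 1).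

Definition bdry1 t i := X (key (i.+1, 0%N)) t / l1.
Definition bdry2 t j := X (key (0%N, j.+1)) t / l2.
Definition bulk t i j := X (key (i.+1, j.+1)) t.

Let I t i j := hinc (bdry1 t) (bdry2 t) (bulk t) i j.
Let J t i j := vinc (bdry1 t) (bdry2 t) (bulk t) i j.

(* The family after the cells of the first j rows, and the first i0 cells of the
   next row, of an m-column box have been processed. *)
Definition burke_state (m j i0 : nat) (p : nat * nat) (t : T) : R :=
  match p with
  | (0%N, 0%N) => X (key (0%N, 0%N)) t
  | (i.+1, 0%N) => l1 * I t i (if (i < m)%N then (j + (i < i0))%N else 0%N)
  | (0%N, j'.+1) =>
      l2 * J t (if (j' < j)%N then m else if j' == j then i0 else 0%N) j'
  | (i.+1, j'.+1) =>
      if (i < m)%N && ((j' < j)%N || (j' == j) && (i < i0)%N)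
      then Num.min (I t i j') (J t i j') else bulk t i j'
  end.

Definition burke_family m j i0 (k : K) : T -> R :=
  if unkey k is Some p then burke_state m j i0 p else X k.

Lemma burke_family_key m j i0 p :
  burke_family m j i0 (key p) = burke_state m j i0 p.
Proof. by rewrite /burke_family keyK. Qed.

(** Key (i + 1, 0) holds the current horizontal increment of column i, key (0, j + 1) the current
    vertical increment of row j, and an inner key the weight or, once its cell is passed, the
    minimum. Processing a cell rewrites exactly three keys by the map of [iidexp_cell_update]. *)
Let step m j i0 : (i0 < m)%N -> iidexp P (burke_family m j i0) ->
  iidexp P (burke_family m j i0.+1).
Proof.
move=> im h.
apply: (@iidexp_cell_update _ _ _ P K (burke_family m j i0) _
  (key (i0.+1, 0%N)) (key (0%N, j.+1)) (key (i0.+1, j.+1)) l1 l2) => //.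
- by rewrite /= !inE !(inj_eq (pcan_inj keyK)) !xpair_eqE /= eqxx.
- move=> k; rewrite !inE /burke_family.
  case e : (unkey k) => [[[|i] [|j']]|]//; rewrite -(unkeyK e) !(inj_eq (pcan_inj keyK)) !xpair_eqE /= ?eqSS ?andbT ?orbF ?andbF.
  + by move=> /negPf jj; apply/funext => t /=; rewrite jj.
  + move=> ij; apply/funext => t /=; case: ifP => // i_m; congr (_ * I t _ (_ + _)).
    by rewrite ltnS leq_eqVlt; move: ij; rewrite orbF => /negPf ->.
  + rewrite negb_and => ij; apply/funext => t /=; congr (if _ then _ else _).
    by rewrite ltnS (leq_eqVlt i); move: ij; case: (i == i0); case: (j' == j).
- apply/funext => t; rewrite !burke_family_key /= !eqxx !ltnn !ltnSn im /= addn1 addn0.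
  by rewrite ![_ * _ / _]mulrAC !divff ?gt_eqF// !mul1r -hincS.
- apply/funext => t; rewrite !burke_family_key /= !eqxx !ltnn im /= addn0.
  by rewrite ![_ * _ / _]mulrAC !divff ?gt_eqF// !mul1r -vincS.
- apply/funext => t; rewrite !burke_family_key /= !eqxx !ltnn ltnSn im /= addn0.
  by rewrite ![_ * _ / _]mulrAC !divff ?gt_eqF// !mul1r.
Qed.

Let start m : burke_family m 0 0 = X.
Proof.
apply/funext => k; apply/funext => t; rewrite /burke_family.
case e : (unkey k) => [[[|i] [|j']]|]//; rewrite -(unkeyK e) /burke_state.
- by [].
- by rewrite /= if_same /J vinc0 /bdry2 mulrC divfK// gt_eqF.
- by rewrite /= add0n; case: ifP; rewrite /I hinc0 /bdry1 mulrC divfK// gt_eqF.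
- by rewrite ltn0 andbF /= andbF.
Qed.

Let newrow m j : burke_family m j m = burke_family m j.+1 0.
Proof.
apply/funext => k; apply/funext => t; rewrite /burke_family.
case e : (unkey k) => [[[|i] [|j']]|]//; rewrite /burke_state.
- congr (_ * J t _ _).
  by rewrite [(j' < j.+1)%N]ltnS [(j' <= j)%N]leq_eqVlt; case: (j' == j); case: (j' < j)%N => //=; rewrite if_same.
- by case im : (i < m)%N; rewrite ?ltn0 /= ?addn0 ?addn1.
- congr (if _ then _ else _); case im : (i < m)%N => //=.
  by rewrite ltn0 andbF orbF andbT [(j' < j.+1)%N]ltnS [(j' <= j)%N]leq_eqVlt orbC.
Qed.

Theorem burke m n : iidexp P (burke_family m n 0).
Proof.
elim: n => [|n ih]; first by rewrite start.
rewrite -newrow.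
suff : forall i, (i <= m)%N -> iidexp P (burke_family m n i) by apply.
by elim=> // i ihi im; apply: step => //; apply: ihi; exact: ltnW.
Qed.

End burke.

(** * Deviations and convergence in probability *)

Section chernoff.
Context {d} {T : measurableType d} {R : realType} (P : probability T R).

Lemma indep2_integralM (X Z : T -> R) (f g : R -> R) :
  measurable_fun setT X -> measurable_fun setT Z -> indep2 P setT Z X ->
  measurable_fun setT f -> measurable_fun setT g ->
  (forall x, 0 <= f x) -> (forall x, 0 <= g x) ->
  (\int[P]_t (f (X t) * g (Z t))%:E =
   (\int[P]_t (f (X t))%:E) * (\int[P]_t (g (Z t))%:E))%E.
Proof.
move=> mX mZ i2 mf mg f0 g0.
pose m := distribution P (mkmfun (measurable_fun_pair mZ mX)).
pose mu := distribution P (mkmfun mX).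
pose nu := distribution P (mkmfun mZ).
have e S : measurable S -> (nu \x mu)%E S = m S.
  move=> mS; apply: product_measure_unique => // A B mA mB.
  have := i2 A B mA mB; rewrite setIT probability_setT mule1 => <-.
  by rewrite /m /distribution /pushforward; congr (P _); apply/seteqP; split.
pose F (z : R * R) := (f z.2 * g z.1)%:E.
have mF : measurable_fun setT F.
  apply/measurable_EFinP; apply: measurable_funM.
    exact: (measurableT_comp mf measurable_snd).
  exact: (measurableT_comp mg measurable_fst).
have F0 z : (0 <= F z)%E by rewrite lee_fin mulr_ge0.
transitivity (\int[m]_z F z)%E; first by rewrite ge0_integral_pushforward.
transitivity (\int[(nu \x mu)%E]_z F z)%E.
  by apply: eq_measure_integral => A mA _; exact/esym/e.
rewrite fubini_tonelli1//= /fubini_F /F /=.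
have mf' : measurable_fun setT (EFin \o f) by exact/measurable_EFinP.
have mg' : measurable_fun setT (EFin \o g) by exact/measurable_EFinP.
transitivity (\int[nu]_x ((\int[mu]_y (f y)%:E) * (g x)%:E))%E.
  apply: eq_integral => x _; under eq_integral do rewrite EFinM muleC.
  by rewrite [LHS]ge0_integralZl//=; do ?[by rewrite muleC|by move=> y _; rewrite lee_fin|by rewrite lee_fin].
rewrite ge0_integralZl//; last 2 first.
- by move=> y _; rewrite lee_fin.
- by apply: integral_ge0 => y _; rewrite lee_fin.
rewrite /mu /nu !ge0_integral_pushforward//; by move=> y _; rewrite lee_fin.
Qed.

Lemma measurable_sum_coord (K : eqType) (D : {pred K}) (s : seq K) :
  {subset s <= D} ->
  measurable_fun setT
    (fun x : g_sigma_algebraType (@cylinders R K D) => \sum_(k <- s) x k : R).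
Proof.
elim: s => [|k s ih] sD.
  rewrite (_ : (fun _ => _) = cst 0); first exact: measurable_cst.
  by apply/funext => x; rewrite big_nil.
rewrite (_ : (fun _ => _) = (fun x : g_sigma_algebraType (@cylinders R K D) =>
   (x k : R) + \sum_(j <- s) x j)); last by apply/funext => x; rewrite big_cons.
apply: measurable_funD; first by apply: measurable_coord; apply: sD; rewrite mem_head.
by apply: ih => j js; apply: sD; rewrite inE js orbT.
Qed.

Lemma iidexp_sum_mgf (K : eqType) (X : K -> T -> R) (s : seq K) (th : R) :
  iidexp P X -> uniq s -> th < 1 ->
  (\int[P]_t (expR (th * \sum_(k <- s) X k t))%:E = ((1 - th)^-1 ^+ size s)%:E)%E.
Proof.
move=> iX us th1; have mX := iX.1.
have me : measurable_fun setT (fun x : R => expR (th * x)).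
  by apply: (measurableT_comp (@measurable_expR R)); exact: mulrl_measurable.
elim: s us => [_|k s ih /= /andP[ks us]].
  under eq_integral do rewrite big_nil mulr0 expR0.
  by rewrite expr0 integral_cst//= mul1e; exact: probability_setT.
transitivity (\int[P]_t (expR (th * X k t) * expR (th * \sum_(j <- s) X j t))%:E)%E.
  by apply: eq_integral => t _; rewrite big_cons mulrDr expRD.
rewrite (@indep2_integralM (X k) (fun t => \sum_(j <- s) X j t)
  (fun x => expR (th * x)) (fun x => expR (th * x)))//.
- by rewrite ih// (exp_mgf (iidexp_exp_law k iX))// -EFinM exprS.
- exact: measurable_sum.
- move=> A B mA mB.
  rewrite setIT probability_setT mule1.
  rewrite [LHS](_ : _ = P [set t | [set x : K -> R | A (\sum_(j <- s) x j)] (X^~ t) /\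
    [set x : K -> R | B (x k)] (X^~ t)])//.
  rewrite (@iidexp_blocks _ _ _ P K X (mem s) (mem [:: k]))//.
  + by move=> j js; rewrite !inE; apply: contra ks => /eqP <-.
  + rewrite /depends_on -[X in _ X]setTI.
    exact: (@measurable_sum_coord K (mem s) s _ measurableT).
  + rewrite /depends_on -[X in _ X]setTI.
    by apply: (@measurable_coord _ K (mem [:: k]) k _ measurableT) => //; rewrite !inE.
Qed.

Lemma inv1B_le_expR (u : R) : `|u| <= 4^-1 -> (1 - u)^-1 <= expR (u + u ^+ 2).
Proof.
rewrite ler_norml => /andP[u1 u2].
have u0 : 0 < 1 - u by lra.
rewrite -[X in X <= _]mul1r ler_pdivrMr//.
(* The bound 1 + z <= exp z at z = u + u^2 is too weak for u > 0, since (1 + u + u^2)(1 - u) = 1 -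
   u^3. Applied at z / 2 and squared, it suffices. *)
pose y := (u + u ^+ 2) / 2.
have e : expR (u + u ^+ 2) = expR y ^+ 2.
  by rewrite -expRM_natl; congr expR; rewrite /y; field.
have y1 : 0 <= 1 + y by rewrite /y; nra.
have ey : (1 + y) ^+ 2 <= expR y ^+ 2.
  by rewrite ler_sqr ?nnegrE ?expR_ge0// expR_ge1Dx.
apply: (@le_trans _ _ ((1 + y) ^+ 2 * (1 - u))); last by rewrite ler_pM2r// e.
have -> : (1 + y) ^+ 2 * (1 - u) = 1 + u ^+ 2 * ((1 - u) * (1 + u) ^+ 2 / 4 - u).
  by rewrite /y; field.
rewrite lerDl mulr_ge0 ?sqr_ge0//.
have : 0 <= 4^-1 - u by lra.
have : 0 <= u + 4^-1 by lra.
nra.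
Qed.

(** Markov's inequality for the exponential moment. A positive th controls upper deviations, a
    negative one lower deviations. *)
Lemma iidexp_chernoff (K : eqType) (X : K -> T -> R) (s : seq K) (th tau : R) :
  iidexp P X -> uniq s -> `|th| <= 4^-1 ->
  (P [set t | (tau <= th * \sum_(k <- s) X k t)%R] <=
   (expR (- tau + (size s)%:R * (th + th ^+ 2)))%:E)%E.
Proof.
move=> iX us hth; have mX := iX.1.
have th1 : th < 1 by move: hth; rewrite ler_norml => /andP[]; lra.
set D := [set t | _].
have mZ : measurable_fun setT (fun t => th * \sum_(k <- s) X k t).
  by apply: measurable_funM => //; exact: measurable_sum.
have mD : measurable D by exact: measurable_ge.
have me : measurable_fun setT (fun t => (expR (th * \sum_(k <- s) X k t))%:E).
  by apply/measurable_EFinP; exact: (measurableT_comp (@measurable_expR R) mZ).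
have h : ((expR tau)%:E * P D <= ((1 - th)^-1 ^+ size s)%:E)%E.
  rewrite -(iidexp_sum_mgf iX us th1) -integral_cst//.
  apply: (@le_trans _ _ (\int[P]_(t in D) (expR (th * \sum_(k <- s) X k t))%:E)%E).
    apply: ge0_le_integral => //.
    - by move=> t _ /=; rewrite lee_fin expR_ge0.
    - exact: measurable_funTS.
    - by move=> t Dt /=; rewrite lee_fin ler_expR.
  by apply: ge0_subset_integral => // t _; rewrite lee_fin expR_ge0.
have -> : P D = ((expR (- tau))%:E * ((expR tau)%:E * P D))%E.
  by rewrite muleA -EFinM -expRD addNr expR0 mul1e.
rewrite expRD EFinM; apply: (le_trans (lee_wpmul2l _ h)).
  by rewrite lee_fin expR_ge0.
rewrite -!EFinM lee_fin ler_pM2l ?expR_gt0// expRM_natl.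
by rewrite lerXn2r ?nnegrE ?invr_ge0 ?expR_ge0 ?inv1B_le_expR// subr_ge0 ltW.
Qed.

End chernoff.

(** * Bounds on outer probability and limits in probability *)

Section small.
Context {d} {T : measurableType d} {R : realType} (P : probability T R).

(** A bound on outer probability: bad events given by existential statements can be estimated
    without a proof of their measurability. *)
Definition small (e : R) (B : set T) :=
  exists E, [/\ measurable E, B `<=` E & (P E <= e%:E)%E].

Lemma small_sub e B C : C `<=` B -> small e B -> small e C.
Proof. by move=> CB [E [mE BE PE]]; exists E; split=> //; exact: subset_trans BE. Qed.

Lemma small_le e e' B : e <= e' -> small e B -> small e' B.
Proof.
move=> ee [E [mE BE PE]]; exists E; split=> //.
by rewrite (le_trans PE)// lee_fin.
Qed.

Lemma smallU e1 e2 B C : small e1 B -> small e2 C -> small (e1 + e2) (B `|` C).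
Proof.
move=> [E [mE BE PE]] [F [mF CF PF]]; exists (E `|` F); split.
- exact: measurableU.
- exact: setUSS.
- by rewrite (le_trans (measureU2 P mE mF))// EFinD leeD.
Qed.

Lemma small_measurable e B : measurable B -> (P B <= e%:E)%E -> small e B.
Proof. by move=> mB PB; exists B; split. Qed.

Lemma small_bigcup_seq (I : eqType) (s : seq I) (e : I -> R) (B : I -> set T) :
  (forall i, i \in s -> small (e i) (B i)) ->
  small (\sum_(i <- s) e i) [set t | exists2 i, i \in s & B i t].
Proof.
elim: s => [|i s ih] h.
  rewrite big_nil; exists set0; split => //; last by rewrite measure0.
  by move=> t [].
rewrite big_cons; apply: small_sub (smallU (h i (mem_head _ _)) (ih _)).
  move=> t [j]; rewrite inE => /predU1P[->|js] Bj; [by left|right].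
  by exists j.
by move=> j js; apply: h; rewrite inE js orbT.
Qed.

Lemma small_negligible B : (forall e, 0 < e -> small e B) -> P.-negligible B.
Proof.
move=> h; have h' n : exists E, [/\ measurable E, B `<=` E & (P E <= (n.+1%:R^-1)%:E)%E].
  by apply: h; rewrite invr_gt0.
have [E hE] := choice h'.
exists (\bigcap_n E n); split.
- by apply: bigcapT_measurable => n; have [] := hE n.
- apply/eqP; rewrite eq_le measure_ge0 andbT.
  apply/lee_addgt0Pr => e e0; rewrite add0e.
  have [n _ /(_ _ (leqnn n)) /= ne] := near_infty_natSinv_lt (PosNum e0).
  have [mE BE PE] := hE n.
  apply: (@le_trans _ _ (P (E n))).
    apply: le_measure; rewrite ?inE//; last exact: bigcap_inf.
    by apply: bigcapT_measurable => k; have [] := hE k.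
  by rewrite (le_trans PE)// lee_fin ltW.
- by move=> t Bt n _; have [_ BE _] := hE n; exact: BE.
Qed.

Lemma negligible_small B e : 0 <= e -> P.-negligible B -> small e B.
Proof. by move=> e0 [E [mE PE BE]]; exists E; split=> //; rewrite PE lee_fin. Qed.

Lemma small_bigcup (e : R) (B : nat -> set T) :
  {homo B : m n / (m <= n)%N >-> m `<=` n} -> (forall n, small e (B n)) ->
  small e (\bigcup_n B n).
Proof.
move=> mono h; have [E hE] := choice h.
(* The covers E k need not increase with k. The intersections of their tails do, and they still
   contain B n by monotonicity. *)
pose F n := \bigcap_(k in [set k | (n <= k)%N]) E k.
have mF n : measurable (F n).
  by apply: bigcap_measurableType => k _; have [] := hE k.
have mU : measurable (\bigcup_n F n) by exact: bigcupT_measurable.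
exists (\bigcup_n F n); split=> //.
  move=> t [n _ Bt]; exists n => // k /= nk.
  by have [_ + _] := hE k; apply; exact: mono nk _ Bt.
have F_nd : {homo F : n m / (n <= m)%N >-> (n <= m)%O}.
  move=> n m nm; apply/subsetPset => t Ft k /= mk; apply: Ft => /=.
  exact: leq_trans mk.
have cF : P \o F @ \oo --> P (\bigcup_n F n) := nondecreasing_cvg_mu mF mU F_nd.
rewrite -(cvg_lim _ cF)//; apply: lime_le; first by apply: cvgP; exact: cF.
apply: nearW => n /=; have [mE _ PE] := hE n.
apply: le_trans PE; apply: le_measure; rewrite ?inE//.
by apply: bigcap_inf => /=.
Qed.

Lemma prob_le_small (A B : set T) (e : R) (C : set T) : measurable A -> measurable B ->
  small e C -> (forall t, A t -> ~ C t -> B t) -> (P A <= P B + e%:E)%E.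
Proof.
move=> mA mB [E [mE CE PE]] h.
apply: (@le_trans _ _ (P (B `|` E))).
  apply: le_measure; rewrite ?inE//; first exact: measurableU.
  by move=> t At; have [Et|nE] := pselect (E t); [right|left; apply: h => // /CE].
by rewrite (le_trans (measureU2 P mB mE))// leeD2l.
Qed.

Definition cvg_in_prob (Y : nat -> T -> R) (Z : T -> R) := forall e, 0 < e ->
  exists M0, forall M, (M0 <= M)%N -> small e [set t | e < `|Y M t - Z t|].

Definition ray_event (K : eqType) (s : seq K) (a : K -> R) : set (K -> R) :=
  [set x | forall k, k \in s -> a k <= x k].

Lemma iidexp_same_rays (K : eqType) (X Y : K -> T -> R) :
  iidexp P Y -> (forall k, measurable_fun setT (X k)) ->
  (forall s a, P [set t | ray_event s a (X^~ t)] = P [set t | ray_event s a (Y^~ t)]) ->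
  iidexp P X.
Proof.
move=> iY mX h; split=> // s A us mA; rewrite -iY.2//.
pose G : set (set (K -> R)) := [set C | exists s a, C = ray_event s a].
have mray (Z : K -> T -> R) : (forall k, measurable_fun setT (Z k)) ->
    forall C, G C -> measurable [set t | C (Z^~ t)].
  move=> mZ _ [s' [a ->]].
  rewrite (_ : [set _ | _] = cylinder s' (fun k => `[a k, +oo[%classic) Z).
    exact: measurable_cylinder.
  by apply/seteqP; split=> t /= h' k ks; have := h' k ks; rewrite /= in_itv/= andbT.
have [] // := @pi_transfer _ _ _ P (K -> R) G (fun t => X^~ t) (fun t => Y^~ t)
  setT setT 1 _ _ ler01 measurableT measurableT _ _ [set x | forall k, k \in s -> A k (x k)].
- move=> _ _ [s1 [a1 ->]] [s2 [a2 ->]].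
  exists (s1 ++ s2), (fun k => if k \in s1 then
     if k \in s2 then Num.max (a1 k) (a2 k) else a1 k else a2 k).
  apply/seteqP; split => x /=.
    move=> [h1 h2] k; rewrite mem_cat.
    case: (boolP (k \in s1)) => k1; case: (boolP (k \in s2)) => k2 //= _.
    + by rewrite ge_max h1// h2.
    + exact: h1.
    + exact: h2.
  move=> h'; split=> k ks; have := h' k; rewrite mem_cat ks ?orbT => /(_ isT).
    by case: ifP => //; rewrite ge_max => _ /andP[].
  by case: ifP => //; rewrite ge_max => _ /andP[].
- by exists [::], (fun=> 0); apply/seteqP; split.
- by move=> C GC; split; apply: mray => //; exact: iY.1.
- by move=> _ [s' [a ->]]; rewrite !setIT mul1e; exact: h.
- pose F : set (set (K -> R)) := <<s G >>.
  have mcoord k : measurable_fun setT (fun x : g_sigma_algebraType G => x k : R).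
    apply: (measurability _ (RGenCInfty.measurableE R)) => // _ [_ [a ->] <-].
    rewrite setTI; apply: sub_sigma_algebra; exists [:: k], (fun=> a).
    apply/seteqP; split=> x /=.
      by rewrite in_itv/= andbT => xa j; rewrite inE => /eqP ->.
    by move/(_ k (mem_head _ _)); rewrite in_itv/= andbT.
  rewrite (_ : [set _ | _] = \big[setI/setT]_(k <- s) [set x : K -> R | A k (x k)]).
    apply: (@bigsetI_measurable _ (g_sigma_algebraType G)) => k _.
    by have := mcoord k measurableT _ (mA k); rewrite setTI.
  elim: (s) => [|k s' ih]; first by rewrite big_nil; apply/seteqP; split.
  rewrite big_cons -ih; apply/seteqP; split=> x /=.
    by move=> h'; split=> [|j js]; apply: h'; rewrite inE ?eqxx ?js ?orbT.
  by move=> [h1 h2] j; rewrite inE => /predU1P[->//|/h2].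
- by rewrite !setIT mul1e.
Qed.

Lemma measurable_ray_event (K : eqType) (X : K -> T -> R) s a :
  (forall k, measurable_fun setT (X k)) -> measurable [set t | ray_event s a (X^~ t)].
Proof.
move=> mX; rewrite (_ : [set _ | _] = cylinder s (fun k => `[a k, +oo[%classic) X).
  exact: measurable_cylinder.
by apply/seteqP; split=> t /= h' k ks; have := h' k ks; rewrite /= in_itv/= andbT.
Qed.

Lemma iidexp_same_ray_event (K : eqType) (X Y : K -> T -> R) s a :
  iidexp P X -> iidexp P Y ->
  P [set t | ray_event s a (X^~ t)] = P [set t | ray_event s a (Y^~ t)].
Proof.
move=> iX iY; apply: iidexp_same_law => //.
rewrite (_ : ray_event s a = [set x | forall k, k \in s -> [set` `[a k, +oo[] (x k)]).
  by apply: (@depends_on_cylinder _ K predT s (fun k => `[a k, +oo[%classic)).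
by apply/seteqP; split=> x /= h k ks; have := h k ks; rewrite /= in_itv/= andbT.
Qed.

Lemma cvg_natSinv : (n.+1%:R^-1 : R)%:E @[n --> \oo] --> 0%E.
Proof. by apply/cvg_EFin; [exact: nearW|exact: cvg_harmonic]. Qed.

(** All families Y M have the law of [Y 0]. Closeness in probability therefore places the
    probability of a ray event of X between those of [Y 0] with thresholds moved by -e and e, and
    both converge as e tends to 0. *)
Lemma iidexp_limit (K : eqType) (Y : nat -> K -> T -> R) (X : K -> T -> R) :
  (forall M, iidexp P (Y M)) -> (forall k, measurable_fun setT (X k)) ->
  (forall k, cvg_in_prob (fun M => Y M k) (X k)) -> iidexp P X.
Proof.
move=> iY mX cX; apply: (iidexp_same_rays (iY 0)) => // s a.
pose A (e : R) := [set t | ray_event s (fun k => a k + e) ((Y 0)^~ t)].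
have mA e : measurable (A e) by apply: measurable_ray_event; exact: (iY 0%N).1.
pose pX := P [set t | ray_event s a (X^~ t)].
have mpX : measurable [set t | ray_event s a (X^~ t)] by exact: measurable_ray_event.
have close (e : R) : 0 < e -> exists M, small e [set t | exists2 k, k \in s & e < `|Y M k t - X k t|].
  move=> e0; pose n := (size s).+1.
  have en0 : 0 < e / n%:R by rewrite divr_gt0.
  have h k : exists M0, forall M, (M0 <= M)%N -> small (e / n%:R) [set t | e < `|Y M k t - X k t|].
    have [M0 hM0] := cX k _ en0; exists M0 => M /hM0; apply: small_sub => t /=.
    apply: le_lt_trans; rewrite ler_pdivrMr//.
    have n1 : 1 <= n%:R :> R by rewrite ler1n.
    by nra.
  have [M0 hM0] := choice h.
  exists (\max_(k <- s) M0 k)%N.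
  apply: (@small_le (\sum_(k <- s) e / n%:R)).
    by rewrite big_const_seq count_predT iter_addr_0 -[(e / n%:R) *+ _]mulr_natr mulrAC ler_pdivrMr// ler_pM2l// ler_nat.
  apply: small_bigcup_seq => k ks; apply: hM0.
  by apply: leq_bigmax_seq.
have up (e : R) : 0 < e -> (pX <= P (A (- e)%R) + e%:E)%E.
  move=> e0; have [M sM] := close e e0.
  have -> : P (A (- e)) = P [set t | ray_event s (fun k => a k - e) ((Y M)^~ t)].
    exact: iidexp_same_ray_event.
  apply: (prob_le_small mpX _ sM); first by apply: measurable_ray_event; exact: (iY M).1.
  move=> t /= h1 h2 k ks; have := h1 k ks; have : ~~ (e < `|Y M k t - X k t|).
    by apply/negP => h; apply: h2; exists k.
  by rewrite -leNgt ler_norml => /andP[]; lra.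
have dn (e : R) : 0 < e -> (P (A e) <= pX + e%:E)%E.
  move=> e0; have [M sM] := close e e0.
  have -> : P (A e) = P [set t | ray_event s (fun k => a k + e) ((Y M)^~ t)].
    exact: iidexp_same_ray_event.
  apply: (prob_le_small _ mpX sM); first by apply: measurable_ray_event; exact: (iY M).1.
  move=> t /= h1 h2 k ks; have := h1 k ks; have : ~~ (e < `|Y M k t - X k t|).
    by apply/negP => h; apply: h2; exists k.
  by rewrite -leNgt ler_norml => /andP[]; lra.
have n0 (n : nat) : 0 < (n.+1%:R^-1 : R) by rewrite invr_gt0.
have inv_le m n : (m <= n)%N -> (n.+1%:R^-1 : R) <= m.+1%:R^-1.
  by move=> mn; rewrite lef_pV2 ?posrE// ler_nat.
have c1 : P \o (fun n => A (- n.+1%:R^-1)) @ \oo --> P (A 0).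
  have <- : \bigcap_n A (- n.+1%:R^-1) = A 0.
    apply/seteqP; split=> t.
      move=> h k ks; apply/ler_addgt0Pr => e e0; rewrite addr0.
      have [n _ /(_ _ (leqnn n)) /= ne] := near_infty_natSinv_lt (PosNum e0).
      have hh : a k + - n.+1%:R^-1 <= Y 0%N k t := h n I k ks.
      by rewrite -lerBlDr; apply: le_trans hh; rewrite lerD2l lerN2 ltW.
    move=> h n _ k ks; apply: le_trans (h k ks); rewrite lerD2l.
    by rewrite oppr_le0 ltW.
  apply: nonincreasing_cvg_mu => //.
  - by rewrite (le_lt_trans (probability_le1 _ _))// ltry.
  - exact: bigcapT_measurable.
  - move=> m n mn; apply/subsetPset => t h k ks; apply: le_trans (h k ks).
    by rewrite lerD2l lerN2 inv_le.
have c2 : P \o (fun n => A n.+1%:R^-1) @ \oo --> P (A 0).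
  have mU : measurable (\bigcup_n A n.+1%:R^-1) by exact: bigcupT_measurable.
  have <- : P (\bigcup_n A n.+1%:R^-1) = P (A 0).
    (* The events increase only to the one with strict inequalities; the difference is null because
       an exponential law has no atoms. *)
    have tie k : k \in s -> small 0 [set t | Y 0%N k t = a k].
      move=> _; apply: small_measurable.
        rewrite (_ : [set _ | _] = Y 0%N k @^-1` [set a k]); last by apply/seteqP; split.
        by apply: measurable_preimage; [exact: (iY 0%N).1|exact: measurable_set1].
      by rewrite (exp_law_eq (a k) (iidexp_exp_law k (iY 0%N))).
    have [N [mN NE PN]] := small_bigcup_seq tie.
    have N0 : P N = 0%E.
      by apply/eqP; rewrite eq_le measure_ge0 andbT (le_trans PN)// big1.
    apply: (prob_eq_null mU (mA 0) mN N0) => t Nt; split.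
      move=> [n _ h] k ks; apply: le_trans (h k ks); rewrite lerD2l.
      by rewrite ltW.
    move=> h.
    have h' k : exists n, k \in s -> a k + n.+1%:R^-1 <= Y 0%N k t.
      have [ks|] := boolP (k \in s); last by exists 0%N.
      have : a k < Y 0%N k t.
        rewrite lt_neqAle; have := h k ks; rewrite addr0 => ->; rewrite andbT.
        by apply/negP => /eqP e; apply: Nt; apply: NE; exists k.
      rewrite -subr_gt0 => e0.
      have [n _ /(_ _ (leqnn n)) /= ne] := near_infty_natSinv_lt (PosNum e0).
      by exists n => _; rewrite addrC -lerBrDr ltW.
    have [nk hnk] := choice h'.
    exists (\max_(k <- s) nk k)%N => // k ks; apply: le_trans (hnk k ks).
    by rewrite lerD2l inv_le// leq_bigmax_seq.
  apply: nondecreasing_cvg_mu => // m n mn; apply/subsetPset => t h k ks.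
  by apply: le_trans (h k ks); rewrite lerD2l inv_le.
have A0 : A 0 = [set t | ray_event s a ((Y 0)^~ t)].
  by apply/seteqP; split=> t h k ks; have := h k ks; rewrite addr0.
rewrite -A0; apply/eqP; rewrite eq_le; apply/andP; split.
  have c : (P \o (fun n => A (- n.+1%:R^-1))) n + (n.+1%:R^-1)%:E @[n --> \oo] --> P (A 0) + 0.
    apply: cvgeD => //; last exact: cvg_natSinv.
    by rewrite fin_num_adde_defl.
  rewrite adde0 in c; rewrite -(cvg_lim _ c)//; apply: lime_ge; first by apply: cvgP; exact: c.
  by apply: nearW => n; exact: up.
have c : pX + (n.+1%:R^-1)%:E @[n --> \oo] --> pX + 0.
  by apply: cvgeD; [rewrite fin_num_adde_defl|exact: cvg_cst|exact: cvg_natSinv].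
rewrite adde0 in c; rewrite -/pX -(cvg_lim _ c)// -(cvg_lim _ c2)//.
apply: lee_lim; [by apply: cvgP; exact: c2|by apply: cvgP; exact: c|].
by apply: nearW => n; exact: dn.
Qed.

End small.

(** * Comparison with stationary fields *)

Section exit.
Context {R : realType}.
Implicit Types (u v : nat -> R) (w : nat -> nat -> R) (x : nat * nat -> R).

(* Either the optimal path to (i, j) leaves through the horizontal boundary, or
   some point of the vertical boundary violates the strict comparison with g. *)
Lemma exit_compare u v v' w (g : nat -> nat -> R) :
  (forall j, v' j <= v j) ->
  (forall i j, w i j + Num.max (g i j.+1) (g i.+1 j) <= g i.+1 j.+1) ->
  forall i j, lpp u v' w i j <= lpp u v w i j /\
  (lpp u v w i j = lpp u v' w i j \/ exists2 k, (0 < k <= j)%N &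
     lpp u v w i j - lpp u v w 0 k <= g i j - g 0%N k).
Proof.
move=> vv hg i j; elim: j i => [|j ihj]; first by move=> i; split=> //; left.
elim=> [|i [ihi1 ihi2]].
  split; last by right; exists j.+1; rewrite ?leqnn// !subrr.
  by rewrite !lpp0S lerD// (ihj 0%N).1.
have [ihj1 ihj2] := ihj i.+1.
split; first by rewrite !lppSS lerD2l ge_max !le_max ihi1 ihj1 orbT.
have hgij := hg i j.
have g1 : w i j + g i j.+1 <= g i.+1 j.+1.
  by apply: le_trans hgij; rewrite lerD2l le_max lexx.
have g2 : w i j + g i.+1 j <= g i.+1 j.+1.
  by apply: le_trans hgij; rewrite lerD2l le_max lexx orbT.
case: (leP (lpp u v w i j.+1) (lpp u v w i.+1 j)) => c.
  have e : lpp u v w i.+1 j.+1 = w i j + lpp u v w i.+1 j by rewrite lppSS max_r.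
  case: ihj2 => [h|[k /andP[k0 kj] h]]; [left|right].
    by rewrite [RHS]lppSS e h max_r// -h (le_trans ihi1).
  by exists k; [rewrite k0 leqW|rewrite e; lra].
have e : lpp u v w i.+1 j.+1 = w i j + lpp u v w i j.+1 by rewrite lppSS max_l// ltW.
case: ihi2 => [h|[k kj h]]; [left|right; exists k => //].
- by rewrite [RHS]lppSS e h max_l// -h (le_trans ihj1)// ltW.
- by rewrite e; lra.
Qed.

(** The stationary field whose axes carry increments of rates l and 1 - l. The boundary of every
    rate is a rescaling of the same weights, which is the coupling used in [field_coupling]. *)
Definition field (l : R) x :=
  lpp (fun i => x (i.+1, 0%N) / l) (fun j => x (0%N, j.+1) / (1 - l))
      (fun i j => x (i.+1, j.+1)).
Definition fieldh (l : R) x i j := field l x i.+1 j - field l x i j.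
Definition fieldv (l : R) x i j := field l x i j.+1 - field l x i j.

(* Last passage value from (a, b) to (a + i, b + j), without the weight of (a, b). *)
Definition ptp x a b :=
  lpp (fun k => x ((a + k).+1, b)) (fun k => x (a, (b + k).+1))
      (fun k l => x ((a + k).+1, (b + l).+1)).

(** The field of rate l is restarted at (a + 1, b + 1). The strict comparison with the field of rate
    l' rules out the second case of [exit_compare], so the vertical boundary can be lowered to the
    bare weights without changing the values at the two points concerned. Lowering the horizontal
    boundary as well gives point-to-point values, and [inc_monotone] says in which direction the
    increments move. *)
Lemma exit_right (l l' : R) x a b i j :
  (forall k, (0 < k <= j.+1)%N ->
    field l' x (a.+1 + i.+1) (b.+1 + j.+1) - field l' x a.+1 (b.+1 + k) <
    field l x (a.+1 + i.+1) (b.+1 + j.+1) - field l x a.+1 (b.+1 + k)) ->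
  (forall k, (0 < k <= j.+1)%N ->
    field l' x (a.+1 + i) (b.+1 + j.+1) - field l' x a.+1 (b.+1 + k) <
    field l x (a.+1 + i) (b.+1 + j.+1) - field l x a.+1 (b.+1 + k)) ->
  ptp x a.+1 b.+1 i.+1 j.+1 - ptp x a.+1 b.+1 i j.+1 <=
    fieldh l x (a.+1 + i) (b.+1 + j.+1) /\
  fieldv l x (a.+1 + i.+1) (b.+1 + j) <=
    ptp x a.+1 b.+1 i.+1 j.+1 - ptp x a.+1 b.+1 i.+1 j.
Proof.
move=> h0 h1.
pose u k := x (k.+1, 0%N) / l; pose v k := x (0%N, k.+1) / (1 - l).
pose w m n := x (m.+1, n.+1).
pose u1 k := hinc u v w (a.+1 + k) b.+1.
pose v1 k := vinc u v w a.+1 (b.+1 + k).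
pose v2 k := w a (b.+1 + k)%N.
pose w1 m n := w (a.+1 + m)%N (b.+1 + n)%N.
pose H := lpp u1 v1 w1; pose HS := lpp u1 v2 w1.
pose u2 k := w (a.+1 + k)%N b.
have sh m n : field l x (a.+1 + m) (b.+1 + n) = field l x a.+1 b.+1 + H m n.
  by rewrite /field lpp_shift.
have v21 k : v2 k <= v1 k by rewrite /v2 /v1 vinc_ge.
have u21 k : u2 k <= u1 k by rewrite /u2 /u1 hinc_ge.
pose g m n := field l' x (a.+1 + m) (b.+1 + n).
have hg m n : w1 m n + Num.max (g m n.+1) (g m.+1 n) <= g m.+1 n.+1.
  by rewrite /g !addnS /field lppSS.
have ex m n : (forall k, (0 < k <= n)%N -> g m n - g 0%N k < H m n - H 0%N k) -> H m n = HS m n.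
  move=> hk; have [_ [//|[k kn h]]] := exit_compare u1 v21 hg m n.
  by have := hk k kn; rewrite ltNge h.
have eH k m n : field l x (a.+1 + m) (b.+1 + n) - field l x a.+1 (b.+1 + k) = H m n - H 0%N k.
  by have := sh 0%N k; rewrite addn0 => ->; rewrite sh; ring.
have e0 : H i.+1 j.+1 = HS i.+1 j.+1.
  by apply: ex => k kj; rewrite -eH /g addn0; exact: h0.
have e1 : H i j.+1 = HS i j.+1.
  by apply: ex => k kj; rewrite -eH /g addn0; exact: h1.
have le m n : HS m n <= H m n by have [] := exit_compare u1 v21 hg m n.
have mono := @inc_monotone _ u1 v2 u2 v2 w1 i.+2 j.+2 (fun k _ => u21 k) (fun k _ => lexx _).
have [mh _] := mono i j.+1; have [_ mv] := mono i.+1 j.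
have {}mh := mh (ltnW (ltnSn _)) (ltnW (ltnSn _)).
have {}mv := mv (ltnW (ltnSn _)) (ltnW (ltnSn _)).
split.
  rewrite /fieldh -!addnS !sh; move: mh; rewrite /hinc -/HS => mh.
  by apply: le_trans mh _; rewrite -e0 -e1; lra.
rewrite /fieldv -!addnS !sh; move: mv; rewrite /vinc -/HS => mv.
by apply: le_trans mv; rewrite -e0; have := le i.+1 j; lra.
Qed.

Lemma fieldh_sum (l : R) x i j A : (A <= i)%N ->
  field l x i j - field l x (i - A) j = \sum_(k <- iota (i - A) A) fieldh l x k j.
Proof.
move=> Ai; rewrite -{1}(subnK Ai) addnC.
move: (i - A)%N => k {Ai}.
elim: A k => [|A ih] k; first by rewrite add0n subrr big_nil.
rewrite /= big_cons -ih addSnnS /fieldh; ring.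
Qed.

Lemma fieldv_sum (l : R) x i j B : (B <= j)%N ->
  field l x i j - field l x i (j - B) = \sum_(k <- iota (j - B) B) fieldv l x i k.
Proof.
move=> Bj; rewrite -{1}(subnK Bj) addnC.
move: (j - B)%N => k {Bj}.
elim: B k => [|B ih] k; first by rewrite add0n subrr big_nil.
rewrite /= big_cons -ih addSnnS /fieldv; ring.
Qed.

Lemma field_coupling (l l' : R) x i j : (forall k, 0 <= x k) ->
  0 < l -> l <= l' -> l' < 1 ->
  fieldh l' x i j <= fieldh l x i j /\ fieldv l x i j <= fieldv l' x i j.
Proof.
move=> x0 l0 ll l1.
have hu k : x (k.+1, 0%N) / l' <= x (k.+1, 0%N) / l.
  by rewrite ler_wpM2l// lef_pV2// posrE// (lt_le_trans l0).
have hv k : x (0%N, k.+1) / (1 - l) <= x (0%N, k.+1) / (1 - l').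
  by rewrite ler_wpM2l// lef_pV2 ?posrE; lra.
have [h1 h2] := @inc_monotone _ _ _ _ _ (fun i j => x (i.+1, j.+1)) i.+1 j.+1
  (fun k _ => hu k) (fun k _ => hv k) i j.
by split; [exact: h1|exact: h2].
Qed.

End exit.

(** * Large deviations along rows and columns *)

Section estimate.
Context {d} {T : measurableType d} {R : realType} (P : probability T R).

Lemma small_deviation (K : eqType) (Y : K -> T -> R) (s : seq K) (A : nat) (k : R) :
  iidexp P Y -> uniq s -> (size s <= 3 * A)%N -> 0 < k <= 1 ->
  small P (2 * expR (- (k ^+ 2 / 12 * A%:R)))
    [set t | k * A%:R <= `|\sum_(i <- s) Y i t - (size s)%:R|].
Proof.
move=> iY us sA /andP[k0 k1].
have sA' : (size s)%:R <= 3 * A%:R :> R by rewrite -natrM ler_nat.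
(* Minimises 3 th^2 - k th, the worst exponent per unit of A when the size is 3 A; the minimum is -
   k^2 / 12. *)
pose th := k / 6.
have th4 : `|th| <= 4^-1 by rewrite ger0_norm /th ?divr_ge0// ?ltW//; lra.
have th4' : `|- th| <= 4^-1 by rewrite normrN.
pose S := (size s)%:R : R.
have mS (c : R) : measurable_fun setT (fun t => c * \sum_(i <- s) Y i t).
  by apply: measurable_funM => //; apply: measurable_sum => i; exact: iY.1.
have h1 := iidexp_chernoff (th * (S + k * A%:R)) iY us th4.
have h2 := iidexp_chernoff (- th * (S - k * A%:R)) iY us th4'.
have b1 : - (th * (S + k * A%:R)) + S * (th + th ^+ 2) <= - (k ^+ 2 / 12 * A%:R).
  have -> : - (th * (S + k * A%:R)) + S * (th + th ^+ 2) =
    - (k ^+ 2 / 12 * A%:R) + (k ^+ 2 / 36) * (S - 3 * A%:R) by rewrite /th; field.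
  by rewrite gerDl mulr_ge0_le0 ?divr_ge0 ?sqr_ge0// subr_le0.
have b2 : - (- th * (S - k * A%:R)) + S * (- th + (- th) ^+ 2) <= - (k ^+ 2 / 12 * A%:R).
  have -> : - (- th * (S - k * A%:R)) + S * (- th + (- th) ^+ 2) =
    - (k ^+ 2 / 12 * A%:R) + (k ^+ 2 / 36) * (S - 3 * A%:R) by rewrite /th; field.
  by rewrite gerDl mulr_ge0_le0 ?divr_ge0 ?sqr_ge0// subr_le0.
rewrite mulr2n mulrDl !mul1r.
apply: (@small_sub _ _ _ _ _
  ([set t | th * (S + k * A%:R) <= th * \sum_(i <- s) Y i t] `|`
   [set t | - th * (S - k * A%:R) <= - th * \sum_(i <- s) Y i t])).
  move=> t /=; rewrite ler_normr => /orP[h|h]; [left|right].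
    by rewrite ler_pM2l ?divr_gt0//; rewrite /S; lra.
  by rewrite !mulNr lerN2 ler_pM2l ?divr_gt0//; rewrite /S; lra.
apply: smallU; apply: small_measurable.
- exact: measurable_ge.
- by apply: le_trans h1 _; rewrite lee_fin ler_expR.
- exact: measurable_ge.
- by apply: le_trans h2 _; rewrite lee_fin ler_expR.
Qed.

(** The factor 8 accounts for four two-sided deviations, each bounded by twice an exponential. *)
Lemma geometric_tail (k e : R) : 0 < k -> 0 < e -> exists N, forall N' n, (N <= N')%N ->
  \sum_(A <- iota N' n) 8 * expR (- (k * A%:R)) <= e.
Proof.
move=> k0 e0; pose r := expR (- k).
have r0 : 0 < r by exact: expR_gt0.
have r1 : r < 1 by rewrite expR_lt1 oppr_lt0.
have cr : (fun n => r ^+ n) @ \oo --> (0 : R) by apply: cvg_expr; rewrite ger0_norm// ltW.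
have c0 : 0 < e * (1 - r) / 8 by rewrite divr_gt0// mulr_gt0// subr_gt0.
have [N0 _ hN0] : \forall n \near \oo, `|0 - r ^+ n| < e * (1 - r) / 8.
  by move/cvgrPdist_lt : cr => /(_ _ c0).
exists N0 => N n /hN0 /= hN.
have pw A : expR (- (k * A%:R)) = r ^+ A by rewrite /r -expRM_natl; congr expR; ring.
have : \sum_(A <- iota N n) 8 * expR (- (k * A%:R)) * (1 - r) <= 8 * r ^+ N.
  rewrite (eq_bigr (fun A => 8 * (r ^+ A - r ^+ A.+1))); last first.
    by move=> A _; rewrite pw exprS; ring.
  rewrite -big_distrr/= ler_pM2l// /index_iota.
  suff -> : \sum_(A <- iota N n) (r ^+ A - r ^+ A.+1) = r ^+ N - r ^+ (N + n).
    by rewrite gerBl exprn_ge0// ltW.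
  elim: n N {hN} => [|n ih] N; first by rewrite big_nil addn0 subrr.
  by rewrite /= big_cons ih addSnnS; ring.
rewrite -big_distrl /= => h.
have h1 : 0 < 1 - r by rewrite subr_gt0.
rewrite -(ler_pM2r h1) (le_trans h)//.
have rN0 : 0 <= r ^+ N by rewrite exprn_ge0// ltW.
have hN' : r ^+ N < e * (1 - r) / 8 by move: hN; rewrite sub0r normrN ger0_norm.
lra.
Qed.

Lemma negligible_neg (K : countType) (X : K -> T -> R) : iidexp P X ->
  P.-negligible [set t | exists k, X k t < 0].
Proof.
move=> iX.
rewrite (_ : [set _ | _] = \bigcup_n
  (if (unpickle n : option K) is Some k then [set t | X k t < 0] else set0)); last first.
  apply/seteqP; split=> t /=.
    by move=> [k Xk]; exists (pickle k) => //; rewrite pickleK.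
  by move=> [n _]; case: unpickle => // k ?; exists k.
apply: negligible_bigcup => n; case: unpickle => [k|]; last exact: negligible_set0.
exists [set t | X k t < 0]; split=> //.
- by apply: measurable_lt; exact: iX.1.
- exact: (exp_law_lt0 (iidexp_exp_law k iX)).
Qed.

End estimate.

Section right_estimate.
Context {d} {T : measurableType d} {R : realType} (P : probability T R).
Variable X : nat * nat -> T -> R.
Hypothesis iX : iidexp P X.
Variable l : R.
Hypotheses (l0 : 4^-1 <= l) (l1 : l <= 2^-1).

Let key (p : nat * nat) := p.
Let unkey (p : nat * nat) := Some p.
Let keyK : pcancel key unkey. Proof. by []. Qed.
Let unkeyK k p : unkey k = Some p -> key p = k. Proof. by case. Qed.
Let l00 : 0 < l. Proof. by apply: lt_le_trans l0; rewrite invr_gt0. Qed.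
Let ll : 0 < 1 - l.
Proof. by rewrite subr_gt0 (le_lt_trans l1)// invf_lt1// ltr1n. Qed.
Let lll : l + (1 - l) = 1. Proof. by rewrite addrC subrK. Qed.

Let iB m n := burke keyK unkeyK iX l00 ll lll m n.

(** By [burke], l times the increments along row q are i.i.d. exponential. The factor 4 pays for the
    division by l, which is at least 1/4. *)
Lemma row_deviation p q A k : (A <= p)%N -> 0 < k <= 1 ->
  small P (2 * expR (- (k ^+ 2 / 12 * A%:R)))
    [set t | 4 * k * A%:R < `|field l (X^~ t) p q - field l (X^~ t) (p - A) q - A%:R / l|].
Proof.
move=> Ap k01.
pose s := [seq (i.+1, 0%N) | i <- iota (p - A) A].
have us : uniq s by rewrite map_inj_uniq ?iota_uniq// => i j [].
have ss : size s = A by rewrite size_map size_iota.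
have sA : (size s <= 3 * A)%N by rewrite ss leq_pmull.
apply: small_sub (small_deviation (iB p q) us sA k01) => t /=.
rewrite ss fieldh_sum// => h.
have -> : \sum_(i <- s) burke_family key unkey X l (1 - l) p q 0 i t =
    l * \sum_(i <- iota (p - A) A) fieldh l (X^~ t) i q.
  rewrite big_map big_distrr /=; apply: eq_big_seq => i.
  rewrite mem_iota subnK// => /andP[_ ip].
  by rewrite /burke_family /= ip addn0.
set S := \sum_(i <- _) _ in h *.
have -> : l * S - A%:R = l * (S - A%:R / l) by rewrite mulrBr mulrCA divff ?mulr1// gt_eqF.
rewrite normrM (ger0_norm (ltW l00)).
have kA : 0 <= k * A%:R by rewrite mulr_ge0//; case/andP: k01 => /ltW.
rewrite -mulrA in h; move: h kA; move: (k * A%:R) (`|_|) => z y h z0.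
have lz : 1 <= 4 * l by rewrite mulrC -ler_pdivrMr// div1r.
have : l * (4 * z) <= l * y by rewrite ler_pM2l// ltW.
nra.
Qed.

Lemma column_deviation p q A B k : (B <= q)%N -> (B <= 3 * A)%N -> 0 < k <= 1 ->
  small P (2 * expR (- (k ^+ 2 / 12 * A%:R)))
    [set t | 4 * k * A%:R < `|field l (X^~ t) p q - field l (X^~ t) p (q - B) - B%:R / (1 - l)|].
Proof.
move=> Bq BA k01.
pose s := [seq (0%N, j.+1) | j <- iota (q - B) B].
have us : uniq s by rewrite map_inj_uniq ?iota_uniq// => i j [].
have ss : size s = B by rewrite size_map size_iota.
have sA : (size s <= 3 * A)%N by rewrite ss.
apply: small_sub (small_deviation (iB p q) us sA k01) => t /=.
rewrite ss fieldv_sum// => h.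
have -> : \sum_(i <- s) burke_family key unkey X l (1 - l) p q 0 i t =
    (1 - l) * \sum_(j <- iota (q - B) B) fieldv l (X^~ t) p j.
  rewrite big_map big_distrr /=; apply: eq_big_seq => j.
  rewrite mem_iota subnK// => /andP[_ jq].
  by rewrite /burke_family /= jq.
set S := \sum_(i <- _) _ in h *.
have -> : (1 - l) * S - B%:R = (1 - l) * (S - B%:R / (1 - l)).
  by rewrite mulrBr mulrCA divff ?mulr1// gt_eqF.
rewrite normrM (ger0_norm (ltW ll)).
have kA : 0 <= k * A%:R by rewrite mulr_ge0//; case/andP: k01 => /ltW.
rewrite -mulrA in h; move: h kA; move: (k * A%:R) (`|_|) => z y h z0.
have lz : 1 <= 4 * (1 - l).
  have : l <= 2^-1 by exact: l1. by lra.
have : (1 - l) * (4 * z) <= (1 - l) * y by rewrite ler_pM2l// ltW.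
nra.
Qed.

End right_estimate.

(** Here a and b are the side lengths and 1/2 - h, 1/2 are the two rates. To second order in h the
    means differ by 4 h (a - b) + 8 h^2 (a + b). For b about a + a h this is 12 h^2 a, which leaves
    room for the subtracted 4 h^2 a, that is, for four deviations of size h^2 a;
    [1 + 2 * h <= a * h] absorbs the extra 2 in the bound on b. *)
Lemma rates_gap (R : realType) (h a b : R) : 0 < h -> h <= 4^-1 ->
  1 + 2 * h <= a * h -> b <= a + a * h + 2 ->
  0 < a / (2^-1 - h) - 2 * a + b / (2^-1 + h) - 2 * b - 4 * h ^+ 2 * a.
Proof.
move=> h0 h4 ah hb.
have d1 : 0 < 2^-1 - h by lra.
have d2 : 0 < 2^-1 + h by lra.
have dd : 0 < (2^-1 - h) * (2^-1 + h) by rewrite mulr_gt0.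
have -> : a / (2^-1 - h) - 2 * a + b / (2^-1 + h) - 2 * b - 4 * h ^+ 2 * a =
  h / ((2^-1 - h) * (2^-1 + h)) *
  (a * (1 + 2 * h) - b * (1 - 2 * h) - a * h * (1 - 4 * h ^+ 2)).
  by field; apply/andP; split; rewrite gt_eqF//; lra.
rewrite pmulr_rgt0 ?divr_gt0//.
have hb' : b * (1 - 2 * h) <= (a + a * h + 2) * (1 - 2 * h) by rewrite ler_wpM2r//; lra.
have -> : a * (1 + 2 * h) = (a + a * h + 2) * (1 - 2 * h) + a * h * (1 - 4 * h ^+ 2) +
  (a * h * (2 + 2 * h + 4 * h ^+ 2) - 2 + 4 * h) by ring.
have : 2 <= a * h * (2 + 2 * h + 4 * h ^+ 2) by nra.
lra.
Qed.

Lemma gap_contradiction (R : realType) (f1 f2 f3 f4 f5 f6 f7 f8 f9 f10 g a b : R) :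
  - g <= f1 - f3 - f9 -> f2 - f4 - a * 2 <= g -> - g <= f3 - f5 - f10 ->
  f4 - f6 - b * 2 <= g -> f1 - f7 <= f2 - f8 -> f6 - f5 <= f8 - f7 ->
  0 < f9 - 2 * a + f10 - 2 * b - 4 * g -> False.
Proof. lra. Qed.

Section right_theorem.
Context {d} {T : measurableType d} {R : realType} (P : probability T R).

(* The strict comparison required by [exit_right], for all points z = y - (A, B)
   with A <= K and B <= (1 + 1/m) A + 2. *)
Lemma comparison_estimate (m : nat) (e : R) : (4 <= m)%N -> 0 < e ->
  exists N, forall K p q (X : nat * nat -> T -> R),
  (K <= p)%N -> (3 * K <= q)%N -> iidexp P X ->
  small P e [set t | exists A B, [/\ (N <= A <= K)%N, (B <= A + A %/ m + 2)%N &
    field (2^-1 - m%:R^-1) (X^~ t) p q - field (2^-1 - m%:R^-1) (X^~ t) (p - A) (q - B)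
    <= field 2^-1 (X^~ t) p q - field 2^-1 (X^~ t) (p - A) (q - B)]].
Proof.
move=> m4 e0; pose h : R := m%:R^-1; pose l := 2^-1 - h.
have m0 : 0 < m%:R :> R by rewrite ltr0n (leq_trans _ m4).
have h0 : 0 < h by rewrite invr_gt0.
have h4 : h <= 4^-1 by rewrite lef_pV2 ?posrE// ler_nat.
have l0 : 4^-1 <= l by rewrite /l; lra.
have l1 : l <= 2^-1 by rewrite /l; lra.
have i4 : 4^-1 <= 2^-1 :> R by rewrite lef_pV2 ?posrE// ler_nat.
(* Makes each of the four deviations at most 4 k A = h^2 A, the total allowed by [rates_gap]. *)
pose k := h ^+ 2 / 4.
have k0 : 0 < k by rewrite divr_gt0// exprn_gt0.
have k01 : 0 < k <= 1.
  rewrite k0 /= /k ler_pdivrMr// mul1r.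
  by nra.
have kk : 0 < k ^+ 2 / 12 by rewrite divr_gt0// exprn_gt0.
have [N0 hN0] := geometric_tail kk e0.
(* A >= m + 2 gives the inequality 1 + 2 h <= A h required by [rates_gap]; N0 makes the union bound
   over A summable to e. *)
exists (maxn N0 m.+2) => K p q X Kp Kq iX.
pose b A := (A + A %/ m + 2)%N.
pose dev A t := [\/ 4 * k * A%:R < `|field l (X^~ t) p q - field l (X^~ t) (p - A) q - A%:R / l|,
  4 * k * A%:R < `|field 2^-1 (X^~ t) p q - field 2^-1 (X^~ t) (p - A) q - A%:R / 2^-1|,
  4 * k * A%:R < `|field l (X^~ t) (p - A) q - field l (X^~ t) (p - A) (q - b A) - (b A)%:R / (1 - l)| |
  4 * k * A%:R < `|field 2^-1 (X^~ t) (p - A) q - field 2^-1 (X^~ t) (p - A) (q - b A) - (b A)%:R / (1 - 2^-1)|].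
pose N := maxn N0 m.+2.
have bA A : (m < A)%N -> (b A <= 3 * A)%N.
  by move=> mA; rewrite /b; move: (leq_div A m) mA m4; clear; lia.
have devP A : (N <= A <= K)%N -> small P (8 * expR (- (k ^+ 2 / 12 * A%:R))) (dev A).
  move=> /andP[NA AK]; have mA : (m < A)%N by move: NA; rewrite /N geq_max => /andP[_ /ltnW].
  have Ap : (A <= p)%N by exact: leq_trans Kp.
  have bq : (b A <= q)%N by move: (bA A mA) AK Kq; clear; lia.
  have s1 := row_deviation iX l0 l1 q Ap k01.
  have s2 := row_deviation iX i4 (lexx _) q Ap k01.
  have s3 := column_deviation iX l0 l1 (p - A)%N bq (bA _ mA) k01.
  have s4 := column_deviation iX i4 (lexx _) (p - A)%N bq (bA _ mA) k01.
  apply: small_le (small_sub _ (smallU (smallU s1 s2) (smallU s3 s4))).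
    by move: (expR _) => y; lra.
  by move=> t [?|?|?|?]; [left; left|left; right|right; left|right; right].
have sdev : small P e [set t | exists2 A, A \in iota N (K.+1 - N) & dev A t].
  apply: small_le (small_bigcup_seq (e := fun A => 8 * expR (- (k ^+ 2 / 12 * A%:R))) _).
    by apply: hN0; exact: leq_maxl.
  by move=> A; rewrite mem_iota => hA; apply: devP; move: hA; clear; lia.
have neg := negligible_small (lexx 0) (negligible_neg iX).
rewrite -[e]addr0; apply: small_sub (smallU sdev neg) => t /= [A [B [NAK Bb hAB]]].
apply: contrapT => /not_orP[nd nn].
have X0 j : 0 <= X j t by rewrite leNgt; apply/negP => ?; apply: nn; exists j.
have {}nd : ~ dev A t.
  by move=> dA; apply: nd; exists A => //; rewrite mem_iota; move: NAK; rewrite -/N; clear; lia.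
have [d1 d2 d3 d4] : [/\
  `|field l (X^~ t) p q - field l (X^~ t) (p - A) q - A%:R / l| <= 4 * k * A%:R,
  `|field 2^-1 (X^~ t) p q - field 2^-1 (X^~ t) (p - A) q - A%:R / 2^-1| <= 4 * k * A%:R,
  `|field l (X^~ t) (p - A) q - field l (X^~ t) (p - A) (q - b A) - (b A)%:R / (1 - l)| <= 4 * k * A%:R &
  `|field 2^-1 (X^~ t) (p - A) q - field 2^-1 (X^~ t) (p - A) (q - b A) - (b A)%:R / (1 - 2^-1)| <= 4 * k * A%:R].
  split; rewrite leNgt; apply/negP => hd; apply: nd.
  - by apply: Or41.
  - by apply: Or42.
  - by apply: Or43.
  - by apply: Or44.
(* Vertical increments grow with the rate, so D is nondecreasing. A failure at some B is thus a
   failure at the largest admissible value [b A], and the union bound runs over A alone. *)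
pose D j := field 2^-1 (X^~ t) (p - A) j - field l (X^~ t) (p - A) j.
have Dmono i j : (i <= j)%N -> D i <= D j.
  move=> ij; rewrite -(subnK ij); elim: (j - i)%N => [//|n ih].
  apply: le_trans ih _; rewrite addSn /D.
  have l00 : 0 < l by apply: lt_le_trans l0; rewrite invr_gt0.
  have [_] := field_coupling (p - A) (n + i) X0 l00 l1 (ltac:(rewrite invf_lt1 ?ltr1n//)).
  by rewrite /fieldv; lra.
have DB := Dmono _ _ (leq_sub2l q Bb).
rewrite /D -/(b A) in DB.
have ah : 1 + 2 * h <= A%:R * h.
  have : m.+2%:R <= A%:R :> R.
    by rewrite ler_nat; move: NAK; rewrite geq_max => /andP[/andP[]].
  have mh : m%:R * h = 1 by rewrite mulfV// gt_eqF.
  rewrite -addn2 natrD => hA.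
  have : (m%:R + 2) * h <= A%:R * h by rewrite ler_wpM2r// ltW.
  by rewrite mulrDl mh.
have hb : (b A)%:R <= A%:R + A%:R * h + 2.
  rewrite /b !natrD lerD2r lerD2l /h ler_pdivlMr// -natrM ler_nat.
  exact: leq_divM.
have num := rates_gap h0 h4 ah hb.
have e1 : 1 - l = 2^-1 + h by rewrite /l; lra.
have e2 : 1 - 2^-1 = 2^-1 :> R by lra.
rewrite -/h -/l in hAB.
move: d1 d2 d3 d4 hAB DB num; rewrite e2 e1 -/l !ler_norml.
move=> /andP[d1 _] /andP[_ d2] /andP[d3 _] /andP[_ d4]; move: d1 d2 d3 d4.
rewrite !invrK -/(b A).
have -> : 4 * k * A%:R = h ^+ 2 * A%:R by rewrite /k; field.
have -> : 4 * h ^+ 2 * A%:R = 4 * (h ^+ 2 * A%:R) by ring.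
exact: gap_contradiction.
Qed.

End right_theorem.

(** * Point-to-point increments between stationary ones *)

Section sandwich.
Context {d} {T : measurableType d} {R : realType} (P : probability T R).

Lemma iidexp_reindex (K K' : eqType) (f : K' -> K) (X : K -> T -> R) :
  injective f -> iidexp P X -> iidexp P (fun k => X (f k)).
Proof.
move=> fI [mX iX]; split=> [k|s A us mA]; first exact: mX.
pose s' := [seq f k | k <- s].
pose B k := if [pick i : 'I_(size s) | f (tnth (in_tuple s) i) == k] is Some i
   then A (tnth (in_tuple s) i) else setT.
have eB k : k \in s -> B (f k) = A k.
  move=> ks; rewrite /B; case: pickP => [i /eqP/fI -> //|h].
  have : (index k s < size s)%N by rewrite index_mem.
  move=> hi; have := h (Ordinal hi); rewrite (tnth_nth k) /= nth_index// eqxx//.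
have -> : cylinder s A (fun k => X (f k)) = cylinder s' B X.
  apply/seteqP; split=> t h k.
    by move=> /mapP[j js ->]; rewrite eB//; exact: h.
  by move=> ks; rewrite -(eB k ks); apply: h; apply: map_f.
rewrite iX; [|by rewrite map_inj_uniq|].
  by rewrite big_map; apply: eq_big_seq => k ks; rewrite eB.
by move=> k; rewrite /B; case: pickP.
Qed.

Lemma field_transpose (l : R) (x : nat * nat -> R) i j :
  field l (fun p => x (p.2, p.1)) j i = field (1 - l) x i j.
Proof.
have e : 1 - (1 - l) = l by lra.
by rewrite /field e -[LHS]lpp_transpose.
Qed.

Lemma ptp_transpose (x : nat * nat -> R) a b i j :
  ptp (fun p => x (p.2, p.1)) b a j i = ptp x a b i j.
Proof. by rewrite /ptp /= -lpp_transpose. Qed.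

(* Increments, at x = (p, q), of the passage values from x - (A, B). *)
Definition ptph (x : nat * nat -> R) p q A B :=
  ptp x (p - A) (q - B) A B - ptp x (p - A) (q - B) A.-1 B.
Definition ptpv (x : nat * nat -> R) p q A B :=
  ptp x (p - A) (q - B) A B - ptp x (p - A) (q - B) A B.-1.

Lemma right_estimate (m : nat) (e : R) : (4 <= m)%N -> 0 < e ->
  exists N, forall K p q (X : nat * nat -> T -> R),
  (K < p)%N -> (3 * K < q)%N -> iidexp P X ->
  small P e [set t | exists A B, [/\ (N < A <= K)%N, (0 < B <= A + A %/ m)%N &
    ~ (ptph (X^~ t) p q A B <= fieldh (2^-1 - m%:R^-1) (X^~ t) p.-1 q /\
       fieldv (2^-1 - m%:R^-1) (X^~ t) p q.-1 <= ptpv (X^~ t) p q A B)]].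
Proof.
move=> m4 e0; have e20 : 0 < e / 2 by rewrite divr_gt0.
have [N hN] := comparison_estimate P m4 e20.
exists N => K p q X Kp Kq iX.
have Kp1 : (K <= p.-1)%N by rewrite -ltnS prednK// (leq_ltn_trans _ Kp).
have s1 := hN K p q X (ltnW Kp) (ltnW Kq) iX.
(* [exit_right] needs the strict comparison both at (p, q) and at (p - 1, q). *)
have s2 := hN K p.-1 q X Kp1 (ltnW Kq) iX.
rewrite (splitr e); apply: small_sub (smallU s1 s2) => t [A [B [/andP[NA AK] /andP[B0 BA] h]]].
apply: contrapT => /not_orP[n1 n2]; apply: h.
have Bq : (B < q)%N.
  by move: BA Kq AK m4 (leq_div A m); clear; lia.
have Ap : (A < p)%N by exact: leq_ltn_trans Kp.
have A0 : (0 < A)%N by exact: leq_ltn_trans NA.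
have ea : (p - A = (p - A).-1.+1)%N by rewrite prednK// subn_gt0.
have eb : (q - B = (q - B).-1.+1)%N by rewrite prednK// subn_gt0.
have eA : A = A.-1.+1 by rewrite prednK.
have eB : B = B.-1.+1 by rewrite prednK.
have c1 : ((p - A).-1.+1 + A.-1.+1 = p)%N by rewrite -ea -eA subnK// ltnW.
have c2 : ((q - B).-1.+1 + B.-1.+1 = q)%N by rewrite -eb -eB subnK// ltnW.
have c3 : ((p - A).-1.+1 + A.-1 = p.-1)%N by rewrite -[in RHS]c1 addnS.
have c4 : ((q - B).-1.+1 + B.-1 = q.-1)%N by rewrite -[in RHS]c2 addnS.
rewrite /ptph /ptpv.
have := @exit_right R (2^-1 - m%:R^-1) 2^-1 (X^~ t) (p - A).-1 (q - B).-1 A.-1 B.-1.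
rewrite c1 c2 c3 c4 -!ea -!eb -!eA -!eB; apply.
- move=> k /andP[k0 kB]; rewrite ltNge; apply/negP => h; apply: n1.
  exists A, (B - k)%N; split; first by rewrite (ltnW NA).
    by move: BA; clear; lia.
  by rewrite (_ : q - (B - k) = q - B + k)%N//; move: kB Bq; clear; lia.
- move=> k /andP[k0 kB]; rewrite ltNge; apply/negP => h; apply: n2.
  exists A.-1, (B - k)%N; split.
  + by move: NA AK; clear; lia.
  (* Seen from (p - 1, q) the horizontal distance is A - 1; the resulting loss in the cone condition
     is at most 2, the slack provided in [comparison_estimate]. *)
  + have : (A %/ m <= A.-1 %/ m + 1)%N.
      have m0 : (0 < m)%N by exact: leq_trans m4.
      have hA : (A <= A.-1 + m)%N by move: A0 m0; clear; lia.
      by apply: leq_trans (leq_div2r m hA) _; rewrite divnDr// divnn m0.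
    by move: BA k0 A0; clear; lia.
  + rewrite (_ : p.-1 - A.-1 = p - A)%N; last by move: Ap A0; clear; lia.
    by rewrite (_ : q - (B - k) = q - B + k)%N//; move: kB Bq; clear; lia.
Qed.

(** Transposition exchanges the rates l and 1 - l as well as the two kinds of increments, so this is
    [right_estimate] for the transposed weights. *)
Lemma left_estimate (m : nat) (e : R) : (4 <= m)%N -> 0 < e ->
  exists N, forall K p q (X : nat * nat -> T -> R),
  (3 * K < p)%N -> (K < q)%N -> iidexp P X ->
  small P e [set t | exists A B, [/\ (N < B <= K)%N, (0 < A <= B + B %/ m)%N &
    ~ (fieldh (2^-1 + m%:R^-1) (X^~ t) p.-1 q <= ptph (X^~ t) p q A B /\
       ptpv (X^~ t) p q A B <= fieldv (2^-1 + m%:R^-1) (X^~ t) p q.-1)]].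
Proof.
move=> m4 e0; have [N hN] := right_estimate m4 e0.
exists N => K p q X Kp Kq iX.
pose X' (z : nat * nat) := X (z.2, z.1).
have iX' : iidexp P X'.
  by apply: (iidexp_reindex (f := fun z : nat * nat => (z.2, z.1))) => // -[a b] [a' b'] [-> ->].
apply: small_sub (hN K q p X' Kq Kp iX') => t [A [B [NB A0 h]]].
exists B, A; split=> //.
have el : 1 - (2^-1 - m%:R^-1) = 2^-1 + m%:R^-1 :> R by lra.
have ef i j : field (2^-1 - m%:R^-1) (X'^~ t) j i = field (2^-1 + m%:R^-1) (X^~ t) i j.
  by rewrite -el -field_transpose.
have ep a b i j : ptp (X'^~ t) b a j i = ptp (X^~ t) a b i j by exact: (ptp_transpose (X^~ t)).
move=> [h1 h2]; apply: h; split.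
  by move: h2; rewrite /ptph /ptpv /fieldh /fieldv !ef !ep.
by move: h1; rewrite /ptph /ptpv /fieldh /fieldv !ef !ep.
Qed.

Lemma expRN_gap (s r : R) : 0 <= s -> s <= r -> expR (- s) - expR (- r) <= r - s.
Proof.
move=> s0 sr; have -> : expR (- r) = expR (- s) * expR (- (r - s)).
  by rewrite -expRD; congr expR; ring.
rewrite -[X in X - _]mulr1 -mulrBr.
have h1 : expR (- s) <= 1 by rewrite -expR0 ler_expR oppr_le0.
have h2 : 1 - expR (- (r - s)) <= r - s by have := expR_ge1Dx (- (r - s)); lra.
have h3 : expR (- (r - s)) <= 1 by rewrite -expR0 ler_expR oppr_le0 subr_ge0.
by apply: le_trans h2; rewrite ler_piMl// subr_ge0.
Qed.

(* If a - b > e then some multiple of e separates b from a. *)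
Lemma coupling_gap (e : R) : 0 < e -> exists2 h, 0 < h <= 4^-1 & forall (l : R) (a b : T -> R),
  2^-1 - h <= l <= 2^-1 ->
  exp_law P (fun t => l * a t) -> exp_law P (fun t => (1 - l) * b t) ->
  P.-negligible [set t | a t < b t] -> small P e [set t | e < a t - b t].
Proof.
move=> e0; have e20 : 0 < e / 2 by rewrite divr_gt0.
(* Since l >= 1/4, a exceeds n e with probability at most exp(- n e / 4); this fixes the number n of
   grid points. *)
have ce : (fun n => expR (- (e / 4)) ^+ n) @ \oo --> (0 : R).
  apply: cvg_expr; rewrite ger0_norm ?expR_ge0// expR_lt1 oppr_lt0.
  by rewrite divr_gt0.
have [n _ /(_ _ (leqnn n)) /= hn] : \forall n \near \oo, `|0 - expR (- (e / 4)) ^+ n| < e / 2.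
  by move/cvgrPdist_lt : ce => /(_ _ e20).
(* Bounds the sum of (1 - 2 l) k e over the grid by h c, as 1 - 2 l <= 2 h; h is then chosen with h
   c <= e / 2. *)
pose c : R := n.+1%:R * (2 * (n%:R * e)) + 1.
have c1 : 1 <= c by rewrite lerDr !mulr_ge0// ltW.
have c0 : 0 < c by lra.
pose h := Num.min 4^-1 (e / 2 / c).
have h0 : 0 < h by rewrite lt_min invr_gt0 ltr0n !divr_gt0.
exists h; first by rewrite h0 ge_min lexx.
move=> l a b /andP[l1 l2] la lb ab.
have h4 : h <= 4^-1 by rewrite ge_min lexx.
have l0 : 4^-1 <= l by lra.
have lp : 0 < l by lra.
have lp' : 0 < 1 - l by lra.
have ma : measurable_fun setT a.
  rewrite (_ : a = fun t => l^-1 * (l * a t)).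
    by apply: measurable_funM => //; exact: la.1.
  by apply/funext => t; rewrite mulKf// gt_eqF.
have mb : measurable_fun setT b.
  rewrite (_ : b = fun t => (1 - l)^-1 * ((1 - l) * b t)).
    by apply: measurable_funM => //; exact: lb.1.
  by apply/funext => t; rewrite mulKf// gt_eqF.
have pa (x : R) : 0 <= x -> P [set t | x < a t] = (expR (- (l * x)))%:E.
  move=> x0; rewrite -(exp_law_gt la); last by rewrite mulr_ge0// ltW.
  by congr (P _); apply/seteqP; split=> t /=; rewrite ltr_pM2l.
have pb (x : R) : 0 <= x -> P [set t | x < b t] = (expR (- ((1 - l) * x)))%:E.
  move=> x0; rewrite -(exp_law_gt lb); last by rewrite mulr_ge0// ltW.
  by congr (P _); apply/seteqP; split=> t /=; rewrite ltr_pM2l.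
have mgt (f : T -> R) (x : R) : measurable_fun setT f -> measurable [set t | x < f t].
  move=> mf; rewrite (_ : [set _ | _] = f @^-1` `]x, +oo[%classic).
    exact: measurable_preimage.
  by apply/seteqP; split=> t /=; rewrite in_itv/= andbT.
(* As b <= a almost surely, the probability that x separates them is the difference exp(- l x) -
   exp(- (1 - l) x) of their tails. *)
have sep (x : R) : 0 <= x -> small P ((1 - 2 * l) * x) [set t | b t <= x < a t].
  move=> x0; have [E [mE PE abE]] := ab.
  apply: (@small_sub _ _ _ _ _ (([set t | x < a t] `\` [set t | x < b t]) `|` E)).
    by move=> t /= /andP[bx xa]; left; split=> //; apply/negP; rewrite -leNgt.
  rewrite -[(1 - 2 * l) * x]addr0; apply: smallU; last first.
    by apply: small_measurable => //; rewrite PE.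
  apply: small_measurable; first by apply: measurableD; exact: mgt.
  have PEx : P ([set t | x < a t] `&` [set t | x < b t]) = P [set t | x < b t].
    apply: (prob_eq_null _ _ mE PE).
    - by apply: measurableI; exact: mgt.
    - exact: mgt.
    - move=> t Et; split=> [[]//|xb]; split=> //=.
      apply: lt_le_trans xb _; rewrite leNgt; apply/negP => hab; apply: Et; exact: abE.
  rewrite measureD//; last 3 first.
  - exact: mgt.
  - exact: mgt.
  - by rewrite (le_lt_trans (probability_le1 _ _)) ?ltry//; exact: mgt.
  rewrite [X in (X - _)%E](pa _ x0) [X in (_ - X)%E]PEx (pb _ x0) -EFinB lee_fin.
  apply: le_trans (expRN_gap _ _) _.
  - by rewrite mulr_ge0// ltW.
  - by rewrite ler_wpM2r//; lra.
  - by rewrite -mulrBl; apply: ler_wpM2r => //; lra.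
have far : small P (e / 2) [set t | n%:R * e < a t].
  apply: small_measurable; first exact: mgt.
  have nn0 : 0 <= n%:R * e by rewrite mulr_ge0// ltW.
  rewrite (pa _ nn0) lee_fin ltW//.
  apply: le_lt_trans hn; rewrite sub0r normrN ger0_norm ?exprn_ge0 ?expR_ge0//.
  rewrite -expRM_natl ler_expR mulrN lerN2.
  have : 0 <= n%:R * e by rewrite mulr_ge0// ltW.
  have -> : n%:R * (e / 4) = (n%:R * e) / 4 by ring.
  by nra.
have neg : small P 0 [set t | (1 - l) * b t < 0].
  apply: small_measurable; last by rewrite exp_law_lt0.
  exact: measurable_lt lb.1.
have mid : small P (e / 2) [set t | exists2 k, k \in iota 0 n.+1 & b t <= k%:R * e < a t].
  apply: small_le (small_bigcup_seq (e := fun k => (1 - 2 * l) * (k%:R * e)) _); last first.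
    by move=> k _; apply: sep; rewrite mulr_ge0// ltW.
  apply: (@le_trans _ _ (\sum_(k <- iota 0 n.+1) (2 * h) * (n%:R * e))).
    rewrite big_seq [X in _ <= X]big_seq; apply: ler_sum => k; rewrite mem_iota => /andP[_ kn].
    apply: ler_pM; [lra|by rewrite mulr_ge0// ltW|lra|].
    by rewrite ler_pM2r// ler_nat -ltnS.
  rewrite big_const_seq count_predT size_iota iter_addr_0 -[_ *+ n.+1]mulr_natr.
  have hc : h * c <= e / 2.
    by rewrite -ler_pdivlMr// ge_min lexx orbT.
  apply: le_trans hc; rewrite /c mulrDr.
  have : 0 <= h * 1 by rewrite mulr1 ltW.
  have -> : 2 * h * (n%:R * e) * n.+1%:R = h * (n.+1%:R * (2 * (n%:R * e))) by ring.
  lra.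
apply: small_le (small_sub _ (smallU (smallU mid far) neg)); first lra.
move=> t /= hab; apply: contrapT => /not_orP[/not_orP[nm nf] nn].
have b0 : 0 <= b t.
  by rewrite leNgt; apply/negP => ?; apply: nn; rewrite pmulr_rlt0.
have an : a t <= n%:R * e by rewrite leNgt; apply/negP.
have [k hk] : exists k, b t <= k%:R * e <= b t + e.
  have be : 0 <= b t / e by rewrite divr_ge0// ltW.
  exists (Num.truncn (b t / e)).+1.
  have /andP[h1 h2] := truncn_itv be.
  rewrite -ler_pdivrMr// ltW//= -addn1 natrD mulrDl mul1r lerD2r.
  by rewrite -ler_pdivlMr.
apply: nm; exists k; last first.
  by case/andP: hk => -> hk; rewrite (le_lt_trans hk)// -ltrBrDl.
rewrite -[0%N :: iota 1 n]/(iota 0 n.+1) mem_iota /= add0n ltnS.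
have : k%:R * e < n%:R * e by case/andP: hk => _; lra.
by rewrite ltr_pM2r// ltr_nat => /ltnW.
Qed.

Lemma exp_law_eqfun (f g : T -> R) : exp_law P f -> f =1 g -> exp_law P g.
Proof. by move=> lf /funext <-. Qed.

Lemma fieldh_law (l : R) (X : nat * nat -> T -> R) i j : 0 < l -> l < 1 ->
  iidexp P X -> exp_law P (fun t => l * fieldh l (X^~ t) i j).
Proof.
move=> l0 l1 iX; have l10 : 0 < 1 - l by rewrite subr_gt0.
have ll : l + (1 - l) = 1 by rewrite addrC subrK.
have key : pcancel (fun p : nat * nat => p) (fun p => Some p) by [].
have unkey (k p : nat * nat) : Some k = Some p -> p = k by case.
have iB := burke key unkey iX l0 l10 ll i.+1 j.
apply: exp_law_eqfun (iidexp_exp_law (i.+1, 0%N) iB) _ => t.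
by rewrite /burke_family /= ltnSn addn0.
Qed.

Lemma fieldv_law (l : R) (X : nat * nat -> T -> R) i j : 0 < l -> l < 1 ->
  iidexp P X -> exp_law P (fun t => (1 - l) * fieldv l (X^~ t) i j).
Proof.
move=> l0 l1 iX; have l10 : 0 < 1 - l by rewrite subr_gt0.
have ll : l + (1 - l) = 1 by rewrite addrC subrK.
have key : pcancel (fun p : nat * nat => p) (fun p => Some p) by [].
have unkey (k p : nat * nat) : Some k = Some p -> p = k by case.
have iB := burke key unkey iX l0 l10 ll i j.+1.
apply: exp_law_eqfun (iidexp_exp_law (0%N, j.+1) iB) _ => t.
by rewrite /burke_family /= ltnSn.
Qed.

(** Both the point-to-point increments and the stationary ones of rate 1/2 lie between those of
    rates 1/2 - 1/m and 1/2 + 1/m. The latter two are ordered and have nearly equal exponential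
    laws, hence are close in probability by [coupling_gap]. That m and N do not depend on K is what
    later allows K to tend to infinity. *)
Theorem increments_estimate (e : R) : 0 < e ->
  exists2 m, (4 <= m)%N & exists N, forall K p q (X : nat * nat -> T -> R),
  (3 * K < p)%N -> (3 * K < q)%N -> iidexp P X ->
  small P e [set t | exists A B,
    [/\ (N < A <= K)%N, (N < B <= K)%N, (B <= A + A %/ m)%N, (A <= B + B %/ m)%N &
      e < `|ptph (X^~ t) p q A B - fieldh 2^-1 (X^~ t) p.-1 q| \/
      e < `|ptpv (X^~ t) p q A B - fieldv 2^-1 (X^~ t) p q.-1|]].
Proof.
move=> e0; have e40 : 0 < e / 4 by rewrite divr_gt0.
have [h /andP[h0 h4] hgap] := coupling_gap e40.
pose m := maxn 4 (Num.truncn h^-1).+1.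
have m4 : (4 <= m)%N by exact: leq_maxl.
have m0 : 0 < m%:R :> R by rewrite ltr0n (leq_trans _ m4).
have mh : m%:R^-1 <= h :> R.
  rewrite -[h]invrK lef_pV2 ?posrE ?invr_gt0//.
  have h1 : 0 <= h^-1 by rewrite invr_ge0 ltW.
  have /andP[_ hlt] := truncn_itv h1.
  apply: (le_trans (ltW hlt)); rewrite ler_nat; exact: leq_maxr.
exists m => //.
have [N1 hN1] := right_estimate m4 e40.
have [N2 hN2] := left_estimate m4 e40.
exists (maxn N1 N2) => K p q X Kp Kq iX.
have Kp' : (K < p)%N by move: Kp; clear; lia.
have Kq' : (K < q)%N by move: Kq; clear; lia.
have s1 := hN1 K p q X Kp' Kq iX.
have s2 := hN2 K p q X Kp Kq' iX.
pose r : R := m%:R^-1; pose l := 2^-1 - r; pose l' := 2^-1 + r.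
have r0 : 0 < r by rewrite invr_gt0.
have r4 : r <= 4^-1 by rewrite /r lef_pV2 ?posrE// ler_nat.
have l0 : 0 < l by rewrite /l; lra.
have l1 : l < 1 by rewrite /l; lra.
have l'0 : 0 < l' by rewrite /l'; lra.
have l'1 : l' < 1 by rewrite /l'; lra.
have ll' : l' = 1 - l by rewrite /l /l'; lra.
have hl : 2^-1 - h <= l <= 2^-1 by rewrite /l lerD2l lerN2 mh gerBl ltW.
have neg := negligible_neg iX.
have cpl t i j : ~ (exists k, X k t < 0) ->
    [/\ fieldh l' (X^~ t) i j <= fieldh 2^-1 (X^~ t) i j,
        fieldh 2^-1 (X^~ t) i j <= fieldh l (X^~ t) i j,
        fieldv l (X^~ t) i j <= fieldv 2^-1 (X^~ t) i j &
        fieldv 2^-1 (X^~ t) i j <= fieldv l' (X^~ t) i j].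
  move=> nn; have X0 k : 0 <= X k t.
    by rewrite leNgt; apply/negP => ?; apply: nn; exists k.
  have a1 : l <= 2^-1 by case/andP: hl.
  have a2 : 2^-1 <= l' by rewrite /l'; lra.
  have a3 : 2^-1 < 1 :> R by lra.
  have a4 : 0 < 2^-1 :> R by lra.
  by have [? ?] := field_coupling i j X0 l0 a1 a3; have [? ?] := field_coupling i j X0 a4 a2 l'1.
have s3 : small P (e / 4) [set t | e / 4 < fieldh l (X^~ t) p.-1 q - fieldh l' (X^~ t) p.-1 q].
  apply: (hgap l) => //; first exact: fieldh_law.
  - by rewrite -ll'; exact: fieldh_law.
  - apply: negligibleS neg => t /= hlt; apply: contrapT => nn.
    by have [c1 c2 _ _] := cpl t p.-1 q nn; move: hlt; rewrite ltNge (le_trans c1).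
have s4 : small P (e / 4) [set t | e / 4 < fieldv l' (X^~ t) p q.-1 - fieldv l (X^~ t) p q.-1].
  apply: (hgap l) => //.
  - have -> : l = 1 - l' by rewrite ll'; lra.
    exact: fieldv_law.
  - exact: fieldv_law.
  - apply: negligibleS neg => t /= hlt; apply: contrapT => nn.
    by have [_ _ c1 c2] := cpl t p q.-1 nn; move: hlt; rewrite ltNge (le_trans c1).
have s5 := negligible_small (lexx 0) neg.
have := smallU (smallU (smallU s1 s2) (smallU s3 s4)) s5.
have -> : e / 4 + e / 4 + (e / 4 + e / 4) + 0 = e by field.
apply: small_sub => t [A [B [NA NB BA AB h12]]].
apply: contrapT => /not_orP[/not_orP[/not_orP[n1 n2] /not_orP[n3 n4]] n5].
have [c1 c2 _ _] := cpl t p.-1 q n5.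
have [_ _ c3 c4] := cpl t p q.-1 n5.
have [r1 r2] : ptph (X^~ t) p q A B <= fieldh l (X^~ t) p.-1 q /\
       fieldv l (X^~ t) p q.-1 <= ptpv (X^~ t) p q A B.
  apply: contrapT => hn; apply: n1; exists A, B; split => //.
    by move: NA; clear; lia.
  by move: NB BA; clear; lia.
have [r3 r4'] : fieldh l' (X^~ t) p.-1 q <= ptph (X^~ t) p q A B /\
       ptpv (X^~ t) p q A B <= fieldv l' (X^~ t) p q.-1.
  apply: contrapT => hn; apply: n2; exists A, B; split => //.
    by move: NB; clear; lia.
  by move: NA AB; clear; lia.
have g1 : fieldh l (X^~ t) p.-1 q - fieldh l' (X^~ t) p.-1 q <= e / 4.
  by rewrite leNgt; apply/negP.
have g2 : fieldv l' (X^~ t) p q.-1 - fieldv l (X^~ t) p q.-1 <= e / 4.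
  by rewrite leNgt; apply/negP.
have sq (a b x y : R) : a <= x -> x <= b -> a <= y -> y <= b -> b - a <= e / 4 ->
    ~ e < `|x - y|.
  move=> ax xb ay yb ba; apply/negP; rewrite -leNgt ler_norml.
  by move: e0 ax xb ay yb ba; clear; move=> *; apply/andP; split; lra.
by case: h12; [exact: (sq (fieldh l' (X^~ t) p.-1 q) (fieldh l (X^~ t) p.-1 q))
              |exact: (sq (fieldv l (X^~ t) p q.-1) (fieldv l' (X^~ t) p q.-1))].
Qed.

End sandwich.

(** * Busemann functions *)

Section site_lpp.
Context {R : realType}.

Definition quad (c : site) (w : site -> R) (p : nat * nat) : R :=
  w (c.1 + p.1%:Z, c.2 + p.2%:Z).

Definition site_lpp (w : site -> R) (v : site) := ptp (quad v w) 0 0.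

Definition back (x : site) (A B : nat) : site := (x.1 - A%:Z, x.2 - B%:Z).

Definition binch w x A B :=
  site_lpp w (back x A B) A B - site_lpp w (back x A B) A.-1 B.
Definition bincv w x A B :=
  site_lpp w (back x A B) A B - site_lpp w (back x A B) A B.-1.

Lemma ptp_quad c w a b i j :
  ptp (quad c w) a b i j = site_lpp w (c.1 + a%:Z, c.2 + b%:Z) i j.
Proof.
apply: (lpp_ext (m := i) (n := j)) => // *; rewrite /quad /=; congr (w (_, _)); lia.
Qed.

Lemma ptph_quad c w p q A B : (A <= p)%N -> (B <= q)%N ->
  ptph (quad c w) p q A B = binch w (c.1 + p%:Z, c.2 + q%:Z) A B.
Proof.
move=> Ap Bq; rewrite /ptph /binch !ptp_quad /back /=.
by have -> : (c.1 + (p - A)%:Z, c.2 + (q - B)%:Z) = (c.1 + p%:Z - A%:Z, c.2 + q%:Z - B%:Z)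
  by congr (_, _); lia.
Qed.

Lemma ptpv_quad c w p q A B : (A <= p)%N -> (B <= q)%N ->
  ptpv (quad c w) p q A B = bincv w (c.1 + p%:Z, c.2 + q%:Z) A B.
Proof.
move=> Ap Bq; rewrite /ptpv /bincv !ptp_quad /back /=.
by have -> : (c.1 + (p - A)%:Z, c.2 + (q - B)%:Z) = (c.1 + p%:Z - A%:Z, c.2 + q%:Z - B%:Z)
  by congr (_, _); lia.
Qed.

Definition cone (m N A B : nat) : bool :=
  [&& (N < A)%N, (N < B)%N, (B <= A + A %/ m)%N & (A <= B + B %/ m)%N].

(* b1, b2 are the horizontal and vertical Busemann increments in the direction
   -(1, 1). *)
Definition busemann (w : site -> R) (b1 b2 : site -> R) :=
  forall x e, 0 < e -> exists2 m, (0 < m)%N & exists N, forall A B, cone m N A B ->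
    `|binch w x A B - b1 x| <= e /\ `|bincv w x A B - b2 x| <= e.

End site_lpp.

Lemma negligible_countable {d} {T : measurableType d} {R : realType}
    (P : probability T R) (I : countType) (F : I -> set T) :
  (forall i, P.-negligible (F i)) -> P.-negligible [set t | exists i, F i t].
Proof.
move=> h; rewrite (_ : [set _ | _] = \bigcup_n
  (if (unpickle n : option I) is Some i then F i else set0)); last first.
  apply/seteqP; split=> t /=; last by move=> [n _]; case: unpickle => // i; exists i.
  by move=> [i Fi]; exists (pickle i) => //; rewrite pickleK.
by apply: negligible_bigcup => n; case: unpickle => [i|]; [exact: h|exact: negligible_set0].
Qed.

Lemma measurable_lpp {R : realType} d' (U : measurableType d') (u v : nat -> U -> R)
    (w : nat -> nat -> U -> R) i j :
  (forall k, measurable_fun setT (u k)) -> (forall k, measurable_fun setT (v k)) ->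
  (forall k l, measurable_fun setT (w k l)) ->
  measurable_fun setT (fun t => lpp (u^~ t) (v^~ t) (fun k l => w k l t) i j).
Proof.
move=> mu mv mw; elim: j i => [|j ihj] i.
  by rewrite /=; apply: measurable_sum.
elim: i => [|i ihi].
  rewrite [X in measurable_fun _ X](_ : _ = (fun t => lpp (u^~ t) (v^~ t) (fun k l => w k l t) 0 j + v j t))//.
  exact: measurable_funD.
rewrite [X in measurable_fun _ X](_ : _ = (fun t => w i j t +
   Num.max (lpp (u^~ t) (v^~ t) (fun k l => w k l t) i j.+1)
           (lpp (u^~ t) (v^~ t) (fun k l => w k l t) i.+1 j)))//.
by apply: measurable_funD => //; exact: measurable_maxr.
Qed.

Lemma measurable_site_lpp {R : realType} d' (U : measurableType d') (W : site -> U -> R) v i j :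
  (forall x, measurable_fun setT (W x)) ->
  measurable_fun setT (fun t => site_lpp (W^~ t) v i j).
Proof.
move=> mW; rewrite /site_lpp /ptp /quad.
by apply: (measurable_lpp (u := fun k => W _) (v := fun k => W _) (w := fun k l => W _)).
Qed.

(** The limit is also presented as an upper limit, because upper limits of measurable functions are
    measurable. *)
Lemma cvg_of_osc {R : realType} (r : nat -> R) :
  (forall e, 0 < e -> exists N, forall n n', (N < n)%N -> (N < n')%N -> `|r n - r n'| <= e) ->
  exists l, forall e, 0 < e -> exists N, forall n, (N < n)%N -> `|r n - l| <= e /\
  limn_esup (fun n => (r n)%:E) = l%:E.
Proof.
move=> h.
have cr : cvgn r.
  apply: cauchy_cvg; apply/cauchyP => e e0; have e20 : 0 < e / 2 by rewrite divr_gt0.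
  have [N hN] := h _ e20; exists (r N.+1).
  exists N.+1 => // n /= Nn; rewrite /ball /=.
  by rewrite (le_lt_trans (hN _ _ (ltnSn _) Nn))// ltr_pdivrMr// ltr_pMr// ltr1n.
exists (limn r) => e e0.
have /cvgrPdist_le/(_ _ e0)[N _ hN] : r @ \oo --> limn r by [].
exists N => n /ltnW Nn; split; first by rewrite distrC; exact: hN.
have c : (fun n => (r n)%:E) @ \oo --> (limn r)%:E by apply: cvg_EFin; [exact: nearW|exact: cr].
by have [_] := cvg_limn_einf_sup c.
Qed.

Section busemann_limit.
Context {d} {T : measurableType d} {R : realType} (P : probability T R).
Variable W : site -> T -> R.
Hypothesis iW : iidexp P W.

Lemma iidexp_quad c : iidexp P (fun p t => quad c (W^~ t) p).
Proof.
apply: (iidexp_reindex (f := fun p : nat * nat => (c.1 + p.1%:Z, c.2 + p.2%:Z))) => //.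
by move=> [a b] [a' b'] /= [h1 h2]; congr (_, _); lia.
Qed.

Definition corner (M : nat) : site := (- M%:Z, - M%:Z).
Definition box_field (M : nat) t := field 2^-1 (quad (corner M) (W^~ t)).
Definition boxi (M : nat) (a : int) : nat := absz (a + M%:Z).
Definition boxh M x t :=
  box_field M t (boxi M x.1) (boxi M x.2) - box_field M t (boxi M x.1).-1 (boxi M x.2).
Definition boxv M x t :=
  box_field M t (boxi M x.1) (boxi M x.2) - box_field M t (boxi M x.1) (boxi M x.2).-1.

Let osc x (e : R) m N K : set T := [set t | exists A B A' B',
  [/\ cone m N A B, cone m N A' B', [&& A <= K, B <= K, A' <= K & B' <= K]%N &
   e < `|binch (W^~ t) x A B - binch (W^~ t) x A' B'| \/
   e < `|bincv (W^~ t) x A B - bincv (W^~ t) x A' B'|]].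

Let box_estimate x (e : R) : 0 < e -> exists2 m, (4 <= m)%N & exists N, forall K,
  exists M0, forall M, (M0 <= M)%N ->
  small P e [set t | exists A B, [/\ cone m N A B, (A <= K)%N, (B <= K)%N &
     e < `|binch (W^~ t) x A B - boxh M x t| \/
     e < `|bincv (W^~ t) x A B - boxv M x t|]].
Proof.
move=> e0; have [m m4 [N hN]] := increments_estimate P e0.
exists m => //; exists N => K.
exists (3 * K + 2 + `|x.1| + `|x.2|)%N => M hM.
have e1 : (boxi M x.1)%:Z = x.1 + M%:Z by rewrite /boxi; move: hM; clear; lia.
have e2 : (boxi M x.2)%:Z = x.2 + M%:Z by rewrite /boxi; move: hM; clear; lia.
have p1 : (3 * K < boxi M x.1)%N by move: hM e1; clear; lia.
have q1 : (3 * K < boxi M x.2)%N by move: hM e2; clear; lia.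
apply: small_sub (hN K _ _ _ p1 q1 (iidexp_quad (corner M))).
move=> t /= [A [B [/and4P[NA NB BA AB] AK BK h]]].
exists A, B; split; rewrite ?NA ?NB//.
have ex : ((corner M).1 + (boxi M x.1)%:Z, (corner M).2 + (boxi M x.2)%:Z) = x.
  by rewrite e1 e2 /=; case: (x) => a b /=; congr (_, _); lia.
have Ap : (A <= boxi M x.1)%N by move: p1 AK; clear; lia.
have Bp : (B <= boxi M x.2)%N by move: q1 BK; clear; lia.
have eh := ptph_quad (corner M) (W^~ t) Ap Bp.
have ev := ptpv_quad (corner M) (W^~ t) Ap Bp.
rewrite ex in eh ev.
move: h; rewrite -eh -ev /fieldh /fieldv.
by rewrite !prednK//; move: p1 q1; clear; lia.
Qed.

(** The box is only an intermediary: two increments close to the same box increment are close to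
    each other. Once the box is eliminated the bound no longer involves M, and the events increase
    with K. *)
Let osc_union x (e : R) m N :
  (forall K, exists M0, forall M, (M0 <= M)%N ->
    small P e [set t | exists A B, [/\ cone m N A B, (A <= K)%N, (B <= K)%N &
     e < `|binch (W^~ t) x A B - boxh M x t| \/
     e < `|bincv (W^~ t) x A B - boxv M x t|]]) ->
  small P e (\bigcup_K osc x (2 * e) m N K).
Proof.
move=> hN; apply: small_bigcup.
  move=> K K' KK t [A [B [A' [B' [c1 c2 /and4P[k1 k2 k3 k4] h]]]]].
  exists A, B, A', B'; split=> //; apply/and4P; split; exact: leq_trans KK.
move=> K; have [M0 /(_ _ (leqnn M0)) hM] := hN K.
apply: small_sub hM => t [A [B [A' [B' [c1 c2 /and4P[k1 k2 k3 k4] h]]]]].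
apply: contrapT => n.
have close A1 B1 : cone m N A1 B1 -> (A1 <= K)%N -> (B1 <= K)%N ->
    `|binch (W^~ t) x A1 B1 - boxh M0 x t| <= e /\
    `|bincv (W^~ t) x A1 B1 - boxv M0 x t| <= e.
  move=> c a b; split; rewrite leNgt; apply/negP => hh; apply: n; exists A1, B1; split=> //.
    by left.
  by right.
have [h1 v1] := close _ _ c1 k1 k2; have [h2 v2] := close _ _ c2 k3 k4.
have tri (a b c : R) : `|a - c| <= e -> `|b - c| <= e -> ~ 2 * e < `|a - b|.
  move=> ac bc; apply/negP; rewrite -leNgt -(subrKA c) mulr2n mulrDl mul1r.
  by rewrite (le_trans (ler_normD _ _))// lerD// distrC.
by case: h => h; [exact: tri h1 h2 h|exact: tri v1 v2 h].
Qed.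

Let osc_small x (e : R) : 0 < e -> exists2 m, (4 <= m)%N & exists N,
  small P e (\bigcup_K osc x (2 * e) m N K).
Proof.
move=> e0; have [m m4 [N hN]] := box_estimate x e0.
by exists m => //; exists N; exact: osc_union.
Qed.

Let cauchy_ae : P.-negligible [set t | ~ forall x e, 0 < e ->
  exists2 m, (4 <= m)%N & exists N, forall K, ~ osc x e m N K t].
Proof.
pose bad x (k : nat) := [set t | forall m, (4 <= m)%N -> forall N,
  exists K, osc x k.+1%:R^-1 m N K t].
suff h x k : P.-negligible (bad x k).
  apply: negligibleS (negligible_countable (F := fun p : site * nat => bad p.1 p.2) (fun p => h p.1 p.2)).
  move=> t /=; apply: contra_notP => nb x e e0.
  have [k _ /(_ _ (leqnn k)) /= ke] := near_infty_natSinv_lt (PosNum e0).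
  apply: contrapT => hx; apply: nb; exists (x, k) => m m4 N.
  apply: contrapT => hK; apply: hx; exists m => //; exists N => K [A [B [A' [B' [c1 c2 c3 hh]]]]].
  apply: hK; exists K, A, B, A', B'; split=> //.
  by case: hh => hh; [left|right]; exact: lt_trans hh.
apply: small_negligible => e e0.
pose e' := Num.min (e / 2) (k.+1%:R^-1 / 2).
have e'0 : 0 < e' by rewrite lt_min !divr_gt0.
have e'e : e' <= e / 2 by rewrite ge_min lexx.
have e'k : 2 * e' <= k.+1%:R^-1.
  by rewrite mulrC -ler_pdivlMr// ge_min lexx orbT.
have [m m4 [N hs]] := osc_small x e'0.
apply: small_le (small_sub _ hs); first by lra.
move=> t ht; have [K [A [B [A' [B' [c1 c2 c3 hh]]]]]] := ht m m4 N.
exists K => //; exists A, B, A', B'; split=> //.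
by case: hh => hh; [left|right]; exact: le_lt_trans hh.
Qed.

(** An upper limit along the diagonal is measurable in t without any null set; off a null set it is
    the limit in the whole cone. *)
Definition bush x t : R := fine (limn_esup (fun n => (binch (W^~ t) x n n)%:E)).
Definition busv x t : R := fine (limn_esup (fun n => (bincv (W^~ t) x n n)%:E)).

Let mW x : measurable_fun setT (W x). Proof. exact: iW.1. Qed.

Let measurable_binch x A B : measurable_fun setT (fun t => binch (W^~ t) x A B).
Proof. by apply: measurable_funB; exact: measurable_site_lpp. Qed.

Let measurable_bincv x A B : measurable_fun setT (fun t => bincv (W^~ t) x A B).
Proof. by apply: measurable_funB; exact: measurable_site_lpp. Qed.

Lemma measurable_bush x : measurable_fun setT (bush x).
Proof.
apply: (@measurableT_comp _ _ _ _ _ _ fine); first exact: fine_measurable.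
by apply: measurable_fun_limn_esup => n; apply/measurable_EFinP.
Qed.

Lemma measurable_busv x : measurable_fun setT (busv x).
Proof.
apply: (@measurableT_comp _ _ _ _ _ _ fine); first exact: fine_measurable.
by apply: measurable_fun_limn_esup => n; apply/measurable_EFinP.
Qed.

Let cone_diag m N n : (N < n)%N -> cone m N n n.
Proof. by move=> Nn; rewrite /cone Nn leq_addr. Qed.

Let cauchy t := forall x e, 0 < e ->
  exists2 m, (4 <= m)%N & exists N, forall K, ~ osc x e m N K t.

Let osc_lim t x e m N : cauchy t -> 0 < e -> (forall K, ~ osc x e m N K t) ->
  forall A B, cone m N A B -> `|binch (W^~ t) x A B - bush x t| <= e /\
    `|bincv (W^~ t) x A B - busv x t| <= e.
Proof.
move=> ct e0 noosc A B cAB.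
have pair A' B' : cone m N A' B' ->
   `|binch (W^~ t) x A B - binch (W^~ t) x A' B'| <= e /\
   `|bincv (W^~ t) x A B - bincv (W^~ t) x A' B'| <= e.
  move=> c'; split; rewrite leNgt; apply/negP => hh; apply: (noosc (A + B + A' + B')%N);
  exists A, B, A', B'; split=> //; try (apply/and4P; split; clear; lia); by [left|right].
have oh : forall e, 0 < e -> exists N, forall n n', (N < n)%N -> (N < n')%N ->
    `|binch (W^~ t) x n n - binch (W^~ t) x n' n'| <= e.
  move=> e1 e10; have [m1 m14 [N1 h1]] := ct x e1 e10; exists N1 => n n' hn hn'.
  rewrite leNgt; apply/negP => hh; apply: (h1 (n + n')%N).
  exists n, n, n', n'; split; rewrite ?cone_diag ?leq_addr ?leq_addl//; by left.
have ov : forall e, 0 < e -> exists N, forall n n', (N < n)%N -> (N < n')%N ->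
    `|bincv (W^~ t) x n n - bincv (W^~ t) x n' n'| <= e.
  move=> e1 e10; have [m1 m14 [N1 h1]] := ct x e1 e10; exists N1 => n n' hn hn'.
  rewrite leNgt; apply/negP => hh; apply: (h1 (n + n')%N).
  exists n, n, n', n'; split; rewrite ?cone_diag ?leq_addr ?leq_addl//; by right.
have [lh hlh] := cvg_of_osc oh; have [lv hlv] := cvg_of_osc ov.
split; apply/ler_addgt0Pr => e1 e10.
  have [N1 h1] := hlh e1 e10.
  pose n := (maxn N N1).+1.
  have [h2 h3] := h1 n (leq_maxr _ _).
  have [p1 _] := pair n n (cone_diag m (leq_maxl _ _ : (N < n)%N)).
  rewrite /bush h3 /= -(subrKA (binch (W^~ t) x n n)).
  by rewrite (le_trans (ler_normD _ _))// lerD.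
have [N1 h1] := hlv e1 e10.
pose n := (maxn N N1).+1.
have [h2 h3] := h1 n (leq_maxr _ _).
have [_ p1] := pair n n (cone_diag m (leq_maxl _ _ : (N < n)%N)).
rewrite /busv h3 /= -(subrKA (bincv (W^~ t) x n n)).
by rewrite (le_trans (ler_normD _ _))// lerD.
Qed.

Theorem busemann_ae :
  P.-negligible [set t | ~ busemann (W^~ t) (bush^~ t) (busv^~ t)].
Proof.
apply: negligibleS cauchy_ae => t /=; apply: contra_not => ct x e e0.
have [m m4 [N h]] := ct x e e0; exists m; first exact: leq_trans m4.
by exists N => A B; exact: osc_lim.
Qed.

Let box_close x (e : R) : 0 < e -> exists M0, forall M, (M0 <= M)%N ->
  small P e [set t | e < `|boxh M x t - bush x t| \/ e < `|boxv M x t - busv x t|].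
Proof.
move=> e0; have e40 : 0 < e / 4 by rewrite divr_gt0.
have [m m4 [N hN]] := box_estimate x e40.
have s1 := osc_union hN.
have s2 := negligible_small (ltW e40) cauchy_ae.
have [M0 hM0] := hN N.+1; exists M0 => M /hM0 s3.
apply: small_le (small_sub _ (smallU s1 (smallU s2 s3))); first by lra.
move=> t /= ht; apply: contrapT => /not_orP[n1 /not_orP[/contrapT ct n3]].
have c1 : cone m N N.+1 N.+1 by apply: cone_diag.
have e20 : 0 < 2 * (e / 4) by lra.
have [h1 v1] := osc_lim ct e20 (fun K (hK : osc x _ m N K t) => n1 (ex_intro2 _ _ K I hK)) c1.
have tri (a b c : R) : `|a - c| <= 2 * (e / 4) -> ~ (e / 4 < `|a - b|) -> ~ e < `|b - c|.
  move=> ac /negP; rewrite -leNgt => ab; apply/negP; rewrite -leNgt -(subrKA a).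
  by rewrite (le_trans (ler_normD _ _))// distrC (le_trans (lerD ab ac))//; lra.
by case: ht; [apply: tri h1 _|apply: tri v1 _] => hh; apply: n3;
  exists N.+1, N.+1; split=> //; [left|right].
Qed.

Lemma boxh_cvg x : cvg_in_prob P (fun M => boxh M x) (bush x).
Proof.
move=> e e0; have [M0 h] := box_close x e0; exists M0 => M /h.
by apply: small_sub => t; left.
Qed.

Lemma boxv_cvg x : cvg_in_prob P (fun M => boxv M x) (busv x).
Proof.
move=> e e0; have [M0 h] := box_close x e0; exists M0 => M /h.
by apply: small_sub => t; right.
Qed.

End busemann_limit.

(** * Dual weights *)

Lemma ler_dist_min {R : realType} (a b a' b' e : R) :
  `|a - a'| <= e -> `|b - b'| <= e -> `|Num.min a b - Num.min a' b'| <= e.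
Proof.
rewrite !ler_norml => /andP[h1 h2] /andP[h3 h4].
by case: (leP a b) => ab; case: (leP a' b') => ab'; apply/andP; split; lra.
Qed.

Lemma ler_dist_max {R : realType} (a b a' b' e : R) :
  `|a - a'| <= e -> `|b - b'| <= e -> `|Num.max a b - Num.max a' b'| <= e.
Proof.
rewrite !ler_norml => /andP[h1 h2] /andP[h3 h4].
by case: (leP a b) => ab; case: (leP a' b') => ab'; apply/andP; split; lra.
Qed.

Lemma lpp_lipschitz {R : realType} (u v u' v' : nat -> R) w w' m n (e : R) : 0 <= e ->
  (forall i, (i < m)%N -> `|u i - u' i| <= e) -> (forall j, (j < n)%N -> `|v j - v' j| <= e) ->
  (forall i j, (i < m)%N -> (j < n)%N -> `|w i j - w' i j| <= e) ->
  forall i j, (i <= m)%N -> (j <= n)%N ->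
  `|lpp u v w i j - lpp u' v' w' i j| <= (i + j)%:R * e.
Proof.
move=> e0 eu ev ew; have add (a b c d x y : R) :
  `|a - c| <= x -> `|b - d| <= y -> `|(a + b) - (c + d)| <= x + y.
  move=> h1 h2; have -> : (a + b) - (c + d) = (a - c) + (b - d) by ring.
  by rewrite (le_trans (ler_normD _ _))// lerD.
have cS k : k.+1%:R * e = k%:R * e + e by rewrite -natr1 mulrDl mul1r.
move=> i j; elim: j i => [|j ihj].
  elim=> [|i ihi] im _; first by rewrite !lpp00 subrr normr0 mul0r.
  by rewrite !lppS0 addSn cS; apply: add; [apply: ihi => //; exact: ltnW|exact: eu].
elim=> [|i ihi] im jn.
  by rewrite !lpp0S addnS cS; apply: add; [apply: ihj => //; exact: ltnW|exact: ev].
rewrite !lppSS addSn cS [_ + e]addrC; apply: add; first exact: ew.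
by apply: ler_dist_max; [apply: ihi => //; exact: ltnW|rewrite addnS -addSn; apply: ihj => //; exact: ltnW].
Qed.

(** An identity for arbitrary G: the larger of the two reversed values is G S S minus the smaller
    value of G at the two intermediate corners, and adding the minimum of the two increments leaves
    exactly G at the opposite corner. Read backwards, a field is a last passage field for its own
    minima. *)
Lemma lpp_reverse {R : realType} (G : nat -> nat -> R) S :
  forall i j, (i <= S)%N -> (j <= S)%N ->
  lpp (fun k => G (S - k)%N S - G (S - k.+1)%N S) (fun k => G S (S - k)%N - G S (S - k.+1)%N)
    (fun k l => Num.min (G (S - k)%N (S - l.+1)%N - G (S - k.+1)%N (S - l.+1)%N)
                        (G (S - k.+1)%N (S - l)%N - G (S - k.+1)%N (S - l.+1)%N)) i j =
  G S S - G (S - i)%N (S - j)%N.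
Proof.
move=> i j; elim: j i => [|j ihj].
  elim=> [|i ihi] iS _; first by rewrite lpp00 subn0 subrr.
  by rewrite lppS0 (ihi (ltnW iS) (leq0n _)) subn0; ring.
elim=> [|i ihi] iS jS; first by rewrite lpp0S (ihj _ (leq0n _) (ltnW jS)) subn0; ring.
rewrite lppSS (ihi (ltnW iS) jS) (ihj _ iS (ltnW jS)).
by case: (leP (G S S - _)) => h1; case: (leP (_ - _) _) => h2; lra.
Qed.

Section dual_weights.
Context {R : realType}.
Implicit Types (w : site -> R).

(* The smaller increment along the two lower-left sides of the plaquette whose
   upper-right corner is x. *)
Definition dual_weight (b1 b2 : site -> R) (x : site) : R :=
  Num.min (b1 (x.1, x.2 - 1)) (b2 (x.1 - 1, x.2)).

End dual_weights.

Lemma cvg_in_prob_eq {d} {T : measurableType d} {R : realType} (P : probability T R)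
   (Y Y' : nat -> T -> R) Z :
  (exists M1, forall M, (M1 <= M)%N -> Y M =1 Y' M) -> cvg_in_prob P Y' Z -> cvg_in_prob P Y Z.
Proof.
move=> [M1 h] c e e0; have [M0 hM] := c e e0.
exists (maxn M0 M1) => M; rewrite geq_max => /andP[M0M M1M].
by apply: small_sub (hM M M0M) => t /=; rewrite h.
Qed.

Lemma cvg_in_prob_min {d} {T : measurableType d} {R : realType} (P : probability T R)
   (Y Y' : nat -> T -> R) Z Z' :
  cvg_in_prob P Y Z -> cvg_in_prob P Y' Z' ->
  cvg_in_prob P (fun M t => Num.min (Y M t) (Y' M t)) (fun t => Num.min (Z t) (Z' t)).
Proof.
move=> c c' e e0; have e20 : 0 < e / 2 by rewrite divr_gt0.
have [M0 h] := c _ e20; have [M0' h'] := c' _ e20; exists (maxn M0 M0') => M.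
rewrite geq_max => /andP[/h s1 /h' s2].
apply: small_le (small_sub _ (smallU s1 s2)); first by lra.
move=> t /= ht; apply: contrapT => /not_orP[/negP + /negP]; rewrite -!leNgt => h1 h2.
have := ler_dist_min h1 h2; lra.
Qed.

Lemma cvg_in_prob_seq {d} {T : measurableType d} {R : realType} (P : probability T R)
   (I : eqType) (Y : I -> nat -> T -> R) (Z : I -> T -> R) (s : seq I) (c e : R) :
  (forall i, cvg_in_prob P (Y i) (Z i)) -> 0 < c -> 0 < e ->
  exists M0, forall M, (M0 <= M)%N ->
    small P e [set t | exists2 i, i \in s & c < `|Y i M t - Z i t|].
Proof.
move=> h c0; elim: s e => [|i s ih] e e0.
  by exists 0%N => M _; apply: negligible_small (ltW e0) _; apply: (@negligibleS _ _ _ _ set0) => [t []//|]; exact: negligible_set0.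
have e20 : 0 < e / 2 by rewrite divr_gt0.
have [M0 h0] := ih _ e20.
have m0 : 0 < Num.min c (e / 2) by rewrite lt_min c0 e20.
have [M1 h1] := h i _ m0.
exists (maxn M0 M1) => M; rewrite geq_max => /andP[/h0 s0 /h1 s1].
have {}s1 := small_le (_ : Num.min c (e / 2) <= e / 2) s1.
apply: small_le (small_sub _ (smallU s0 (s1 _))); rewrite ?ge_min ?lexx ?orbT//; first by lra.
move=> t [k]; rewrite inE => /orP[/eqP -> hk|ks hk]; [right|by left; exists k].
by rewrite /= gt_min hk.
Qed.

Lemma ptp_lipschitz {R : realType} (x x' : nat * nat -> R) a b i j (e : R) : 0 <= e ->
  (forall k l, (k <= i)%N -> (l <= j)%N -> (0 < k + l)%N ->
     `|x ((a + k)%N, (b + l)%N) - x' ((a + k)%N, (b + l)%N)| <= e) ->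
  forall A B, (A <= i)%N -> (B <= j)%N ->
  `|ptp x a b A B - ptp x' a b A B| <= (A + B)%:R * e.
Proof.
move=> e0 h A B Ai Bj; apply: (@lpp_lipschitz _ _ _ _ _ _ _ A B) => // [k kA|l lB|k l kA lB].
- by have := h k.+1 0%N; rewrite !addn0 !addnS; apply; lia.
- by have := h 0%N l.+1; rewrite !addn0 !addnS; apply; lia.
- by rewrite -!addnS; apply: h; lia.
Qed.

Definition box_key M (p : nat * nat) : site := (- M%:Z + p.1%:Z, - M%:Z + p.2%:Z).
Definition box_unkey M (x : site) : option (nat * nat) :=
  if (0 <= x.1 + M%:Z) && (0 <= x.2 + M%:Z) then Some (boxi M x.1, boxi M x.2) else None.

Lemma box_keyK M : pcancel (box_key M) (box_unkey M).
Proof.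
move=> [i j]; rewrite /box_unkey /box_key /= ![- _ + _]addrC !subrK /=; congr (Some (_, _)); rewrite /boxi; lia.
Qed.

Lemma box_unkeyK M x p : box_unkey M x = Some p -> box_key M p = x.
Proof.
rewrite /box_unkey; case: ifP => // /andP[h1 h2] [<-]; rewrite /box_key /boxi /=.
by case: x h1 h2 => a b /= h1 h2; congr (_, _); lia.
Qed.

Section dual.
Context {d} {T : measurableType d} {R : realType} (P : probability T R).
Variable W : site -> T -> R.
Hypothesis iW : iidexp P W.

Let b1 := bush W. Let b2 := busv W.

Definition dual_field t x := dual_weight (b1^~ t) (b2^~ t) x.

Definition dual_box M x t := dual_weight (fun y => boxh W M y t) (fun y => boxv W M y t) x.

Lemma dual_box_cvg x : cvg_in_prob P (fun M => dual_box M x) (fun t => dual_field t x).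
Proof. by apply: cvg_in_prob_min; [exact: boxh_cvg|exact: boxv_cvg]. Qed.

Let half0 : 0 < 2^-1 :> R. Proof. by rewrite invr_gt0. Qed.
Let half1 : 0 < 1 - 2^-1 :> R. Proof. lra. Qed.
Let halfD : 2^-1 + (1 - 2^-1) = 1 :> R. Proof. lra. Qed.

Let Z M := burke_family (box_key M) (box_unkey M) W 2^-1 (1 - 2^-1) (M + M) (M + M) 0.

Let iZ M : iidexp P (Z M).
Proof. exact: (burke (@box_keyK M) (@box_unkeyK M) iW half0 half1 halfD). Qed.

Let field_bdry M t i j : box_field W M t i j =
  lpp (bdry1 (box_key M) W 2^-1 t) (bdry2 (box_key M) W (1 - 2^-1) t) (bulk (box_key M) W t) i j.
Proof. by []. Qed.

Let key_box M (i : nat) : boxi M (- M%:Z + i%:Z) = i.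
Proof. rewrite /boxi; lia. Qed.

Let Zbox M i j t : (i < M + M)%N -> (j < M + M)%N ->
  Z M (box_key M (i.+1, j.+1)) t = dual_box M (box_key M (i.+1, j.+1)) t.
Proof.
move=> iM jM; rewrite /Z (burke_family_key (@box_keyK M)) /burke_state iM jM /= /dual_box /dual_weight.
rewrite /boxh /boxv /=.
have -> : - M%:Z + j.+1%:Z - 1 = - M%:Z + j%:Z by lia.
have -> : - M%:Z + i.+1%:Z - 1 = - M%:Z + i%:Z by lia.
by rewrite !key_box /= !field_bdry.
Qed.

(** The interior entries of the Burke family of a fully processed box are box versions of the dual
    weights, which converge in probability. *)
Lemma dual_iidexp : iidexp P (fun x t => dual_field t x).
Proof.
apply: (iidexp_limit (Y := Z)) => // x.
  by apply: measurable_minr; [exact: (measurable_bush iW)|exact: (measurable_busv iW)].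
apply: cvg_in_prob_eq (dual_box_cvg x).
exists (`|x.1| + `|x.2| + 2)%N => M hM t.
have e1 : x = box_key M ((boxi M x.1).-1.+1, (boxi M x.2).-1.+1).
  by case: x hM => a b /= hM; rewrite /box_key /boxi /=; congr (_, _); move: hM; clear; lia.
by rewrite e1 Zbox// /boxi; move: hM; clear; lia.
Qed.

(* The family [Z M] read from the upper-right corner of the box: by Burke's
   theorem it is again i.i.d., and its stationary field is the original one
   reversed. *)
Let rev M k := if (0 < k <= M + M)%N then ((M + M).+1 - k)%N else k.

Let revI M : injective (rev M).
Proof. by move=> k l; rewrite /rev; do 2![case: ifP]; lia. Qed.

Let X M (p : nat * nat) := Z M (box_key M (rev M p.1, rev M p.2)).

Let iX M : iidexp P (X M).
Proof.
apply: (iidexp_reindex (f := fun p : nat * nat => box_key M (rev M p.1, rev M p.2))) (iZ M).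
by move=> [a b] [a' b'] /(pcan_inj (@box_keyK M)) [/revI -> /revI ->].
Qed.

Let Xbox M a b t : (0 < a <= M + M)%N -> (0 < b <= M + M)%N ->
  X M (a, b) t = dual_box M (M.+1%:Z - a%:Z, M.+1%:Z - b%:Z) t.
Proof.
case/andP=> a0 aM /andP[b0 bM]; rewrite /X /rev /= a0 aM b0 bM /= !subSn// Zbox; try lia.
by congr (dual_box _ (_, _) _); rewrite /=; move: a0 aM b0 bM; clear; lia.
Qed.

Let Xfield M t i j : (i <= M + M)%N -> (j <= M + M)%N ->
  field 2^-1 ((X M)^~ t) i j =
  box_field W M t (M + M) (M + M) - box_field W M t (M + M - i) (M + M - j).
Proof.
move=> iM jM; rewrite -lpp_reverse//; apply: (lpp_ext (m := i) (n := j)) => // [k ki|l lj|k l ki lj].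
- have kM : (k < M + M)%N by apply: leq_trans iM.
  rewrite /X /rev /= kM subSS /Z (burke_family_key (@box_keyK M)) -subnSK// /burke_state ifT; last by lia.
  by rewrite ltn0 addn0 mulrC mulKf ?gt_eqF// /hinc -!field_bdry subnSK.
- have lM : (l < M + M)%N by apply: leq_trans jM.
  rewrite /X /rev /= lM subSS /Z (burke_family_key (@box_keyK M)) -subnSK// /burke_state ifT; last by lia.
  by rewrite mulrC mulKf ?gt_eqF// /vinc -!field_bdry subnSK.
- have kM : (k < M + M)%N by apply: leq_trans iM.
  have lM : (l < M + M)%N by apply: leq_trans jM.
  rewrite /X /rev /= kM lM !subSS /Z -(subnSK kM) -(subnSK lM) (burke_family_key (@box_keyK M)) /burke_state.
  rewrite ifT; last by lia.
  by rewrite /hinc /vinc -!field_bdry !subnSK.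
Qed.

Definition reflected_dual t (x : site) := dual_field t (- x.1, - x.2).

(* The increments in the direction (1, 1) of the dual weights are those of the
   original weights in the direction -(1, 1). *)
Theorem dual_busemann : P.-negligible [set t | ~ busemann (reflected_dual t)
   (fun x => b1 (- x.1, - x.2 - 1) t) (fun x => b2 (- x.1 - 1, - x.2) t)].
Proof.
pose dh x t := b1 (- x.1, - x.2 - 1) t; pose dv x t := b2 (- x.1 - 1, - x.2) t.
pose bad x (k : nat) := [set t | forall m, (0 < m)%N -> forall N, exists A B, cone m N A B /\
  (k.+1%:R^-1 < `|binch (reflected_dual t) x A B - dh x t| \/
   k.+1%:R^-1 < `|bincv (reflected_dual t) x A B - dv x t|)].
suff h x k : P.-negligible (bad x k).
  apply: negligibleS (negligible_countable (F := fun p : site * nat => bad p.1 p.2) (fun p => h p.1 p.2)).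
  move=> t /=; apply: contra_notP => nb x e e0.
  have [k _ /(_ _ (leqnn k)) /= ke] := near_infty_natSinv_lt (PosNum e0).
  apply: contrapT => hx; apply: nb; exists (x, k) => m m0 N.
  apply: contrapT => hK; apply: hx; exists m => //; exists N => A B c.
  by split; rewrite leNgt; apply/negP => he; apply: hK; exists A, B; split=> //; [left|right];
    exact: lt_trans he.
apply: small_negligible => e e0.
(* Four exceptional events share e. Three errors add up: replacing weights by their box versions,
   the estimate inside the box, and the convergence of the box increments. *)
pose e' := Num.min (e / 4) (k.+1%:R^-1 / 3).
have e'0 : 0 < e' by rewrite lt_min !divr_gt0.
have e'e : e' <= e / 4 by rewrite ge_min lexx.
have e'k : 3 * e' <= k.+1%:R^-1 by rewrite mulrC -ler_pdivlMr// ge_min lexx orbT.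
have [m m4 [N hmN]] := increments_estimate P e'0.
pose near_bad K := [set t | exists A B, [/\ cone m N A B, (A <= K)%N, (B <= K)%N &
  3 * e' < `|binch (reflected_dual t) x A B - dh x t| \/
  3 * e' < `|bincv (reflected_dual t) x A B - dv x t|]].
apply: (@small_sub _ _ _ _ _ (\bigcup_K near_bad K)).
  move=> t /(_ m (leq_trans (isT : 0 < 4)%N m4) N) [A [B [c h]]].
  exists (A + B)%N => //; exists A, B; split; rewrite ?leq_addr ?leq_addl//.
  by case: h => h; [left|right]; exact: le_lt_trans h.
apply: (@small_le _ _ _ _ ((e' + e') + (e' + e'))); first by lra.
apply: small_bigcup.
  by move=> K K' KK t [A [B [c a b h]]]; exists A, B; split=> //; exact: leq_trans KK.
(* Each of the two passage values in an increment moves by at most 2 K times the error on a single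
   weight; an error of e' / (4 K + 1) keeps the total below e'. *)
move=> K; have d0 : 0 < e' / (2 * K).*2.+1%:R by rewrite divr_gt0.
pose window := [seq (a, b) | a <- iota 0 K.+1, b <- iota 0 K.+1].
have [M1 h1] := cvg_in_prob_seq window (fun p : nat * nat => @dual_box_cvg (p.1%:Z - x.1, p.2%:Z - x.2)) d0 e'0.
have [M2 h2] := boxh_cvg iW (- x.1, - x.2 - 1) e'0.
have [M3 h3] := boxv_cvg iW (- x.1 - 1, - x.2) e'0.
pose M := (M1 + M2 + M3 + 3 * K + `|x.1| + `|x.2| + 2)%N.
have hK : (3 * K + `|x.1| + `|x.2| + 2 <= M)%N by rewrite /M; clear; lia.
have /h1 {}h1 : (M1 <= M)%N by rewrite /M; clear; lia.
have /h2 {}h2 : (M2 <= M)%N by rewrite /M; clear; lia.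
have /h3 {}h3 : (M3 <= M)%N by rewrite /M; clear; lia.
move: (M) hK h1 h2 h3 => {M1 M2 M3}M hK h1 h2 h3.
pose p := boxi M.+1 x.1; pose q := boxi M.+1 x.2.
have ep : p%:Z = x.1 + M.+1%:Z by rewrite /p /boxi; move: hK; clear; lia.
have eq : q%:Z = x.2 + M.+1%:Z by rewrite /q /boxi; move: hK; clear; lia.
have [Kp pM] : (3 * K < p)%N /\ (p <= M + M)%N by move: hK ep; clear; lia.
have [Kq qM] : (3 * K < q)%N /\ (q <= M + M)%N by move: hK eq; clear; lia.
have ex : ((corner M.+1).1 + p%:Z, (corner M.+1).2 + q%:Z) = x.
  by rewrite ep eq /=; case: (x) => u v /=; congr (_, _); clear; lia.
have h4 := hmN K p q (X M) Kp Kq (iX M).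
apply: small_le (small_sub _ (smallU (smallU h1 h4) (smallU h2 h3))); first by lra.
move=> t [A [B [c AK BK h]]]; apply: contrapT => /not_orP[/not_orP[n1 n4] /not_orP[n2 n3]].
have Ap : (A <= p)%N by move: Kp AK; clear; lia.
have Bq : (B <= q)%N by move: Kq BK; clear; lia.
pose w2 := quad (corner M.+1) (reflected_dual t).
have eh : ptph w2 p q A B = binch (reflected_dual t) x A B by rewrite ptph_quad// ex.
have ev : ptpv w2 p q A B = bincv (reflected_dual t) x A B by rewrite ptpv_quad// ex.
have lip A' B' : (A' <= A)%N -> (B' <= B)%N ->
  `|ptp ((X M)^~ t) (p - A) (q - B) A' B' - ptp w2 (p - A) (q - B) A' B'| <=
  (2 * K)%:R * (e' / (2 * K).*2.+1%:R).
  move=> AA BB; apply: (@le_trans _ _ ((A' + B')%:R * (e' / (2 * K).*2.+1%:R))); last first.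
    rewrite ler_wpM2r//; first exact: ltW.
    by rewrite ler_nat; move: AA BB AK BK; clear; lia.
  apply: (ptp_lipschitz (i := A) (j := B)) => // [|k' l kA lB _]; first exact: ltW.
  rewrite Xbox; [|move: Ap pM kA Kp AK; clear; lia|move: Bq qM lB Kq BK; clear; lia].
  rewrite leNgt; apply/negP => hh; apply: n1.
  exists ((A - k')%N, (B - l)%N).
    apply/allpairsP; exists ((A - k')%N, (B - l)%N); split=> //; rewrite mem_iota /=;
      move: AK BK; clear; lia.
  move: hh; rewrite /w2 /quad /reflected_dual /corner /=.
  have -> : M.+1%:Z - (p - A + k')%N%:Z = (A - k')%N%:Z - x.1 by move: ep kA Ap; clear; lia.
  have -> : M.+1%:Z - (q - B + l)%N%:Z = (B - l)%N%:Z - x.2 by move: eq lB Bq; clear; lia.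
  have -> : - (- M.+1%:Z + (p - A + k')%N%:Z) = (A - k')%N%:Z - x.1 by move: ep kA Ap; clear; lia.
  by have -> : - (- M.+1%:Z + (q - B + l)%N%:Z) = (B - l)%N%:Z - x.2 by move: eq lB Bq; clear; lia.
have fin (u u' v v' s s' r : R) :
  `|u - v| <= (2 * K)%:R * (e' / (2 * K).*2.+1%:R) ->
  `|u' - v'| <= (2 * K)%:R * (e' / (2 * K).*2.+1%:R) ->
  `|(u - u') - s| <= e' -> s = s' -> `|s' - r| <= e' -> `|(v - v') - r| <= 3 * e'.
  have hd : (2 * K)%:R * (e' / (2 * K).*2.+1%:R) *+ 2 <= e'.
    rewrite -mulrnAl -mulrnA mulrCA ger_pMr// ler_pdivrMr// mul1r ler_nat; clear; lia.
  move: (_ * (e' / _)) hd => z; rewrite mulr2n => hd.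
  move=> + + + <-; rewrite !ler_norml => /andP[a1 a2] /andP[a3 a4] /andP[a5 a6] /andP[a7 a8].
  by apply/andP; split; lra.
have p0 : (0 < p)%N by move: Kp; clear; lia.
have q0 : (0 < q)%N by move: Kq; clear; lia.
have cAB : [/\ (N < A <= K)%N, (N < B <= K)%N, (B <= A + A %/ m)%N & (A <= B + B %/ m)%N].
  by case/and4P: c => -> -> -> ->; rewrite AK BK.
case: cAB => c1 c2 c3 c4.
have [y1 y2] : `|ptph ((X M)^~ t) p q A B - fieldh 2^-1 ((X M)^~ t) p.-1 q| <= e' /\
   `|ptpv ((X M)^~ t) p q A B - fieldv 2^-1 ((X M)^~ t) p q.-1| <= e'.
  by split; rewrite leNgt; apply/negP => hh; apply: n4; exists A, B; split=> //; [left|right].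
have z1 : fieldh 2^-1 ((X M)^~ t) p.-1 q = boxh W M (- x.1, - x.2 - 1) t.
  rewrite /fieldh prednK// !Xfield//; last by rewrite (leq_trans (leq_pred _)).
  rewrite /boxh /=.
  have -> : boxi M (- x.1) = (M + M - p).+1 by rewrite /boxi; move: ep pM; clear; lia.
  have -> : boxi M (- x.2 - 1) = (M + M - q)%N by rewrite /boxi; move: eq qM; clear; lia.
  have -> : (M + M - p.-1)%N = (M + M - p).+1 by move: p0 pM; clear; lia.
  by rewrite /=; ring.
have z2 : fieldv 2^-1 ((X M)^~ t) p q.-1 = boxv W M (- x.1 - 1, - x.2) t.
  rewrite /fieldv prednK// !Xfield//; last by rewrite (leq_trans (leq_pred _)).
  rewrite /boxv /=.
  have -> : boxi M (- x.1 - 1) = (M + M - p)%N by rewrite /boxi; move: ep pM; clear; lia.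
  have -> : boxi M (- x.2) = (M + M - q).+1 by rewrite /boxi; move: eq qM; clear; lia.
  have -> : (M + M - q.-1)%N = (M + M - q).+1 by move: q0 qM; clear; lia.
  by rewrite /=; ring.
case: h; apply/negP; rewrite -leNgt; [rewrite -eh|rewrite -ev].
  apply: fin (lip _ _ (leqnn _) (leqnn _)) (lip _ _ (leq_pred _) (leqnn _)) y1 z1 _.
  by rewrite leNgt; apply/negP.
apply: fin (lip _ _ (leqnn _) (leqnn _)) (lip _ _ (leqnn _) (leq_pred _)) y2 z2 _.
by rewrite leNgt; apply/negP.
Qed.

End dual.

(** * Almost sure absence of ties *)

Lemma iidexp_tie {d} {T : measurableType d} {R : realType} (P : probability T R)
    (K : eqType) (X : K -> T -> R) (k : K) (D : {pred K}) (F : (K -> R) -> R) :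
  iidexp P X -> k \notin D ->
  measurable_fun setT (F : g_sigma_algebraType (@cylinders R K D) -> R) ->
  P.-negligible [set t | F (X^~ t) = X k t].
Proof.
move=> iX kD mF; have mX := iX.1.
have DF A : measurable A -> depends_on D (F @^-1` A).
  by move=> mA; have := mF measurableT A mA; rewrite setTI.
pose Z t := F (X^~ t).
have mZ : measurable_fun setT Z.
  by move=> _ A mA; rewrite setTI; exact: (measurable_depends_on P mX (DF _ mA)).
have i2 : indep2 P setT Z (X k).
  move=> A B mA mB; rewrite setIT probability_setT mule1.
  apply: (@iidexp_blocks _ _ _ P K X D (pred1 k) (F @^-1` A) [set x | B (x k)] iX) => //.
  - by move=> j jD; apply: contraNN kD => /eqP <-.
  - exact: DF.
  - have mk := @measurable_coord R K (pred1 k) k (eqxx k).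
    by have := mk measurableT B mB; rewrite setTI.
pose S := [set p : R * R | p.1 - p.2 = 0].
have mS : measurable S.
  rewrite (_ : S = (fun p : R * R => p.1 - p.2) @^-1` [set 0])//.
  by apply: measurable_preimage; [exact: measurable_funB|exact: measurable_set1].
have h := indep2_fubini (mX k) mZ i2 mS.
have e : [set t | F (X^~ t) = X k t] = [set t | S (Z t, X k t)].
  by apply/seteqP; split=> t /=; [rewrite /S /Z /= => ->; rewrite subrr|move/eqP; rewrite subr_eq0 => /eqP].
rewrite e; exists [set t | S (Z t, X k t)]; split => //.
  rewrite (_ : [set t | _] = (fun t => Z t - X k t) @^-1` [set 0])//.
  by apply: measurable_preimage; [exact: measurable_funB|exact: measurable_set1].
rewrite h integral0_eq// => t _.
rewrite (_ : [set s | _] = [set s | X k s = Z t]); first exact: exp_law_eq (iidexp_exp_law k iX).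
apply/seteqP; split=> s /=; first by move/eqP; rewrite subr_eq0 => /eqP.
  by rewrite /S/= => ->; rewrite subrr.
Qed.

Definition no_ties {R : realType} (w : site -> R) := forall v i j,
  site_lpp w v i j.+1 <> site_lpp w v i.+1 j.

Section ties.
Context {d} {T : measurableType d} {R : realType} (P : probability T R).
Variable W : site -> T -> R.
Hypothesis iW : iidexp P W.

(** Setting the weight at k to 0 exhibits a passage value as a function of the other coordinates. *)
Let erase (k : site) (x : site -> R) z := if z == k then 0 else x z.

Let site_lpp_erase k x v i j :
  (forall a b, (a <= i)%N -> (b <= j)%N -> (v.1 + a%:Z, v.2 + b%:Z) <> k) ->
  site_lpp (erase k x) v i j = site_lpp x v i j.
Proof.
move=> h; apply: (lpp_ext (m := i) (n := j)) => // [a ai|b bj|a b ai bj];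
  rewrite /quad /erase /= ?add0n; case: eqP => // e; case: (h _ _ _ _ e); lia.
Qed.

Let measurable_erase k z : measurable_fun setT
  (fun x : g_sigma_algebraType (@cylinders R site (predC1 k)) => erase k x z).
Proof.
rewrite /erase; case: eqVneq => [_|zk]; first exact: measurable_cst.
exact: (measurable_coord (D := predC1 k)).
Qed.

Let measurable_erase_lpp k v i j : measurable_fun setT
  (fun x : g_sigma_algebraType (@cylinders R site (predC1 k)) => site_lpp (erase k x) v i j).
Proof.
exact: (@measurable_site_lpp R _ (g_sigma_algebraType (@cylinders R site (predC1 k)))
  (fun z x => erase k x z) v i j (@measurable_erase k)).
Qed.

Lemma no_ties_ae : P.-negligible [set t | ~ no_ties (W^~ t)].
Proof.
suff h (v : site) i j : P.-negligible [set t | site_lpp (W^~ t) v i j.+1 = site_lpp (W^~ t) v i.+1 j].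
  apply: negligibleS (negligible_countable (F := fun p : site * nat * nat =>
    [set t | site_lpp (W^~ t) p.1.1 p.1.2 p.2.+1 = site_lpp (W^~ t) p.1.1 p.1.2.+1 p.2]) _).
    by move=> t /existsNP[v /existsNP[i /existsNP[j /contrapT e]]]; exists (v, i, j).
  by move=> p; exact: h.
(* The endpoint of the first value lies on no path to (i + 1, j), so a tie would express its weight
   through the other weights. *)
pose k : site := (v.1 + i%:Z, v.2 + j.+1%:Z).
have kD : k \notin predC1 k by rewrite inE /= negbK.
have e1 x : site_lpp (erase k x) v i.+1 j = site_lpp x v i.+1 j.
  by apply: site_lpp_erase => a b _ bj [_] /addrI; lia.
have e2 x : site_lpp (erase k x) v i j = site_lpp x v i j.
  by apply: site_lpp_erase => a b _ bj [_] /addrI; lia.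
case: i @k kD e1 e2 => [|i] k kD e1 e2.
  have := iidexp_tie iW kD (measurable_funB (@measurable_erase_lpp k v 1 j) (@measurable_erase_lpp k v 0 j)).
  apply: negligibleS => t /= h; rewrite e1 e2 -h {1}/site_lpp /ptp lpp0S /=.
  by rewrite /site_lpp /ptp addrAC subrr add0r /k /quad /=.
have e3 x : site_lpp (erase k x) v i j.+1 = site_lpp x v i j.+1.
  by apply: site_lpp_erase => a b ai _ [/addrI + _]; lia.
have := iidexp_tie iW kD (measurable_funB (@measurable_erase_lpp k v i.+2 j)
  (measurable_maxr (@measurable_erase_lpp k v i j.+1) (@measurable_erase_lpp k v i.+1 j))).
apply: negligibleS => t /= h; rewrite e1 e2 e3 -h {1}/site_lpp /ptp lppSS.
by rewrite addrK /quad /=.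
Qed.

Let bus_pair x (b : bool) t := 2^-1 * (if b then busv W x t else bush W x t).

(** The two increments arriving at the upper-right corner of a box are entries of its Burke family
    with different keys. Independence and continuity pass to the limit and exclude a tie. *)
Lemma busemann_pair_iidexp x : iidexp P (bus_pair x).
Proof.
have half0 : 0 < 2^-1 :> R by rewrite invr_gt0.
have half1 : 0 < 1 - 2^-1 :> R by lra.
have halfD : 2^-1 + (1 - 2^-1) = 1 :> R by lra.
have keyK : pcancel (fun p : nat * nat => p) (fun p => Some p) by [].
have unkeyK : forall k p : nat * nat, Some k = Some p -> p = k by move=> k p [].
pose Y M (b : bool) : T -> R := burke_family id (fun p => Some p)
  (fun p t => quad (corner M) (W^~ t) p) 2^-1 (1 - 2^-1) (boxi M x.1) (boxi M x.2) 0
  (if b then (0, (boxi M x.2).-1.+1) else ((boxi M x.1).-1.+1, 0))%N.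
apply: (iidexp_limit (Y := Y)) => [M|b|b].
- apply: (iidexp_reindex (f := fun b : bool => if b then (0, (boxi M x.2).-1.+1) else ((boxi M x.1).-1.+1, 0))%N).
    by move=> [] [] // [].
  exact: (burke keyK unkeyK (iidexp_quad iW (corner M)) half0 half1 halfD).
- apply: (measurableT_comp (@mulrl_measurable R setT 2^-1)).
  by case: b; [exact: measurable_busv iW x|exact: measurable_bush iW x].
- apply: (@cvg_in_prob_eq _ _ _ _ _ (fun M t => 2^-1 * (if b then boxv W M x t else boxh W M x t))).
    exists (`|x.1| + `|x.2| + 2)%N => M hM t.
    have p1 : (0 < boxi M x.1)%N by rewrite /boxi; move: hM; clear; lia.
    have p2 : (0 < boxi M x.2)%N by rewrite /boxi; move: hM; clear; lia.
    rewrite /Y /burke_family; case: b => /=.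
      rewrite ifT ?prednK// /vinc prednK//; congr (_ * _); lra.
    by rewrite ifT ?prednK// /hinc prednK// addn0.
  move=> e e0.
  have [M0 h0] := boxh_cvg iW x e0; have [M1 h1] := boxv_cvg iW x e0.
  exists (maxn M0 M1) => M; rewrite geq_max => /andP[/h0 s0 /h1 s1].
  have hh (y : R) : e < `|2^-1 * y| -> e < `|y|.
    by move=> /lt_le_trans; apply; rewrite normrM ler_piMl// ger0_norm ?invr_ge0// invf_le1// ler1n.
  case: b; [apply: small_sub s1|apply: small_sub s0] => t /=;
    by rewrite -mulrBr => /hh.
Qed.

Lemma busemann_ties : P.-negligible [set t | exists x, bush W x t = busv W x t].
Proof.
apply: negligible_countable => x.
have := @iidexp_tie _ _ _ P bool (bus_pair x) true (pred1 false) (fun y => y false) (busemann_pair_iidexp x) isT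
  (measurable_coord (D := pred1 false) (eqxx _)).
by apply: negligibleS => t /= h; rewrite /bus_pair h.
Qed.

End ties.

(** * Geodesics and potentials *)

Section potential.
Context {R : realType}.

Lemma sub_unit_vec1 (z : site) i : (z - unit_vec i).1 = z.1 - (~~ i : nat)%:Z.
Proof. by case: i => /=; lia. Qed.

Lemma sub_unit_vec2 (z : site) i : (z - unit_vec i).2 = z.2 - (i : nat)%:Z.
Proof. by case: i => /=; lia. Qed.

Lemma upstepP (u z : site) : upstep u z <-> exists i, u = z - unit_vec i.
Proof.
rewrite /upstep; split=> [/orP[]/eqP ->|[[] ->]].
- by exists false; rewrite addrK.
- by exists true; rewrite addrK.
- by rewrite subrK eqxx orbT.
- by rewrite subrK eqxx.
Qed.

Lemma unit_vec_inj : injective unit_vec.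
Proof. by move=> [] []. Qed.

Definition site_le (v z : site) : bool := (v.1 <= z.1) && (v.2 <= z.2).

Definition level (z : site) : int := z.1 + z.2.

Definition back_step (tau : site -> bool) (z : site) : site := z - unit_vec (tau z).

Lemma level_sub_unit_vec z i : level (z - unit_vec i) = level z - 1.
Proof. by rewrite /level sub_unit_vec1 sub_unit_vec2; case: i => /=; lia. Qed.

Lemma level_iter tau n z : level (iter n (back_step tau) z) = level z - n%:Z.
Proof.
elim: n => [|n ih]; first by rewrite subr0.
by rewrite iterS level_sub_unit_vec ih; lia.
Qed.

(** A certificate of optimality: a path in the quadrant above v weighs at most the increment of h,
    with equality exactly when it follows tau backwards. Passage values and Busemann functions both
    provide one, so their geodesics are treated at once. *)
Definition potential (w : site -> R) (v : site) (h : site -> R) (tau : site -> bool) :=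
  forall z i, site_le v (z - unit_vec i) ->
  w z <= h z - h (z - unit_vec i) /\ (w z = h z - h (z - unit_vec i) <-> i = tau z).

Variables (w : site -> R) (v : site) (h : site -> R) (tau : site -> bool).
Hypothesis pot : potential w v h tau.
Let T := back_step tau.

Lemma site_le_unit_vec z i : site_le v (z - unit_vec i) -> site_le v z.
Proof. by rewrite /site_le sub_unit_vec1 sub_unit_vec2; case: i => /=; lia. Qed.

Lemma potential_path y q : site_le v y -> path upstep y q ->
  [/\ site_le v (last y q), \sum_(z <- q) w z <= h (last y q) - h y &
   \sum_(z <- q) w z = h (last y q) - h y ->
     rev (y :: q) = traject T (last y q) (size q).+1].
Proof.
move=> vy; elim/last_ind: q => [|q z ih]; first by rewrite /= big_nil subrr.
rewrite rcons_path last_rcons => /andP[/ih[vl le1 eq1] /upstepP[i ei]].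
have vz : site_le v (z - unit_vec i) by rewrite -ei.
have [le2 eq2] := pot vz; rewrite -ei in le2 eq2.
rewrite big_rcons /=; split; first exact: site_le_unit_vec vz.
  by move: le1 le2; set a := \sum_(_ <- _) _; lra.
rewrite -(subrKA (h (last y q))) => e.
have e2 : w z = h z - h (last y q).
  by move: le1 le2 e; rewrite addrC; set a := \sum_(_ <- _) _; lra.
have e1 : \sum_(z <- q) w z = h (last y q) - h y.
  by move: e; rewrite e2; set a := \sum_(_ <- _) _; lra.
have ez : last y q = T z by rewrite ei /T /back_step -(eq2.1 e2).
by rewrite -rcons_cons rev_rcons eq1// size_rcons ez [in RHS]trajectS.
Qed.

Lemma weight_traject n x : site_le v (iter n T x) ->
  \sum_(z <- traject T x n) w z = h x - h (iter n T x).
Proof.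
elim: n => [|n ih] vx; first by rewrite big_nil subrr.
have vn := site_le_unit_vec vx.
rewrite trajectSr big_rcons ih//=.
have [_ [_ e]] := pot vx; rewrite e// addrC.
by rewrite -/(back_step tau _) -/T; lra.
Qed.

Lemma up_path_traject n x :
  up_path (iter n T x) x (rev (traject T x n.+1)).
Proof.
have fp : fpath T x (traject T (T x) n) by exact: fpath_traject.
have e : x :: traject T (T x) n = traject T x n.+1 by [].
have l : last x (traject T (T x) n) = iter n T x by exact: last_traject.
rewrite -e lastI rev_rcons l /= eqxx /=; apply/andP; split.
  rewrite -l rev_path; apply: sub_path fp => a b /eqP <-.
  by apply/upstepP; exists (tau a).
case: n {e fp l} => [|n] /=; first by rewrite eqxx.
by rewrite rev_cons last_rcons.
Qed.

Lemma weight_rev_traject n x :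
  weight w (rev (traject T x n.+1)) = \sum_(z <- traject T x n) w z.
Proof. by rewrite trajectSr rev_rcons /weight /= (perm_big _ (permEl (perm_rev _))). Qed.

Lemma geodesic_traject n x : site_le v (iter n T x) ->
  geodesic w (iter n T x) x (rev (traject T x n.+1)).
Proof.
move=> vn.
have le q : up_path (iter n T x) x q ->
   weight w q <= h x - h (iter n T x) /\
   (weight w q = h x - h (iter n T x) -> q = rev (traject T x n.+1)).
  case: q => // y q /= /and3P[/eqP ey pq /eqP lq]; subst y.
  have [_ le1 eq1] := potential_path vn pq; rewrite lq in le1 eq1; split=> // e.
  have {}eq1 := eq1 e; rewrite -[LHS]revK eq1; congr (rev (traject _ _ _.+1)).
  have : level (last x (traject T (T x) (size q))) = level (iter n T x).
    by rewrite -[X in level X = _](last_cons x) -trajectS -eq1 rev_cons last_rcons.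
  by rewrite last_traject !level_iter; lia.
have up := up_path_traject n x.
have wt : weight w (rev (traject T x n.+1)) = h x - h (iter n T x).
  by rewrite weight_rev_traject weight_traject.
split; first by split=> // q /le[]; rewrite wt.
move=> q [uq /(_ _ up)]; rewrite wt => ge; have [le1 eq1] := le q uq.
by apply: eq1; apply/eqP; rewrite eq_le le1 ge.
Qed.

End potential.

Section lpp_potential.
Context {R : realType} (w : site -> R) (c : site) (u v : nat -> R) (tau : site -> bool).

Let H := lpp u v (fun i j => w (c.1 + i.+1%:Z, c.2 + j.+1%:Z)).

(** Boundary increments equal to the weights give passage values from c; Busemann increments on the
    boundary give the Busemann function. *)
Lemma lpp_potential :
  (forall i, w (c.1 + i.+1%:Z, c.2) <= u i /\
    (w (c.1 + i.+1%:Z, c.2) = u i <-> tau (c.1 + i.+1%:Z, c.2) = false)) ->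
  (forall j, w (c.1, c.2 + j.+1%:Z) <= v j /\
    (w (c.1, c.2 + j.+1%:Z) = v j <-> tau (c.1, c.2 + j.+1%:Z) = true)) ->
  (forall i j, H i j.+1 <> H i.+1 j) ->
  (forall i j, tau (c.1 + i.+1%:Z, c.2 + j.+1%:Z) = (H i j.+1 < H i.+1 j)) ->
  potential w c (fun z => H (absz (z.1 - c.1)) (absz (z.2 - c.2))) tau.
Proof.
move=> hu hv nH ht z i; rewrite /site_le sub_unit_vec1 sub_unit_vec2 => /andP[h1 h2].
have [I eI] : exists I : nat, z.1 = c.1 + I%:Z by exists (absz (z.1 - c.1)); case: (i) h1 => /=; lia.
have [J eJ] : exists J : nat, z.2 = c.2 + J%:Z by exists (absz (z.2 - c.2)); case: (i) h2 => /=; lia.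
have -> : absz (z.1 - c.1) = I by rewrite eI; lia.
have -> : absz (z.2 - c.2) = J by rewrite eJ; lia.
have ez : z = (c.1 + I%:Z, c.2 + J%:Z) by rewrite -eI -eJ; case: (z).
case: i h1 h2 => /= h1 h2.
- have -> : absz (z.1 - 0 - c.1)%R = I by rewrite eI; lia.
  case: J eJ ez h2 => [|J] eJ ez h2; first by move: h2; rewrite eJ; lia.
  have -> : absz (z.2 - 1 - c.2)%R = J by rewrite eJ; lia.
  case: I eI ez => [|I] eI ez.
    have [a b] := hv J; rewrite ez addr0 /H lpp0S [_ + v J]addrC addrK; split=> //.
    by rewrite b; split=> ->.
  rewrite ez ht /H lppSS -/H; have := nH I J; rewrite /H.
  move: (lpp u v _ I J.+1) (lpp u v _ I.+1 J) (w _) => a b x ab.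
  split; first by rewrite lerBrDr lerD2l le_max lexx orbT.
  split=> [e|lt]; last by rewrite max_r; [lra|apply/ltW/esym].
  by apply/esym; rewrite lt_neqAle (introF eqP ab) /=; move: e; case: (leP a b) => // _; lra.
- have -> : absz (z.2 - 0 - c.2)%R = J by rewrite eJ; lia.
  case: I eI ez h1 => [|I] eI ez h1; first by move: h1; rewrite eI; lia.
  have -> : absz (z.1 - 1 - c.1)%R = I by rewrite eI; lia.
  case: J eJ ez => [|J] eJ ez.
    have [a b] := hu I; rewrite ez addr0 /H lppS0 [_ + u I]addrC addrK; split=> //.
    by rewrite b; split=> ->.
  rewrite ez ht /H lppSS -/H; have := nH I J; rewrite /H.
  move: (lpp u v _ I J.+1) (lpp u v _ I.+1 J) (w _) => a b x ab.
  split; first by rewrite lerBrDr lerD2l le_max lexx.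
  split=> [e|lt]; last by rewrite max_l; [lra|rewrite leNgt -lt].
  by apply/esym/negbTE; rewrite -leNgt; move: e; case: (leP a b) => // h; lra.
Qed.

End lpp_potential.

Section finite_potential.
Context {R : realType} (w : site -> R) (v : site).

Let H z := site_lpp w v (absz (z.1 - v.1)) (absz (z.2 - v.2)).

(** The last step of the geodesic from v to z, [true] standing for a vertical one. On the two axes
    through v the step is forced. *)
Definition lpp_dir (z : site) : bool :=
  if z.1 == v.1 then true else if z.2 == v.2 then false
  else site_lpp w v (absz (z.1 - v.1)).-1 (absz (z.2 - v.2)) <
       site_lpp w v (absz (z.1 - v.1)) (absz (z.2 - v.2)).-1.

Lemma site_lpp_potential : no_ties w -> potential w v H lpp_dir.
Proof.
move=> nt; have e0 (a : int) (i : nat) : (a + i.+1%:Z == a) = false by lia.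
have e1 (a : int) (i : nat) : absz (a + i%:Z - a)%R = i by lia.
apply: (@lpp_potential _ w v (fun k => quad v w (k.+1, 0%N)) (fun k => quad v w (0%N, k.+1))) => [i|j|i j|i j].
- by rewrite /lpp_dir /quad /= !e0 eqxx addr0.
- by rewrite /lpp_dir /quad /= eqxx addr0.
- exact: nt.
- by rewrite /lpp_dir /= !e0 !e1.
Qed.

Lemma iter_lpp_dir x n : site_le v x -> level x = level v + n%:Z ->
  iter n (back_step lpp_dir) x = v.
Proof.
elim: n x => [|n ih] x; rewrite /site_le /level => /andP[h1 h2] e.
  by case: x v h1 h2 e => a b [c d] /= h1 h2 e; congr (_, _); lia.
rewrite iterSr; apply: ih; last by rewrite level_sub_unit_vec /level e; lia.
rewrite /site_le sub_unit_vec1 sub_unit_vec2 /lpp_dir.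
case: eqP => [e1|n1] /=; first by apply/andP; split; lia.
case: eqP => [e2|n2] /=; first by apply/andP; split; lia.
by case: (_ < _) => /=; apply/andP; split; lia.
Qed.

End finite_potential.

(** * Busemann functions as potentials *)

Section busemann_cocycle.
Context {R : realType} (w : site -> R) (b1 b2 : site -> R).
Hypothesis bus : busemann w b1 b2.

Let close x e : 0 < e -> exists N, forall A B, (N < A)%N -> (N < B)%N -> (B <= A.+1)%N -> (A <= B.+1)%N ->
  `|binch w x A B - b1 x| <= e /\ `|bincv w x A B - b2 x| <= e.
Proof.
move=> e0; have [m m0 [N h]] := bus x e0; exists (N + m)%N => A B NA NB BA AB; apply: h; rewrite /cone.
have hd k : (N + m < k)%N -> (0 < k %/ m)%N.
  by move=> hk; rewrite divn_gt0//; move: hk; clear; lia.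
have := hd _ NA; have := hd _ NB; move: (A %/ m)%N (B %/ m)%N => dA dB dB0 dA0.
by apply/and4P; split; move: NA NB BA AB dA0 dB0; clear; lia.
Qed.

Let eq_of_close (a b : R) : (forall e, 0 < e -> `|a - b| <= e) -> a = b.
Proof.
move=> h; apply/eqP; rewrite -subr_eq0 -normr_le0; apply/ler_addgt0Pr => e e0.
by rewrite add0r; exact: h.
Qed.

Let finite x e : 0 < e -> exists c n, let L := site_lpp w c in
  [/\ `|L n.+1 n.+1 - L n n.+1 - b1 x| <= e, `|L n.+1 n.+1 - L n.+1 n - b2 x| <= e,
      `|L n.+1 n - L n n - b1 (x.1, x.2 - 1)| <= e,
      `|L n n.+1 - L n n - b2 (x.1 - 1, x.2)| <= e &
      L n.+1 n.+1 = w x + Num.max (L n n.+1) (L n.+1 n)].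
Proof.
move=> e0.
have [N0 h0] := close x e0; have [N1 h1] := close (x.1, x.2 - 1) e0.
have [N2 h2] := close (x.1 - 1, x.2) e0.
pose n := (N0 + N1 + N2).+1; exists (back x n.+1 n.+1), n => L.
have [a1 a2] : `|binch w x n.+1 n.+1 - b1 x| <= e /\ `|bincv w x n.+1 n.+1 - b2 x| <= e.
  by apply: h0; rewrite /n; clear; lia.
have [a3 _] : `|binch w (x.1, x.2 - 1) n.+1 n - b1 (x.1, x.2 - 1)| <= e /\
   `|bincv w (x.1, x.2 - 1) n.+1 n - b2 (x.1, x.2 - 1)| <= e by apply: h1; rewrite /n; clear; lia.
have [_ a4] : `|binch w (x.1 - 1, x.2) n n.+1 - b1 (x.1 - 1, x.2)| <= e /\
   `|bincv w (x.1 - 1, x.2) n n.+1 - b2 (x.1 - 1, x.2)| <= e by apply: h2; rewrite /n; clear; lia.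
have ey : back (x.1, x.2 - 1) n.+1 n = back x n.+1 n.+1 by rewrite /back /=; congr (_, _); clear; lia.
have ez : back (x.1 - 1, x.2) n n.+1 = back x n.+1 n.+1 by rewrite /back /=; congr (_, _); clear; lia.
rewrite /binch ey in a3; rewrite /bincv ez in a4.
split=> //; rewrite /L /site_lpp /ptp lppSS /quad /=; congr (w _ + _).
by case: (x) => a b /=; congr (_, _); clear; lia.
Qed.

Lemma busemann_rel x : b1 x + b2 (x.1 - 1, x.2) = b2 x + b1 (x.1, x.2 - 1).
Proof.
apply: eq_of_close => e e0; have e40 : 0 < e / 4 by rewrite divr_gt0.
have [c [n []]] := finite x e40.
move: (site_lpp _ _ n.+1 n.+1) (site_lpp _ _ n n.+1) (site_lpp _ _ n.+1 n) (site_lpp _ _ n n) => p q r s.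
rewrite !ler_norml => /andP[h1 h2] /andP[h3 h4] /andP[h5 h6] /andP[h7 h8] _.
by apply/andP; split; lra.
Qed.

Lemma busemann_min x : Num.min (b1 x) (b2 x) = w x.
Proof.
apply: eq_of_close => e e0.
have [c [n []]] := finite x e0.
move: (site_lpp _ _ n.+1 n.+1) (site_lpp _ _ n n.+1) (site_lpp _ _ n.+1 n) (site_lpp _ _ n n) => p q r s.
move=> h1 h2 _ _ e1; have <- : Num.min (p - q) (p - r) = w x.
  by rewrite e1; case: (leP q r) => qr; case: (leP _ _); lra.
by rewrite distrC; exact: ler_dist_min.
Qed.

(** [busemann_rel] and [busemann_min] amount to the recursions [hincS] and [vincS]: Busemann
    increments form a last passage field with themselves as boundary. *)
Lemma busemann_lpp (c : site) i j :
  let u k := b1 (c.1 + k.+1%:Z, c.2) in let v k := b2 (c.1, c.2 + k.+1%:Z) in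
  let w' k l := w (c.1 + k.+1%:Z, c.2 + l.+1%:Z) in
  hinc u v w' i j = b1 (c.1 + i.+1%:Z, c.2 + j%:Z) /\
  vinc u v w' i j = b2 (c.1 + i%:Z, c.2 + j.+1%:Z).
Proof.
move=> u v w'.
have rel a b : b1 (c.1 + a.+1%:Z, c.2 + b.+1%:Z) =
    w' a b + Num.max 0 (b1 (c.1 + a.+1%:Z, c.2 + b%:Z) - b2 (c.1 + a%:Z, c.2 + b.+1%:Z)) /\
    b2 (c.1 + a.+1%:Z, c.2 + b.+1%:Z) =
    w' a b + Num.max 0 (b2 (c.1 + a%:Z, c.2 + b.+1%:Z) - b1 (c.1 + a.+1%:Z, c.2 + b%:Z)).
  have := busemann_rel (c.1 + a.+1%:Z, c.2 + b.+1%:Z).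
  have := busemann_min (c.1 + a.+1%:Z, c.2 + b.+1%:Z) => /=.
  have -> : c.1 + a.+1%:Z - 1 = c.1 + a%:Z by lia.
  have -> : c.2 + b.+1%:Z - 1 = c.2 + b%:Z by lia.
  rewrite /w'; move: (w _) (b1 (_ + _, _ + b%:Z)) (b2 (_ + a%:Z, _)) (b1 _) (b2 _) => x y z p q.
  by case: (leP p q) => pq <-; case: (leP 0) => ?; case: (leP 0) => ?; lra.
have hv b : (forall a, hinc u v w' a b = b1 (c.1 + a.+1%:Z, c.2 + b%:Z)) ->
   forall a, vinc u v w' a b = b2 (c.1 + a%:Z, c.2 + b.+1%:Z).
  move=> hb; elim=> [|a ih]; first by rewrite vinc0 addr0.
  by rewrite vincS ih hb (rel a b).2.
suff hh b : forall a, hinc u v w' a b = b1 (c.1 + a.+1%:Z, c.2 + b%:Z).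
  by split; [exact: hh|exact: hv].
elim: b => [|b ih] a; first by rewrite hinc0 addr0.
by rewrite hincS ih (hv _ ih) (rel a b).1.
Qed.

Hypothesis ties : forall x, b1 x <> b2 x.

Definition bus_dir (x : site) : bool := b2 x < b1 x.

(** The explicit values on the bottom row are the sums of increments that appear in the walks of the
    crossing argument. *)
Lemma busemann_potential c : exists2 h, potential w c h bus_dir &
  forall i : nat, h (c.1 + i%:Z, c.2) = \sum_(k < i) b1 (c.1 + k.+1%:Z, c.2).
Proof.
pose u k := b1 (c.1 + k.+1%:Z, c.2); pose v k := b2 (c.1, c.2 + k.+1%:Z).
have lt x : (w x = b1 x <-> bus_dir x = false) /\ (w x = b2 x <-> bus_dir x = true).
  rewrite -busemann_min /bus_dir; have := @ties x; case: (ltgtP (b2 x) (b1 x)) => [h|h|->//] _.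
    by split; split=> // e; move: h; rewrite e ltxx.
  by split; split=> // e; move: h; rewrite e ltxx.
have le x : w x <= b1 x /\ w x <= b2 x.
  by rewrite -busemann_min !ge_min !lexx orbT.
exists (fun z => lpp u v (fun i j => w (c.1 + i.+1%:Z, c.2 + j.+1%:Z))
                     (absz (z.1 - c.1)) (absz (z.2 - c.2))); last first.
  by move=> i /=; rewrite subrr absz0 /=; have -> : absz (c.1 + i%:Z - c.1)%R = i by lia.
apply: (@lpp_potential _ w c u v) => [i|j|i j|i j].
- by split; [exact: (le _).1|exact: (lt _).1].
- by split; [exact: (le _).2|exact: (lt _).2].
- set f := lpp _ _ _; have [_ h1] := busemann_lpp c i.+1 j; have [h2 _] := busemann_lpp c i j.+1.
  move=> e; apply: (ties (x := (c.1 + i.+1%:Z, c.2 + j.+1%:Z))).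
  by rewrite -h1 -h2 /hinc /vinc -[lpp _ _ _]/f e.
- set f := lpp _ _ _; have [_ h1] := busemann_lpp c i.+1 j; have [h2 _] := busemann_lpp c i j.+1.
  rewrite /bus_dir -h1 -h2 /hinc /vinc -[lpp _ _ _]/f ltrD2l ltrN2 //.
Qed.

Lemma bus_dirP z : exists2 m, (0 < m)%N & exists N, forall A B, cone m N A B ->
  lpp_dir w (back z A B) z = bus_dir z.
Proof.
have e0 : 0 < `|b1 z - b2 z| / 3 by rewrite divr_gt0// normr_gt0 subr_eq0; apply/eqP; exact: ties.
have [m m0 [N h]] := bus z e0; exists m => //; exists N => A B c.
have [h1 h2] := h _ _ c; move: c => /and4P[NA NB _ _].
rewrite /lpp_dir /back /=.
have -> : (z.1 == z.1 - A%:Z) = false by move: NA; clear; lia.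
have -> : (z.2 == z.2 - B%:Z) = false by move: NB; clear; lia.
have -> : absz (z.1 - (z.1 - A%:Z))%R = A by clear; lia.
have -> : absz (z.2 - (z.2 - B%:Z))%R = B by clear; lia.
rewrite /bus_dir; move: h1 h2; rewrite /binch /bincv /back.
move: (site_lpp _ _ A B) (site_lpp _ _ A.-1 B) (site_lpp _ _ A B.-1) (b1 z) (b2 z) (@ties z) => p q r s t st.
case: (ltgtP t s) => [ts|ts|e]; last by case: st.
  have -> : `|s - t| = s - t by rewrite ger0_norm// subr_ge0 ltW.
  rewrite !ler_norml => /andP[? ?] /andP[? ?]; apply/idP; lra.
have -> : `|s - t| = t - s by rewrite ltr0_norm ?subr_lt0// opprB.
rewrite !ler_norml => /andP[? ?] /andP[? ?].
by apply/negbTE; rewrite -leNgt; lra.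
Qed.

End busemann_cocycle.

(** A relative tolerance of 1 / (4 m) is tighter than the opening 1 / m of the cone, which leaves
    room for shifts by at most K once both coordinates are large. *)
Lemma cone_arith (m N K y1 y2 a b : nat) : (0 < m)%N ->
  (4 * m * y2 <= 4 * m * y1 + y1)%N -> (4 * m * y1 <= 4 * m * y2 + y2)%N ->
  (N + K + 2 * (m * K + K) < y1)%N -> (N + K + 2 * (m * K + K) < y2)%N ->
  (a <= K)%N -> (b <= K)%N -> cone m N (y1 - a) (y2 - b).
Proof.
move=> m0 h1 h2 n1 n2 aK bK.
have half c d : (4 * m * d <= 4 * m * c + c)%N -> (N + K + 2 * (m * K + K) < c)%N ->
   forall a b, (a <= K)%N -> (b <= K)%N -> (d - b <= c - a + (c - a) %/ m)%N.
  move=> h n a' b' a'K b'K; rewrite -leq_subLR leq_divRL//.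
  have e1 : ((d - b' - (c - a')) * m <= (d - c + a') * m)%N by rewrite leq_mul2r; lia.
  apply: leq_trans e1 _.
  have e2 : (4 * ((d - c) * m) <= c)%N by rewrite mulnBl mulnBr; lia.
  have e3 : (a' * m <= m * K)%N by rewrite mulnC leq_mul2l a'K orbT.
  by rewrite mulnDl; lia.
apply/and4P; split; [lia|lia|exact: half|exact: half].
Qed.

Lemma diag_ratio {R : realType} (r : R) (m y1 y2 : nat) : (0 < m)%N ->
  `|1 - r| <= (4 * m).+1%:R^-1 -> r = y2%:R / y1%:R ->
  (4 * m * y2 <= 4 * m * y1 + y1)%N /\ (4 * m * y1 <= 4 * m * y2 + y2)%N.
Proof.
move=> m0 h e; set c : R := (4 * m).+1%:R in h.
have c0 : 0 < c by rewrite ltr0n.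
have c4 : c = 4 * m%:R + 1 by rewrite /c -natr1 natrM.
have m1 : 1 <= m%:R :> R by rewrite ler1n.
have h' : c * `|1 - r| <= 1 by rewrite mulrC -ler_pdivlMr// mul1r.
have [/eqP y0|y0] := eqVneq y1 0%N.
  (* Division by zero gives the ratio 0, whose distance to 1 exceeds the tolerance. *)
  exfalso; move: h'; rewrite e (eqP y0) invr0 mulr0 subr0 normr1 mulr1 c4; lra.
have y10 : 0 < y1%:R :> R by rewrite ltr0n lt0n.
have e2 : y2%:R = r * y1%:R :> R by rewrite e divfK// gt_eqF.
have : c * `|(y1%:R : R) - y2%:R| <= y1%:R.
  have -> : (y1%:R : R) - y2%:R = (1 - r) * y1%:R by rewrite e2 mulrBl mul1r.
  by rewrite normrM (ger0_norm (ltW y10)) mulrA ler_piMl// ltW.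
rewrite -(ger0_norm (ltW c0)) -normrM ler_norml => /andP[g1 g2].
have y20 : 0 <= y2%:R :> R by exact: ler0n.
by split; rewrite -(ler_nat R) !natrD !natrM; nra.
Qed.

Lemma diagonal_cone {R : realType} (y : nat -> site) m N K : (0 < m)%N ->
  diagonal_seq R y -> \forall n \near \oo, forall a b, (a <= K)%N -> (b <= K)%N ->
    cone m N (absz (y n).1 - a) (absz (y n).2 - b).
Proof.
move=> m0 [ypos ysum yratio].
set Q := (N + K + 2 * (m * K + K))%N.
have c0 : 0 < (4 * m).+1%:R^-1 :> R by rewrite invr_gt0.
move/cvgrPdist_le : yratio => /(_ _ c0) hr.
move/cvgryPge : ysum => /(_ (4 * Q.+1)%:R) hs.
apply: filterS2 hr hs => n e1 e2.
have [p1 p2] := ypos n.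
have f1 : (y n).1 = (absz (y n).1)%:Z by move: p1; clear; lia.
have f2 : (y n).2 = (absz (y n).2)%:Z by move: p2; clear; lia.
move: e1 e2; rewrite f1 f2 !absz_nat; move: (absz (y n).1) (absz (y n).2) => y1 y2 e1 e2.
have [g1 g2] := diag_ratio m0 e1 erefl.
have {}e2 : (4 * Q.+1 <= y1 + y2)%N.
  have e3 : `|y1%:Z| + `|y2%:Z| = (y1 + y2)%N%:Z by clear; lia.
  by move: e2; rewrite e3 -pmulrn ler_nat.
have b1 : (y2 <= 3 * y1)%N by move: g1 m0; clear; nia.
have b2 : (y1 <= 3 * y2)%N by move: g2 m0; clear; nia.
by move=> a b; apply: cone_arith => //; rewrite -/Q; move: e2 b1 b2; clear; lia.
Qed.

Lemma diagonal_seq_nat (R : realType) : diagonal_seq R (fun n => (n%:Z, n%:Z)).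
Proof.
split=> //.
  apply/cvgryPge => A; near=> n.
  have : (A <= n%:R) by near: n; exact: nbhs_infty_ger.
  move/le_trans; apply; rewrite /= !ger0_norm// -PoszD -pmulrn natrD lerDl; exact: ler0n.
apply: cvg_near_cst; near=> n.
have n0 : (0 < n)%N by near: n; exact: nbhs_infty_gt.
by rewrite /= divff// -pmulrn pnatr_eq0 -lt0n.
Unshelve. all: by end_near.
Qed.

Lemma level_add_unit_vec z i : level (z + unit_vec i) = level z + 1.
Proof. by rewrite -[in RHS](addrK (unit_vec i) z) level_sub_unit_vec subrK. Qed.

Section geodesics.
Context {R : realType} (w : site -> R) (b1 b2 : site -> R).
Hypotheses (bus : busemann w b1 b2) (ties : forall x, b1 x <> b2 x) (nt : no_ties w).

Let T := back_step (bus_dir b1 b2).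

Let Tn (v : site) := back_step (lpp_dir w v).

Let iter_offset tau k (x : site) : exists a b, [/\ (a <= k)%N, (b <= k)%N &
  iter k (back_step tau) x = (x.1 - a%:Z, x.2 - b%:Z)].
Proof.
elim: k => [|k [a [b [ak bk e]]]].
  by exists 0%N, 0%N; split=> //=; rewrite !subr0; case: x.
rewrite iterS e /back_step; move: (tau _) => i; exists (a + ~~ i)%N, (b + i)%N.
split; [by case: i; lia|by case: i; lia|].
by apply: injective_projections; rewrite ?sub_unit_vec1 ?sub_unit_vec2 /=; lia.
Qed.

(** Each of the first K sites of the Busemann path eventually sees x - y n inside the cone where
    [bus_dirP] applies, so the finite geodesic takes the same step there. *)
Let finite_agree (y : nat -> site) x K : diagonal_seq R y ->
  \forall n \near \oo, forall k, (k <= K)%N -> iter k (Tn (x - y n)) x = iter k T x.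
Proof.
move=> dy; elim: K => [|K ih]; first by apply: nearW => n k; rewrite leqn0 => /eqP ->.
have [m m0 [N h]] := bus_dirP bus ties (iter K T x).
have [a [b [aK bK e]]] := iter_offset (bus_dir b1 b2) K x.
apply: filterS2 ih (diagonal_cone N K m0 dy) => n ihn /(_ _ _ aK bK) cn k.
rewrite leq_eqVlt => /predU1P[->|]; last exact: ihn.
rewrite !iterS ihn// -[RHS]/(iter K T x - unit_vec (bus_dir b1 b2 (iter K T x))) -(h _ _ cn).
rewrite -[LHS]/(iter K T x - unit_vec (lpp_dir w (x - y n) (iter K T x))) /T.
have [ypos _ _] := dy; have [p1 p2] := ypos n; move: cn => /and4P[q1 q2 _ _].
have -> : back (iter K (back_step (bus_dir b1 b2)) x) (absz (y n).1 - a) (absz (y n).2 - b) = x - y n.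
  rewrite e /back; case: (x) (y n) p1 p2 q1 q2 => u v [c d] /= p1 p2 q1 q2.
  by apply: injective_projections => /=; move: p1 p2 q1 q2; clear; lia.
by [].
Qed.

Definition down_path (x : site) (n : nat) : site := iter n T x.

Let paths_cvg_down (y : nat -> site) x : diagonal_seq R y ->
  paths_cvg (fun n => geodesic w (x - y n) x) (down_path x).
Proof.
move=> dy A.
have [K hK] : exists K : nat, forall z, z \in A -> level x - level z < K%:Z.
  elim: A => [|z A [K ih]]; first by exists 0%N.
  exists (K + absz (level x - level z)).+1 => z'.
  by rewrite inE => /predU1P[->|/ih]; clear; lia.
have := diagonal_cone K 0 (ltn0Sn 0) dy.
move: (finite_agree x K dy); apply: filterS2 => n agree /(_ 0%N 0%N isT isT).
rewrite !subn0 => /and4P[k1 k2 _ _]; have [ypos _ _] := dy; have [p1 p2] := ypos n.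
pose M := (absz (y n).1 + absz (y n).2)%N.
have vx : site_le (x - y n) x by rewrite /site_le /=; move: p1 p2; clear; lia.
have eM : iter M (Tn (x - y n)) x = x - y n.
  by apply: iter_lpp_dir => //; rewrite /level /M /=; move: p1 p2; clear; lia.
exists (rev (traject (Tn (x - y n)) x M.+1)).
  rewrite -[X in geodesic _ X _]eM.
  apply: (geodesic_traject (@site_lpp_potential _ w (x - y n) nt)).
  by rewrite -/(Tn _) eM /site_le !lexx.
move=> z /hK zK; rewrite mem_rev; split.
  move=> /trajectP[i iM ez]; exists i => //.
  by rewrite /down_path -agree//; move: zK; rewrite ez level_iter; clear; lia.
move=> [i _ ez]; have iK : (i < K)%N.
  by move: zK; rewrite -ez level_iter; clear; lia.
apply/trajectP; exists i; first by rewrite /M; move: k1 iK; clear; lia.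
by rewrite agree ?ez// ltnW.
Qed.

Lemma down_geodesic_down_path x : down_geodesic w x (down_path x).
Proof.
split=> // [n|k n kn|y]; last exact: paths_cvg_down.
  by apply/upstepP; exists (bus_dir b1 b2 (down_path x n)).
have [h pot _] := busemann_potential bus ties (down_path x n).
have e : down_path x n = iter (n - k) T (down_path x k).
  by rewrite /down_path -iterD subnK// ltnW.
have -> : segment (down_path x) k n = traject T (down_path x k) (n - k).+1.
  apply: (@eq_from_nth _ (down_path x k)); rewrite ?size_map ?size_iota ?size_traject// => i ik.
  by rewrite (nth_map 0%N) ?size_iota// nth_iota// nth_traject// /down_path addnC iterD.
by rewrite e; apply: (geodesic_traject pot); rewrite -/T -e /site_le !lexx.
Qed.

(** Two limits of the same finite geodesics have the same range, and the level of a point recovers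
    its index. *)
Lemma down_geodesic_unique x g : down_geodesic w x g -> g =1 down_path x.
Proof.
move=> [g0 gup _ gcvg].
have lev n : level (g n) = level x - n%:Z.
  elim: n => [|n ih]; first by rewrite g0 subr0.
  by have /upstepP[i ei] := gup n; rewrite ei level_sub_unit_vec ih; lia.
move=> n; have h1 := gcvg _ (diagonal_seq_nat R) [:: g n].
have h2 := paths_cvg_down x (diagonal_seq_nat R) [:: g n].
have [k [[s gs hs] [s' gs' hs']]] : exists k,
   (exists2 s, geodesic w (x - (k%:Z, k%:Z)) x s & forall z, z \in [:: g n] -> (z \in s <-> range g z)) /\
   (exists2 s, geodesic w (x - (k%:Z, k%:Z)) x s & forall z, z \in [:: g n] -> (z \in s <-> range (down_path x) z)).
  by have [k _ hk] := filterI h1 h2; exists k; exact: (hk k (leqnn k)).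
have es : s = s' by apply: gs'.2; exact: gs.1.
have [m _ em] : range (down_path x) (g n).
  by apply/(hs' _ (mem_head _ _)); rewrite -es; apply/(hs _ (mem_head _ _)); exists n.
rewrite -em; congr (down_path x _).
by have := lev n; rewrite -em level_iter; lia.
Qed.

Theorem down_geodesic_treeE :
  down_geodesic_tree w = [set e | bus_dir b1 b2 (e.1 + unit_vec e.2) = e.2].
Proof.
apply/seteqP; split=> [[z i] [x [g [dg [n /= jn]]]]|[z i] /= e].
  move: jn; rewrite !(down_geodesic_unique dg) /joins /down_path iterS -/(down_path x n) /=.
  move: (down_path x n) => u; rewrite /T /back_step; case=> [[eu ez]|[eT eu]].
    by exfalso; have := congr1 level ez; rewrite level_sub_unit_vec level_add_unit_vec eu; lia.
  rewrite -eu; apply: unit_vec_inj; apply/eqP; rewrite -(inj_eq oppr_inj).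
  by rewrite -(inj_eq (addrI u)) eT [X in X - unit_vec i]eu addrK.
exists (z + unit_vec i), (down_path (z + unit_vec i)); split; first exact: down_geodesic_down_path.
by exists 0%N; right; split=> //=; rewrite /T /back_step e addrK.
Qed.

End geodesics.

(** * Reflection and duality *)

Section reflection.
Context {R : realType}.
Implicit Types (w : site -> R) (x y z : site) (p q : seq site).

Definition opp_weights w x := w (- x).

Lemma opp_weightsK w : opp_weights (opp_weights w) = w.
Proof. by apply/funext => x; rewrite /opp_weights opprK. Qed.

Definition reflect_path p := rev (map -%R p).

Lemma reflect_pathK p : reflect_path (reflect_path p) = p.
Proof.
rewrite /reflect_path map_rev revK -map_comp -[RHS]map_id.
by apply: eq_map => x /=; rewrite opprK.
Qed.

Lemma upstep_opp x y : upstep (- y) (- x) = upstep x y.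
Proof.
have h i : (- x == - y + unit_vec i) = (y == x + unit_vec i).
  by rewrite -(inj_eq oppr_inj) opprD !opprK eq_sym subr_eq.
by rewrite /upstep !h.
Qed.

Lemma up_path_reflect x y p : up_path x y p -> up_path (- y) (- x) (reflect_path p).
Proof.
case: p => // x0 q /= /and3P[/eqP -> pq /eqP lq]; rewrite /reflect_path /=.
have l : last (- x) (map -%R q) = - y by rewrite last_map lq.
rewrite lastI rev_rcons l /= eqxx /=; apply/andP; split.
  rewrite -l rev_path path_map; apply: sub_path pq => a b /=.
  by rewrite upstep_opp.
case: q lq {pq l} => [|z q] /= lq; first by rewrite lq.
by rewrite rev_cons last_rcons.
Qed.

Lemma up_path_weight w x y p : up_path x y p -> weight w p = \sum_(z <- p) w z - w x.
Proof.
by case: p => // x0 q /= /and3P[/eqP -> _ _]; rewrite /weight /= big_cons addrC addKr.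
Qed.

(** Reflection exchanges the endpoint whose weight is omitted. The correction depends on the
    endpoints only, so maximisers correspond. *)
Lemma weight_reflect w x y p : up_path x y p ->
  weight (opp_weights w) (reflect_path p) = weight w p + (w x - w y).
Proof.
move=> up; rewrite (up_path_weight _ up) (up_path_weight _ (up_path_reflect up)).
rewrite /opp_weights opprK /reflect_path (perm_big _ (permEl (perm_rev _))) /= big_map.
by under eq_bigr do rewrite opprK; ring.
Qed.

Lemma maximizing_reflect w x y p :
  maximizing w x y p -> maximizing (opp_weights w) (- y) (- x) (reflect_path p).
Proof.
move=> [up mx]; split=> [|q uq]; first exact: up_path_reflect.
have uq' : up_path x y (reflect_path q) by rewrite -[x]opprK -[y]opprK; exact: up_path_reflect.
have := mx _ uq'; rewrite -[in X in _ -> X](reflect_pathK q) (weight_reflect _ uq') (weight_reflect _ up).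
by rewrite lerD2r.
Qed.

Lemma geodesic_reflect w x y p :
  geodesic w x y p -> geodesic (opp_weights w) (- y) (- x) (reflect_path p).
Proof.
move=> [mx un]; split=> [|q mq]; first exact: maximizing_reflect.
have := maximizing_reflect mq; rewrite opp_weightsK !opprK => /un <-.
by rewrite reflect_pathK.
Qed.

Lemma segment_reflect (g : nat -> site) k n :
  map -%R (segment g k n) = segment (fun i => - g i) k n.
Proof. by rewrite /segment -map_comp. Qed.

Lemma mem_reflect_path z p : (- z \in reflect_path p) = (z \in p).
Proof. by rewrite mem_rev (mem_map oppr_inj). Qed.

Lemma up_geodesic_reflect w x g :
  up_geodesic w x g -> down_geodesic (opp_weights w) (- x) (fun n => - g n).
Proof.
move=> [g0 gs gg gc]; split=> [|n|k n kn|y dy A]; first by rewrite g0.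
- by rewrite upstep_opp.
- by rewrite -segment_reflect; exact: geodesic_reflect (gg _ _ kn).
- apply: filterS (gc y dy (map -%R A)) => n [s gs' hs].
  exists (reflect_path s); first by rewrite -opprD; exact: geodesic_reflect.
  move=> z zA; rewrite -{1}[z]opprK mem_reflect_path.
  have := hs (- z); rewrite (mem_map oppr_inj) => /(_ zA) ->.
  by split=> -[k _ e]; exists k => //; [rewrite /= e opprK|rewrite -e opprK].
Qed.

Lemma down_geodesic_reflect w x g :
  down_geodesic w x g -> up_geodesic (opp_weights w) (- x) (fun n => - g n).
Proof.
move=> [g0 gs gg gc]; split=> [|n|k n kn|y dy A]; first by rewrite g0.
- by rewrite upstep_opp.
- rewrite -segment_reflect -[map _ _]revK -map_rev.
  exact: geodesic_reflect (gg _ _ kn).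
- apply: filterS (gc y dy (map -%R A)) => n [s gs' hs].
  exists (reflect_path s).
    have -> : - x + y n = - (x - y n) by rewrite opprB addrC.
    exact: geodesic_reflect.
  move=> z zA; rewrite -{1}[z]opprK mem_reflect_path.
  have := hs (- z); rewrite (mem_map oppr_inj) => /(_ zA) ->.
  by split=> -[k _ e]; exists k => //; [rewrite /= e opprK|rewrite -e opprK].
Qed.

Lemma joins_reflect (e : edge) u v :
  joins e u v -> joins (- (e.1 + unit_vec e.2), e.2) (- u) (- v).
Proof.
rewrite /joins /= opprD subrK; case=> -[-> ->]; [right|left]; split=> //; by rewrite opprD.
Qed.

Lemma geodesic_treeE w b1 b2 : busemann (opp_weights w) b1 b2 -> (forall x, b1 x <> b2 x) ->
  no_ties (opp_weights w) -> geodesic_tree w = [set e | bus_dir b1 b2 (- e.1) = e.2].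
Proof.
move=> bus ties nt; have tE := down_geodesic_treeE bus ties nt.
apply/seteqP; split=> e /=.
  move=> [x [g [/up_geodesic_reflect dg [n jn]]]].
  have : down_geodesic_tree (opp_weights w) (- (e.1 + unit_vec e.2), e.2).
    by exists (- x), (fun n => - g n); split=> //; exists n; exact: joins_reflect.
  by rewrite tE /= opprD subrK.
move=> he; have : down_geodesic_tree (opp_weights w) (- (e.1 + unit_vec e.2), e.2).
  by rewrite tE /= opprD subrK.
move=> [x [g [/down_geodesic_reflect + [n jn]]]]; rewrite opp_weightsK => ug.
exists (- x), (fun n => - g n); split=> //; exists n.
by have := joins_reflect jn; rewrite /= opprD opprK addrK -surjective_pairing.
Qed.

Lemma dual_systemE (E : set edge) : dual_system E = [set f | ~ E (crossed f)].
Proof.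
apply/seteqP; split=> f /= h; first by apply: h; exact/crossedP.
by move=> e /crossedP ->.
Qed.

(** Each site has exactly one outgoing edge in the tree. The edge crossed by f leaves the site f.1 +
    unit_vec f.2 in the direction other than f.2, so it is absent precisely when that site steps in
    direction f.2. *)
Lemma dual_geodesic_treeE w b1 b2 : busemann (opp_weights w) b1 b2 -> (forall x, b1 x <> b2 x) ->
  no_ties (opp_weights w) ->
  dual_system (geodesic_tree w) = [set f | bus_dir b1 b2 (- (f.1 + unit_vec f.2)) = f.2].
Proof.
move=> bus ties nt; rewrite dual_systemE (geodesic_treeE bus ties nt) /crossed.
apply/seteqP; split=> -[z i] /=; first by case: bus_dir; case: i.
by move=> -> /esym; case: i.
Qed.

End reflection.

(** * Trees as measurable functionals of the weights *)

Section edge_law.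
Context {R : realType}.

(* A measurable functional of the weights that a.s. gives the direction of the
   last step of the geodesics arriving at x. *)
Definition lim_dir (w : site -> R) (x : site) : bool :=
  `[< exists N, forall n, (N < n)%N -> bincv w x n n < binch w x n n >].

Definition lim_tree (w : site -> R) : set edge :=
  [set e | lim_dir w (e.1 + unit_vec e.2) = e.2].

Lemma lim_dirE w b1 b2 : busemann w b1 b2 -> (forall x, b1 x <> b2 x) ->
  lim_dir w = bus_dir b1 b2.
Proof.
move=> bus ties; apply/funext => x.
have [m m0 [N h]] := bus_dirP bus ties x.
have e n : (N < n)%N -> (bincv w x n n < binch w x n n) = bus_dir b1 b2 x.
  move=> Nn; have c : cone m N n n by rewrite /cone Nn leq_addr.
  rewrite -(h _ _ c) /lpp_dir /back /= /bincv /binch.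
  have -> : (x.1 == x.1 - n%:Z) = false by move: Nn; clear; lia.
  have -> : (x.2 == x.2 - n%:Z) = false by move: Nn; clear; lia.
  have -> : absz (x.1 - (x.1 - n%:Z))%R = n by clear; lia.
  have -> : absz (x.2 - (x.2 - n%:Z))%R = n by clear; lia.
  by rewrite ltrD2l ltrN2.
rewrite /lim_dir; case hb : bus_dir.
  by apply/asboolP; exists N => n Nn; rewrite e.
apply/negbTE/asboolPn => -[N' h']; have := h' (maxn N N').+1.
by rewrite e ?hb ?ltnS ?leq_maxl ?leq_maxr// => /(_ isT).
Qed.

Lemma lim_treeE w b1 b2 : busemann w b1 b2 -> (forall x, b1 x <> b2 x) ->
  lim_tree w = [set e | bus_dir b1 b2 (e.1 + unit_vec e.2) = e.2].
Proof. by move=> bus ties; rewrite /lim_tree (lim_dirE bus ties). Qed.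

Lemma measurable_edge_sets d (U : measurableType d) (F : U -> edge_sets) :
  (forall e, measurable [set t | F t e]) -> measurable_fun setT F.
Proof.
move=> mF _ S mS; rewrite setTI.
suff : <<s edge_events >> `<=` [set S | measurable (F @^-1` S)] by apply.
apply: smallest_sub => [|_ [e _ <-]]; last exact: mF.
split=> /= [|A mA|A mA].
- by rewrite preimage_set0.
- by rewrite setTD preimage_setC; exact: measurableC.
- by rewrite preimage_bigcup; exact: bigcup_measurable.
Qed.

Let config := g_sigma_algebraType (@cylinders R site predT).

Lemma measurable_lim_tree : measurable_fun setT (lim_tree : config -> edge_sets).
Proof.
apply: measurable_edge_sets => -[z i].
have mW x : measurable_fun setT (fun w : config => w x) by exact: measurable_coord.
pose x := z + unit_vec i.
have ml : measurable [set w : config | lim_dir w x].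
  rewrite (_ : [set _ | _] = \bigcup_N \bigcap_(n in [set n | (N < n)%N])
     [set w : config | bincv w x n n - binch w x n n < 0]).
    apply: bigcup_measurable => N _; apply: bigcap_measurable => [|n _].
      by exists N.+1 => /=.
    apply: measurable_lt; apply: measurable_funB; apply: measurable_funB;
      exact: (@measurable_site_lpp R _ config (fun x w => w x)).
  apply/seteqP; split=> w /= => [/asboolP[N h]|[N _ h]].
    by exists N => // n /= Nn; rewrite subr_lt0; exact: h.
  by apply/asboolP; exists N => n Nn; rewrite -subr_lt0; exact: h.
case: i @x ml => x ml; first exact: ml.
rewrite (_ : [set _ | _] = ~` [set w : config | lim_dir w x]); first exact: measurableC.
by apply/seteqP; split=> w /=; rewrite /lim_tree /= -/x; [move=> ->|move/negP/negbTE].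
Qed.

Context {d} {T : measurableType d} (P : probability T R).

Lemma measurable_iid_lim_tree (W : site -> T -> R) : iidexp P W ->
  measurable_fun setT ((fun t => lim_tree (W^~ t)) : T -> edge_sets).
Proof.
move=> iW _ S mS; rewrite setTI.
apply: (measurable_depends_on P iW.1 (D := predT) (S := lim_tree @^-1` S)).
by have := measurable_lim_tree measurableT mS; rewrite setTI.
Qed.

Lemma lim_tree_same_law (W V : site -> T -> R) : iidexp P W -> iidexp P V ->
  forall S : set edge_sets, measurable S ->
  P [set t | S (lim_tree (W^~ t))] = P [set t | S (lim_tree (V^~ t))].
Proof.
move=> iW iV S mS; apply: (iidexp_same_law (S := lim_tree @^-1` S) iW iV).
by have := measurable_lim_tree measurableT mS; rewrite setTI.
Qed.

End edge_law.

(** * Absence of bi-infinite paths *)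

Section symmetric_walk.
Context {d} {T : measurableType d} {R : realType} (P : probability T R).
Variable X : bool * nat -> T -> R.
Hypothesis iX : iidexp P X.

Let K : eqType := (bool * nat)%type.
Let cfg (D : {pred K}) := g_sigma_algebraType (@cylinders R K D).
Let step (x : K -> R) l := x (true, l) - x (false, l).
Let walk (x : K -> R) j k := \sum_(i < k) step x (j + i)%N.
Let pr (S : set (K -> R)) : R := fine (P [set t | S (X^~ t)]).

Let prE D S : depends_on D S -> P [set t | S (X^~ t)] = (pr S)%:E.
Proof. by move=> dS; rewrite /pr fineK// fin_num_measure//; exact: (measurable_depends_on P iX.1 dS). Qed.

Let pr_ge0 S : 0 <= pr S. Proof. exact: fine_ge0. Qed.

Let pr_le D1 D2 S1 S2 : depends_on D1 S1 -> depends_on D2 S2 -> S1 `<=` S2 -> pr S1 <= pr S2.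
Proof.
move=> d1 d2 s12; rewrite -lee_fin -(prE d1) -(prE d2); apply: le_measure.
- by rewrite inE; exact: (measurable_depends_on P iX.1 d1).
- by rewrite inE; exact: (measurable_depends_on P iX.1 d2).
- by move=> t; exact: s12.
Qed.

Let pr_blocks D1 D2 S1 S2 : (forall k, k \in D1 -> k \notin D2) ->
  depends_on D1 S1 -> depends_on D2 S2 -> pr (S1 `&` S2) = pr S1 * pr S2.
Proof.
move=> D12 d1 d2; apply: EFin_inj; rewrite EFinM -(prE d1) -(prE d2) -(iidexp_blocks iX D12 d1 d2).
rewrite /pr fineK// fin_num_measure//; apply: measurableI.
  exact: (measurable_depends_on P iX.1 d1).
exact: (measurable_depends_on P iX.1 d2).
Qed.

Let pr_reindex (f : K -> K) S : injective f -> depends_on predT S ->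
  pr [set x | S (fun k => x (f k))] = pr S.
Proof.
move=> fI dS; rewrite /pr; congr fine.
exact: (iidexp_same_law (iidexp_reindex fI iX) iX dS).
Qed.

Let measurable_walk D j k : (forall b l, (j <= l < j + k)%N -> (b, l) \in D) ->
  measurable_fun setT (fun x : cfg D => walk x j k).
Proof.
move=> h; apply: measurable_sum => i; apply: measurable_funB; apply: measurable_coord; apply: h;
  by rewrite leq_addr ltn_add2l ltn_ord.
Qed.

Let below j n := [set x : K -> R | forall k, (k <= n)%N -> walk x j k <= 0].
Let below' n := [set x : K -> R | forall k, (0 < k <= n)%N -> walk x 0 k < 0].
(** Time j is a strict record of the walk over its whole past: every sum of steps ending at j is
    positive. *)
Let above' j := [set x : K -> R | forall k, (0 < k <= j)%N -> 0 < walk x (j - k)%N k].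

Let depends_below D j n : (forall b l, (j <= l)%N -> (b, l) \in D) -> depends_on D (below j n).
Proof.
move=> h; rewrite /depends_on; suff : measurable (below j n : set (cfg D)) by [].
rewrite (_ : below j n = \bigcap_(k in [set k | (k <= n)%N]) ~` [set x : cfg D | 0 < walk x j k]).
  apply: bigcap_measurable => [|k kn]; first by exists 0%N => /=.
  apply: measurableC; rewrite (_ : [set _ | _] = [set x : cfg D | - walk x j k < 0]).
    apply: measurable_lt; apply: measurableT_comp => //; apply: measurable_walk => b l /andP[+ _].
    exact: h.
  by apply/seteqP; split=> x /=; rewrite oppr_lt0.
by apply/seteqP; split=> x hx k kn; [apply/negP; rewrite -leNgt|rewrite leNgt; apply/negP]; exact: hx.
Qed.

Let depends_below' D n : (forall b l, (l < n)%N -> (b, l) \in D) -> depends_on D (below' n).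
Proof.
move=> h; rewrite /depends_on; suff : measurable (below' n : set (cfg D)) by [].
rewrite (_ : below' n = \bigcap_(k in [set k | (0 < k <= n)%N]) [set x : cfg D | walk x 0 k < 0])//.
apply: bigcap_measurableType => k /andP[k0 kn].
apply: measurable_lt; apply: measurable_walk => b l; rewrite add0n => lk; apply: h.
exact: leq_trans lk kn.
Qed.

Let depends_above' D j : (forall b l, (l < j)%N -> (b, l) \in D) -> depends_on D (above' j).
Proof.
move=> h; rewrite /depends_on; suff : measurable (above' j : set (cfg D)) by [].
rewrite (_ : above' j = \bigcap_(k in [set k | (0 < k <= j)%N]) [set x : cfg D | - walk x (j - k)%N k < 0]).
  apply: bigcap_measurableType => k /andP[k0 kn].
  apply: measurable_lt; apply: measurableT_comp => //; apply: measurable_walk => b l.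
  by rewrite subnK// => /andP[_]; exact: h.
by apply/seteqP; split=> x hx k kn; have := hx k kn; rewrite /= oppr_lt0.
Qed.

Let pr_below j n : pr (below j n) = pr (below 0 n).
Proof.
have fI : injective (fun k : K => (k.1, (j + k.2)%N)).
  by move=> [a b] [a' b'] /= [-> /addnI ->].
rewrite -[RHS](pr_reindex fI); last exact: depends_below.
congr pr; apply/seteqP; split=> x h k kn; exact: h.
Qed.

(** Reversing the first j times and exchanging the two families maps the law to itself and turns the
    sums ending at j into the negatives of the sums starting at 0. *)
Let pr_above' j : pr (above' j) = pr (below' j).
Proof.
pose f (k : K) : K := if (k.2 < j)%N then (~~ k.1, (j.-1 - k.2)%N) else k.
have fI : injective f.
  move=> [a b] [a' b']; rewrite /f /=; case: ltnP => h; case: ltnP => h' [e1 e2].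
  - by congr (_, _); [apply: negb_inj|move: e2 h h'; clear; lia].
  - by move: e2 h h'; clear; lia.
  - by move: e2 h h'; clear; lia.
  - by rewrite e1 e2.
rewrite -(pr_reindex fI); last exact: depends_above'.
have e (x : K -> R) k : (k <= j)%N -> walk (fun k => x (f k)) (j - k) k = - walk x 0 k.
  move=> kj; rewrite /walk (reindex_inj rev_ord_inj) -sumrN; apply: eq_bigr => i _ /=.
  have ij : (j - k + (k - i.+1) < j)%N by move: (ltn_ord i) kj; clear; lia.
  rewrite /step /f /= ij opprB.
  by have -> : (j.-1 - (j - k + (k - i.+1)))%N = (0 + i)%N by move: (ltn_ord i) kj; clear; lia.
by congr pr; apply/seteqP; split=> x h k kj; have := h k kj;
  rewrite e ?oppr_gt0//; case/andP: kj.
Qed.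

Let first := [set x : K -> R | x (true, 0%N) < 1 /\ 1 <= x (false, 0%N)].

Let depends_first D : (forall b, (b, 0%N) \in D) -> depends_on D first.
Proof.
move=> h; rewrite /depends_on; suff : measurable (first : set (cfg D)) by [].
apply: measurableI; first by apply: measurable_lt; exact: measurable_coord.
by apply: measurable_ge; exact: measurable_coord.
Qed.

Let pr_first : 0 < pr first.
Proof.
have lX b := iidexp_exp_law (b, 0%N) iX.
have i2 := iidexp_indep2 iX (isT : (true, 0%N) != (false, 0%N) :> K).
have := i2 `]-oo, 1[%classic `[1, +oo[%classic (measurable_itv _) (measurable_itv _).
rewrite setIT probability_setT mule1.
have -> : X (true, 0%N) @^-1` `]-oo, 1[%classic = ~` [set t | 1 <= X (true, 0%N) t].
  by apply/seteqP; split=> t /=; rewrite in_itv/= ltNge => /negP.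
have -> : X (false, 0%N) @^-1` `[1, +oo[%classic = [set t | 1 <= X (false, 0%N) t].
  by apply/seteqP; split=> t /=; rewrite in_itv/= andbT.
rewrite probability_setC; last exact: measurable_ge (lX true).1.
rewrite !exp_law_ge// -EFinB -EFinM => e.
rewrite -lte_fin -(prE (@depends_first predT _))//.
rewrite (_ : [set t | _] = ~` [set t | 1 <= X (true, 0%N) t] `&` [set t | 1 <= X (false, 0%N) t]).
  rewrite e lte_fin mulr_gt0 ?expR_gt0// subr_gt0 -expR0 ltr_expR; lra.
by apply/seteqP; split=> t [/= h1 h2]; split=> //=; [apply/negP; rewrite -ltNge|rewrite ltNge; apply/negP].
Qed.

(** A negative first step makes the weak inequalities after it strict, and it is independent of the
    later steps. *)
Let pr_below' n m : (n <= m.+1)%N -> pr first * pr (below 0 m) <= pr (below' n).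
Proof.
move=> nm; rewrite -(pr_below 1).
rewrite -(@pr_blocks [pred k : K | k.2 == 0%N] [pred k : K | 0 < k.2]%N); last 3 first.
- by move=> [b l] /=; rewrite !inE /= => /eqP ->.
- by apply: depends_first => b; rewrite inE.
- by apply: depends_below => b l; rewrite inE.
apply: (@pr_le predT predT).
- suff : measurable (first `&` below 1 m : set (cfg predT)) by [].
  by apply: measurableI; [exact: depends_first|exact: (depends_below (D := predT))].
- exact: depends_below'.
move=> x [[x1 x2] hx] [//|k] /andP[_ kn]; rewrite /walk big_ord_recl.
have s0 : step x (0 + @ord0 k)%N < 0 by rewrite /step /=; lra.
have := hx k; rewrite -ltnS (leq_trans kn nm) => /(_ isT); rewrite /walk => hk.
by rewrite -[X in _ < X]addr0 ltr_leD.
Qed.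

(* The walk has a first maximum over a window of length N + 1 at j with probability
   at least p0 * r ^ 2, where r is the probability of staying nonpositive for N
   steps and p0 that of a negative first step; hence (N + 1) * p0 * r ^ 2 <= 1. *)
Let argmax N j := above' j `&` below j N.

Let pr_argmax N j : (j <= N)%N -> pr first * pr (below 0 N) ^+ 2 <= pr (argmax N j).
Proof.
move=> jN; rewrite /argmax (@pr_blocks [pred k : K | k.2 < j]%N [pred k : K | j <= k.2]%N); last 3 first.
- by move=> [b l]; rewrite !inE /= -ltnNge.
- by apply: depends_above' => b l; rewrite inE.
- by apply: depends_below => b l; rewrite inE.
rewrite pr_below pr_above' expr2 mulrA ler_wpM2r//.
by apply: pr_below'; exact: leqW.
Qed.

Lemma symmetric_walk : P.-negligible [set t |
  forall k, \sum_(l < k) (X (true, val l) t - X (false, val l) t) <= 0].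
Proof.
have dE N : depends_on predT (below 0 N) by exact: depends_below.
apply: (@negligibleS _ _ _ _ (\bigcap_N [set t | below 0 N (X^~ t)])) => [t /= h N _ k _|].
  exact: h.
have mb N : measurable [set t | below 0 N (X^~ t)] by exact: (measurable_depends_on P iX.1 (dE N)).
have mI : measurable (\bigcap_N [set t | below 0 N (X^~ t)]) by apply: bigcap_measurableType.
apply/negligibleP => //; set A := \bigcap_N _ in mI *.
have fA : P A = (fine (P A))%:E by rewrite fineK// fin_num_measure.
have a0 : 0 <= fine (P A) by exact: fine_ge0.
transitivity (fine (P A))%:E; first exact: fA.
congr EFin; move: a0 fA; move: (fine (P A)) => a a0 fA.
have ar N : a <= pr (below 0 N).
  rewrite -lee_fin -(prE (dE N)) -fA; apply: le_measure; rewrite ?inE//.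
  by move=> t /(_ N I).
have bound N : N.+1%:R * (pr first * a ^+ 2) <= 1.
  apply: (@le_trans _ _ (\sum_(j < N.+1) pr (argmax N j))).
    rewrite mulr_natl -[X in _ *+ X]card_ord -sumr_const; apply: ler_sum => j _.
    apply: le_trans (pr_argmax (_ : j <= N)%N); last by rewrite -ltnS.
    by rewrite ler_wpM2l ?(ltW pr_first)// ler_sqr ?nnegrE.
  have mj j : measurable [set t | argmax N j (X^~ t)].
    apply: measurableI; first by apply: (measurable_depends_on P iX.1 (D := predT) (S := above' j)); exact: depends_above'.
    by apply: (measurable_depends_on P iX.1 (D := predT) (S := below j N)); exact: depends_below.
  rewrite -lee_fin -sumEFin; apply: (@le_trans _ _ (\sum_(j < N.+1) P [set t | argmax N j (X^~ t)])%E).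
    by apply: lee_sum => j _; rewrite /pr fineK// fin_num_measure.
  rewrite -(measure_bigsetU_ord P xpredT (F := fun j : 'I_N.+1 => [set t | argmax N j (X^~ t)])) => //.
    by apply: probability_le1; apply: bigsetU_measurable => j _; exact: mj.
  have dis (i j : 'I_N.+1) t : (i < j)%N -> argmax N i (X^~ t) -> argmax N j (X^~ t) -> False.
    move=> ij [_ hi] [hj _].
    have jiN : (j - i <= N)%N by rewrite leq_subLR (leq_trans _ (leq_addl _ _))// -ltnS.
    have ji : (0 < j - i <= j)%N by rewrite subn_gt0 ij leq_subr.
    by have := hj _ ji; rewrite subKn ?(ltnW ij)// ltNge (hi _ jiN).
  move=> i j _ _ [t [hi hj]].
  case: (ltngtP (val i) (val j)) => [h|h|h]; last exact: val_inj h.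
    by case: (dis i j t h hi hj).
  by case: (dis j i t h hj hi).
apply/eqP; rewrite eq_le a0 andbT leNgt; apply/negP => ap.
have c0 : 0 < pr first * a ^+ 2 by rewrite mulr_gt0// exprn_gt0.
have [N _ /(_ N (leqnn N)) /= hN] := near_infty_natSinv_lt (PosNum c0).
have := bound N; rewrite leNgt => /negP; apply.
by rewrite -ltr_pdivrMl// mulr1.
Qed.

End symmetric_walk.

(** * Joint law of the increments on two consecutive rows *)

Section two_rows.
Context {d} {T : measurableType d} {R : realType} (P : probability T R).
Variable W : site -> T -> R.
Hypothesis iW : iidexp P W.

Definition reflected (x : site) : T -> R := W (- x).

Lemma reflected_iidexp : iidexp P reflected.
Proof. exact: (iidexp_reindex (f := fun x : site => - x) oppr_inj iW). Qed.

Let iW' := reflected_iidexp.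

Let key2 M p : site := - box_key M p.
Let unkey2 M (x : site) := box_unkey M (- x).

Let key2K M : pcancel (key2 M) (unkey2 M).
Proof. by move=> p; rewrite /key2 /unkey2 opprK box_keyK. Qed.

Let unkey2K M x p : unkey2 M x = Some p -> key2 M p = x.
Proof. by move=> /box_unkeyK e; rewrite /key2 e opprK. Qed.

Let half0 : 0 < 2^-1 :> R. Proof. by rewrite invr_gt0. Qed.
Let half1 : 0 < 1 - 2^-1 :> R. Proof. lra. Qed.
Let halfD : 2^-1 + (1 - 2^-1) = 1 :> R. Proof. lra. Qed.

Variable r : int.

Let n1 M := boxi M r.
Let n2 M := boxi M (- r - 1).

(* Processing the box below row r + 1 and then the one above it, read from its
   upper-right corner, puts the increments along both rows into a single i.i.d.
   family. *)
Let Y1 M := burke_family (box_key M) (box_unkey M) W 2^-1 (1 - 2^-1) (M + M) (n1 M) 0.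
Let Y2 M := burke_family (key2 M) (unkey2 M) (Y1 M) 2^-1 (1 - 2^-1) (M + M) (n2 M) 0.

Let iY2 M : iidexp P (Y2 M).
Proof.
apply: (burke (@key2K M) (@unkey2K M) _ half0 half1 halfD).
exact: (burke (@box_keyK M) (@box_unkeyK M) iW half0 half1 halfD).
Qed.

Let Y1_above M a b t : (0 < a)%N -> (n1 M < b)%N ->
  Y1 M (box_key M (a, b)) t = W (box_key M (a, b)) t.
Proof.
case: a b => [//|a] [//|b] _ nb; rewrite /Y1 (burke_family_key (@box_keyK M)) /burke_state.
by rewrite ifF// andbF orbF; move: nb; rewrite ltnS leqNgt => /negPf ->; rewrite andbF.
Qed.

(** The second pass stops above row r, so the bottom row of the box keeps the increments along row r
    left there by the first pass. *)
Let Y2_low M x t : (`|x| + `|r| + 2 < M)%N ->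
  Y2 M (x, - M%:Z) t = 2^-1 * boxh W M (x, r) t.
Proof.
move=> hM.
have [i ei] : exists i : nat, x = - M%:Z + i.+1%:Z.
  by exists (absz (x + M%:Z)).-1; move: hM; clear; lia.
have iM : (i.+2 < M + M)%N by move: ei hM; clear; lia.
have [j ej] : exists j : nat, (M + M)%N = j.+1 by exists (M + M).-1; move: iM; clear; lia.
have -> : (x, - M%:Z) = key2 M ((j - i.+1).+1, j.+1)%N.
  by apply: injective_projections; rewrite /key2 /= ?ei; move: ej iM; clear; lia.
rewrite /Y2 (burke_family_key (@key2K M)) /burke_state andbF orbF.
rewrite ifF; last by rewrite /n2 /boxi; move: ej hM; clear; lia.
have -> : bulk (key2 M) (Y1 M) t (j - i.+1) j = Y1 M (box_key M (i.+1, 0%N)) t.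
  congr (Y1 M _ t); apply: injective_projections; rewrite /key2 /=; move: ej iM; clear; lia.
rewrite /Y1 (burke_family_key (@box_keyK M)) /burke_state ifT; last by move: iM; clear; lia.
rewrite ltn0 addn0 /boxh /=.
have -> : boxi M x = i.+1 by rewrite /boxi ei; clear; lia.
by [].
Qed.

(** The first pass leaves the weights above row r untouched, so the second pass computes the box
    field of the reflected weights and stores its increments in the top row. *)
Let Y2_high M x t : (`|x| + `|r| + 2 < M)%N ->
  Y2 M (x, M%:Z) t = 2^-1 * boxh reflected M (- x, - r - 1) t.
Proof.
move=> hM.
have [i ei] : exists i : nat, x = M%:Z - i.+1%:Z.
  by exists (absz (M%:Z - x)).-1; move: hM; clear; lia.
have iM : (i.+2 < M + M)%N by move: ei hM; clear; lia.
have -> : (x, M%:Z) = key2 M (i.+1, 0)%N.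
  by apply: injective_projections; rewrite /key2 /= ?ei; clear; lia.
rewrite /Y2 (burke_family_key (@key2K M)) /burke_state.
rewrite ifT; last by move: iM; clear; lia.
rewrite ltn0 addn0 /boxh /=; congr (_ * _).
have -> : boxi M (- x) = i.+1 by rewrite /boxi ei; clear; lia.
rewrite -/(n2 M) /hinc.
have e1 : (n1 M)%:Z = r + M%:Z by rewrite /n1 /boxi; move: hM; clear; lia.
have e2 : (n2 M)%:Z = - r - 1 + M%:Z by rewrite /n2 /boxi; move: hM; clear; lia.
have above a b : (a < M + M)%N -> (b <= n2 M)%N -> Y1 M (key2 M (a, b)) t = reflected (box_key M (a, b)) t.
  move=> aM bn.
  have -> : key2 M (a, b) = box_key M (M + M - a, M + M - b)%N.
    by apply: injective_projections; rewrite /key2 /=; move: aM bn hM e2; clear; lia.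
  rewrite Y1_above; [|by move: aM; clear; lia|by move: bn e1 e2 hM; clear; lia].
  congr (W _ t); apply: injective_projections => /=; move: aM bn hM e2; clear; lia.
have ext i' : (i' <= i.+1)%N ->
  lpp (bdry1 (key2 M) (Y1 M) 2^-1 t) (bdry2 (key2 M) (Y1 M) (1 - 2^-1) t) (bulk (key2 M) (Y1 M) t) i' (n2 M) =
  box_field reflected M t i' (n2 M).
  move=> ii; apply: (lpp_ext (m := i.+1) (n := n2 M)) => // [k ki|l ln|k l ki ln].
  - by rewrite /bdry1 above//; move: ki iM; clear; lia.
  - by rewrite /bdry2 above//; move: iM; clear; lia.
  - by rewrite /bulk above//; move: ki iM; clear; lia.
by rewrite !ext.
Qed.

Theorem rows_iidexp : iidexp P (fun (k : bool * int) t =>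
  2^-1 * (if k.1 then bush W (k.2, r) t else bush reflected (- k.2, - r - 1) t)).
Proof.
(* [M.+1] keeps the bottom row and the top row distinct. *)
pose f M (k : bool * int) : site := if k.1 then (k.2, - M.+1%:Z) else (k.2, M.+1%:Z).
have fI M : injective (f M).
  by move=> [[] x] [[] y] /= [-> //] /eqP; rewrite /f => /eqP; lia.
apply: (iidexp_limit (Y := fun M k => Y2 M.+1 (f M k))) => [M|k|k].
- exact: (iidexp_reindex (f := f M)).
- apply: (measurableT_comp (@mulrl_measurable R setT 2^-1)).
  by case: (k.1); [exact: measurable_bush iW _|exact: measurable_bush iW' _].
- move=> e e0.
  have [M1 h1] := boxh_cvg iW (k.2, r) e0; have [M2 h2] := boxh_cvg iW' (- k.2, - r - 1) e0.
  exists (M1 + M2 + `|k.2| + `|r| + 2)%N => M hM.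
  have hh (y : R) : e < `|2^-1 * y| -> e < `|y|.
    by move=> /lt_le_trans; apply; rewrite normrM ler_piMl// ger0_norm ?invr_ge0// invf_le1// ler1n.
  case: k hM h1 h2 => [[] x] /= hM h1 h2.
    apply: small_sub (h1 M.+1 _); last by move: hM; clear; lia.
    move=> t /=; rewrite /f /= Y2_low; last by move: hM; clear; lia.
    by rewrite -mulrBr => /hh.
  apply: small_sub (h2 M.+1 _); last by move: hM; clear; lia.
  move=> t /=; rewrite /f /= Y2_high; last by move: hM; clear; lia.
  by rewrite -mulrBr => /hh.
Qed.

End two_rows.

Lemma telescope_ord {V : zmodType} (f : nat -> V) n : \sum_(l < n) (f l.+1 - f l) = f n - f 0%N.
Proof.
elim: n => [|n ih]; first by rewrite big_ord0 subrr.
by rewrite big_ord_recr /= ih addrC subrKA.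
Qed.

(** * Crossing a backward chain *)

Section ptp_increments.
Context {R : realType} (x : nat * nat -> R).

Let hinc_shift (u v : nat -> R) z a b i j : hinc u v z (a + i) (b + j) =
  hinc (fun k => hinc u v z (a + k) b) (fun k => vinc u v z a (b + k))
       (fun k l => z (a + k)%N (b + l)%N) i j.
Proof. by rewrite {1}/hinc -addnS !lpp_shift [in RHS]/hinc; ring. Qed.

Let u k := x ((0 + k).+1, 0%N).
Let v k := x (0%N, (0 + k).+1).
Let z k l := x ((0 + k).+1, (0 + l).+1).

(** Restarted at (a, 0), the field seen from the origin has the weights as bottom boundary and a
    left boundary at least as large as the weights, so [inc_monotone] makes its horizontal
    increments smaller. *)
Lemma ptp_inc_left a i j :
  ptp x 0 0 (a + i).+1 j - ptp x 0 0 (a + i) j <= ptp x a 0 i.+1 j - ptp x a 0 i j.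
Proof.
have E := hinc_shift u v z a 0 i j; rewrite -[leLHS]/(hinc u v z (a + i) (0 + j)) E.
have hu k : (k < i.+1)%N -> hinc u v z (a + k) 0 <= x ((a + k).+1, 0%N) by rewrite hinc0.
have hv k : (k < j)%N -> x (a, (0 + k).+1) <= vinc u v z a (0 + k).
  by case: (a) => [|b]; rewrite ?vinc0// => _; exact: vinc_ge.
by have [h _] := inc_monotone (fun k l => x ((a + k).+1, (0 + l).+1)) hu hv i j; exact: h.
Qed.

Lemma ptp_inc_down b i j :
  ptp x 0 b i.+1 j - ptp x 0 b i j <= ptp x 0 0 i.+1 (b + j) - ptp x 0 0 i (b + j).
Proof.
have E := hinc_shift u v z 0 b i j; rewrite -[leRHS]/(hinc u v z (0 + i) (b + j)) E.
have hu k : (k < i.+1)%N -> x ((0 + k).+1, b) <= hinc u v z (0 + k) b.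
  by case: (b) => [|c]; rewrite ?hinc0// => _; exact: hinc_ge.
have hv k : (k < j)%N -> vinc u v z 0 (b + k) <= x (0%N, (b + k).+1) by rewrite vinc0.
by have [h _] := inc_monotone (fun k l => x ((0 + k).+1, (b + l).+1)) hu hv i j; exact: h.
Qed.

End ptp_increments.

Section site_increments.
Context {R : realType} (w : site -> R).

Lemma site_lpp_ge_weight u z p : no_ties w -> up_path u z p ->
  weight w p <= site_lpp w u (absz (z.1 - u.1)) (absz (z.2 - u.2)).
Proof.
move=> nt; case: p => // y q /= /and3P[/eqP -> pq /eqP lq].
have uu : site_le u u by rewrite /site_le !lexx.
have [_ + _] := potential_path (@site_lpp_potential _ w u nt) uu pq.
by rewrite lq !subrr absz0 /site_lpp /ptp lpp00 subr0.
Qed.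

Lemma site_lpp_attained u z : no_ties w -> site_le u z -> exists2 p, up_path u z p &
  weight w p = site_lpp w u (absz (z.1 - u.1)) (absz (z.2 - u.2)).
Proof.
move=> nt uz; set n := (absz (z.1 - u.1) + absz (z.2 - u.2))%N.
have e : iter n (back_step (lpp_dir w u)) z = u.
  apply: iter_lpp_dir => //; rewrite /n /level; move: uz => /andP[]; clear; lia.
exists (rev (traject (back_step (lpp_dir w u)) z n.+1)).
  by rewrite -[X in up_path X _ _]e; exact: up_path_traject.
rewrite weight_rev_traject (weight_traject (@site_lpp_potential _ w u nt)).
  by rewrite e !subrr absz0 /site_lpp /ptp lpp00 subr0.
by rewrite e /site_le !lexx.
Qed.

Definition lpp_inc v i j := site_lpp w v i.+1 j - site_lpp w v i j.

Lemma lpp_inc_binch v i j :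
  lpp_inc v i j = binch w (v.1 + i.+1%:Z, v.2 + j%:Z) i.+1 j.
Proof.
by rewrite /lpp_inc /binch; have -> : back (v.1 + i.+1%:Z, v.2 + j%:Z) i.+1 j = v
  by case: (v) => a b; rewrite /back /=; congr (_, _); lia.
Qed.

Lemma lpp_inc_left (v : site) a i j : lpp_inc v (a + i) j <= lpp_inc (v.1 + a%:Z, v.2) i j.
Proof.
have := ptp_inc_left (quad v w) a i j; rewrite !ptp_quad !addr0 /lpp_inc.
by case: (v).
Qed.

Lemma lpp_inc_down (v : site) b i j : lpp_inc (v.1, v.2 + b%:Z) i j <= lpp_inc v i (b + j).
Proof.
have := ptp_inc_down (quad v w) b i j; rewrite !ptp_quad !addr0 /lpp_inc.
by case: (v).
Qed.

End site_increments.

Section crossing.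
Context {R : realType} (w : site -> R) (a1 a2 b1 b2 : site -> R).
Hypotheses (nt : no_ties w) (busb : busemann w b1 b2).
Hypotheses (busa : busemann (opp_weights w) a1 a2) (ties : forall x, a1 x <> a2 x).

Definition up_step (y : site) : site := y + unit_vec (bus_dir a1 a2 (- y)).

Lemma opp_up_step y : - up_step y = back_step (bus_dir a1 a2) (- y).
Proof. by rewrite /up_step /back_step opprD. Qed.

Let T := back_step (bus_dir a1 a2).

Variable c : nat -> site.
Hypothesis chain : forall k, up_step (c k.+1) = c k.

Lemma chain_iter k n : iter n T (- c (k + n)%N) = - c k.
Proof.
elim: n => [|n ih]; first by rewrite addn0.
by rewrite iterSr addnS /T -opp_up_step chain.
Qed.

Lemma chain_offset k n : exists p q, (p + q)%N = n /\
  c (k + n)%N = ((c k).1 - p%:Z, (c k).2 - q%:Z).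
Proof.
elim: n => [|n [p [q [pq e]]]].
  by exists 0%N, 0%N; split=> //; rewrite addn0 !subr0 -surjective_pairing.
have := chain (k + n); rewrite -addnS /up_step e.
move: (bus_dir _ _ _) => i /(canRL (addrK _)) ->.
exists (p + ~~ i)%N, (q + i)%N; split; first by move: pq; case: i; clear; lia.
by apply: injective_projections; rewrite ?sub_unit_vec1 ?sub_unit_vec2 /=; lia.
Qed.

Variables (k0 : nat) (x r : int).
Hypotheses (c1 : c k0.+1 = (x, r)) (c0 : c k0 = (x, r + 1)).

(* Leaving the chain at column y of row r cannot beat the chain. *)
Let below_chain (p q : nat) (y : int) (h : site -> R) (o : site) :
  potential (opp_weights w) o h (bus_dir a1 a2) ->
  site_le o (- x, - r - 1) -> site_le o (- y, - r - 1) ->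
  x - p%:Z <= y -> c (k0.+1 + (p + q)) = (x - p%:Z, r - q%:Z) ->
  site_lpp w (x - p%:Z, r - q%:Z) (absz (y - x + p%:Z)) q - site_lpp w (x - p%:Z, r - q%:Z) p q <=
  h (- x, - r - 1) - h (- y, - r - 1).
Proof.
move=> pot ox oy py cu; set u : site := (_, _) in cu *.
have ez : - c k0 = (- x, - r - 1) by rewrite c0; apply: injective_projections => /=; lia.
have chainE : h (- u) - h (- x, - r - 1) <= w u + site_lpp w u p q.
  have it : iter (p + q).+1 T (- u) = (- x, - r - 1) by rewrite -ez -cu addSnnS chain_iter.
  rewrite -it -(weight_traject pot); last by rewrite -/T it.
  have it' : iter (p + q) T (- u) = - (x, r) by rewrite -cu -c1 chain_iter.
  have up : up_path u (x, r) (reflect_path (rev (traject T (- u) (p + q).+1))).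
    by have := up_path_reflect (up_path_traject (bus_dir a1 a2) (p + q) (- u)); rewrite -/T it' !opprK.
  have := site_lpp_ge_weight nt up; rewrite (up_path_weight _ up) -/T.
  have -> : \sum_(z <- reflect_path (rev (traject T (- u) (p + q).+1))) w z =
            \sum_(z <- traject T (- u) (p + q).+1) opp_weights w z.
    by rewrite /reflect_path map_rev revK big_map.
  have -> : absz ((x, r).1 - u.1)%R = p by rewrite /u /=; clear; lia.
  have -> : absz ((x, r).2 - u.2)%R = q by rewrite /u /=; clear; lia.
  by rewrite lerBlDl.
have otherE : w u + site_lpp w u (absz (y - x + p%:Z)) q <= h (- u) - h (- y, - r - 1).
  have uy : site_le u (y, r) by rewrite /site_le /u /=; move: py; clear; lia.
  have [P upP] := site_lpp_attained nt uy.
  have -> : absz ((y, r).1 - u.1)%R = absz (y - x + p%:Z) by rewrite /u /=; move: py; clear; lia.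
  have -> : absz ((y, r).2 - u.2)%R = q by rewrite /u /=; clear; lia.
  rewrite (up_path_weight _ upP) => <-; rewrite subrKC.
  have := up_path_reflect upP; case eP : (reflect_path P) => [//|z0 Q] /= /and3P[/eqP ez0 pQ /eqP lQ].
  have st : upstep (- y, - r - 1) z0.
    rewrite ez0; apply/upstepP; exists true.
    by apply: injective_projections; rewrite ?sub_unit_vec1 ?sub_unit_vec2 /=; clear; lia.
  have pz : path upstep (- y, - r - 1) (z0 :: Q) by rewrite /= st pQ.
  have [_ + _] := potential_path pot oy pz.
  have -> : \sum_(z <- z0 :: Q) opp_weights w z = \sum_(z <- P) w z.
    rewrite -eP /reflect_path (perm_big _ (permEl (perm_rev _))) big_map /=.
    by apply: eq_bigr => z _; rewrite /opp_weights opprK.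
  by rewrite /= lQ.
lra.
Qed.

Let right_bound (p q n : nat) : c (k0.+1 + (p + q)) = (x - p%:Z, r - q%:Z) ->
  site_lpp w (x - p%:Z, r - q%:Z) (p + n) q - site_lpp w (x - p%:Z, r - q%:Z) p q <=
  \sum_(l < n) a1 (- x - l%:Z, - r - 1).
Proof.
(* The potential is anchored at the leftmost of the two reflected sites, so that both lie on its
   bottom row, where its values are explicit. *)
move=> cu; have [h pot hs] := busemann_potential busa ties (- x - n%:Z, - r - 1).
have ox : site_le (- x - n%:Z, - r - 1) (- x, - r - 1) by rewrite /site_le /= lexx andbT; clear; lia.
have oy : site_le (- x - n%:Z, - r - 1) (- (x + n%:Z), - r - 1).
  by rewrite /site_le /= lexx andbT; clear; lia.
have py : x - p%:Z <= x + n%:Z by clear; lia.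
have := below_chain pot ox oy py cu.
have -> : absz (x + n%:Z - x + p%:Z)%R = (p + n)%N by clear; lia.
have -> : h (- (x + n%:Z), - r - 1) = 0.
  have := hs 0%N; rewrite big_ord0 /= addr0 => <-; congr (h (_, _)); clear; lia.
have -> : h (- x, - r - 1) = \sum_(l < n) a1 (- x - l%:Z, - r - 1).
  transitivity (h (- x - n%:Z + n%:Z, - r - 1)); first by rewrite subrK.
  rewrite hs (reindex_inj rev_ord_inj); apply: eq_bigr => i _ /=; congr (a1 (_, _)).
  by move: (ltn_ord i); clear; lia.
by rewrite subr0.
Qed.

Let left_bound (p q n : nat) : (n <= p)%N -> c (k0.+1 + (p + q)) = (x - p%:Z, r - q%:Z) ->
  \sum_(l < n) a1 (- x + l.+1%:Z, - r - 1) <=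
  site_lpp w (x - p%:Z, r - q%:Z) p q - site_lpp w (x - p%:Z, r - q%:Z) (p - n) q.
Proof.
move=> np cu; have [h pot hs] := busemann_potential busa ties (- x, - r - 1).
have ox : site_le (- x, - r - 1) (- x, - r - 1) by rewrite /site_le !lexx.
have oy : site_le (- x, - r - 1) (- (x - n%:Z), - r - 1).
  by rewrite /site_le /= lexx andbT; clear; lia.
have py : x - p%:Z <= x - n%:Z by move: np; clear; lia.
have := below_chain pot ox oy py cu.
have -> : absz (x - n%:Z - x + p%:Z)%R = (p - n)%N by move: np; clear; lia.
have -> : h (- x, - r - 1) = 0.
  by have := hs 0%N; rewrite big_ord0 /= addr0.
have -> : - (x - n%:Z) = - x + n%:Z by clear; lia.
by rewrite hs /= => ?; lra.
Qed.

Let diag_inc (y : int) (m : nat) (e : R) : 0 < e -> exists J, forall j, (J <= j)%N ->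
  `|lpp_inc w (x - j%:Z, r - j%:Z) (absz (j%:Z + y)) j - b1 (x + y + 1, r)| <= e.
Proof.
move=> e0; have [M M0 [N h]] := busb (x + y + 1, r) e0.
exists (N + 2 + `|y| + M * (`|y| + 2))%N => j hj.
rewrite lpp_inc_binch.
have -> : (x - j%:Z, r - j%:Z).1 + (absz (j%:Z + y)).+1%:Z = x + y + 1.
  by rewrite /=; move: hj; clear; lia.
have -> : (x - j%:Z, r - j%:Z).2 + j%:Z = r by rewrite /= subrK.
apply: (h _ _ _).1.
have d1 : (`|y| + 2 <= j %/ M)%N by rewrite leq_divRL//; move: hj; clear; nia.
have d2 : (`|y| + 2 <= (absz (j%:Z + y)%R).+1 %/ M)%N by rewrite leq_divRL//; move: hj M0; clear; nia.
by rewrite /cone; move: (j %/ M)%N (_ %/ M)%N d1 d2 => A B d1 d2; apply/and4P; split; move: hj d1 d2; clear; lia.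
Qed.

(* The chain comes from points u far below. If such a u lies above the diagonal
   through (x, r), its increments along row r are at least those seen from the
   diagonal, which converge to b1; otherwise they are at most those. *)
Lemma crossing :
  (forall n, \sum_(l < n) (b1 (x + l.+1%:Z, r) - a1 (- x - l%:Z, - r - 1)) <= 0) \/
  (forall n, \sum_(l < n) (a1 (- x + l.+1%:Z, - r - 1) - b1 (x - l%:Z, r)) <= 0).
Proof.
apply: contrapT => /not_orP[/existsNP[n1 /negP + ] /existsNP[n2 /negP]].
rewrite -!ltNge; set s1 := \sum_(_ < n1) _; set s2 := \sum_(_ < n2) _ => s10 s20.
(* An error e on each increment then costs less than the positive sum s1, respectively s2. *)
pose e := Num.min (s1 / n1.+1%:R) (s2 / n2.+1%:R).
have e0 : 0 < e by rewrite lt_min !divr_gt0.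
have e1 : n1%:R * e < s1.
  have : n1.+1%:R * e <= s1 by rewrite mulrC -ler_pdivlMr// ge_min lexx.
  by rewrite -natr1 mulrDl mul1r; lra.
have e2 : n2%:R * e < s2.
  have : n2.+1%:R * e <= s2 by rewrite mulrC -ler_pdivlMr// ge_min lexx orbT.
  by rewrite -natr1 mulrDl mul1r; lra.
have near_inc (y : nat -> int) n : exists J, forall j, (J <= j)%N -> forall l, (l < n)%N ->
   `|lpp_inc w (x - j%:Z, r - j%:Z) (absz (j%:Z + y l)) j - b1 (x + y l + 1, r)| <= e.
  elim: n => [|n [J hJ]]; first by exists 0%N.
  have [J' hJ'] := diag_inc (y n) n e0; exists (maxn J J') => j.
  rewrite geq_max => /andP[/hJ h1 /hJ' h2] l; rewrite ltnS leq_eqVlt => /predU1P[->//|]; exact: h1.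
have [J1 h1] := near_inc (fun l => l%:Z) n1.
have [J2 h2] := near_inc (fun l => - l.+1%:Z) n2.
(* Enough steps back that the larger of p and q exceeds J1, J2 and n2. *)
have [p [q [pq cu]]] := chain_offset k0.+1 (2 * (J1 + J2 + n2).+1).
rewrite c1 /= -pq in cu.
case: (leqP p q) => cmp.
(* The starting point (x - p, r - q) lies on the row of the diagonal point (x - q, r - q), at or to
   the right of it, which makes its increments larger. *)
- have Jq : (J1 <= q)%N by move: pq cmp; clear; lia.
  have := right_bound n1 cu; apply/negP; rewrite -ltNge.
  have H : site_lpp w (x - q%:Z, r - q%:Z) (q + n1) q - site_lpp w (x - q%:Z, r - q%:Z) q q <=
      site_lpp w (x - p%:Z, r - q%:Z) (p + n1) q - site_lpp w (x - p%:Z, r - q%:Z) p q.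
    rewrite -[X in _ - site_lpp _ _ X q <= _]addn0 -[X in _ <= _ - site_lpp _ _ X q]addn0.
    rewrite -(telescope_ord (fun l => site_lpp w (x - q%:Z, r - q%:Z) (q + l) q)).
    rewrite -(telescope_ord (fun l => site_lpp w (x - p%:Z, r - q%:Z) (p + l) q)).
    apply: ler_sum => l _; rewrite !addnS.
    have := lpp_inc_left w (x - q%:Z, r - q%:Z) (q - p) (p + l) q.
    rewrite addnA subnK//=.
    by have -> : x - q%:Z + (q - p)%N%:Z = x - p%:Z by move: cmp; clear; lia.
  apply: lt_le_trans H.
  rewrite -[X in _ < _ - site_lpp _ _ X q]addn0.
  rewrite -(telescope_ord (fun l => site_lpp w (x - q%:Z, r - q%:Z) (q + l) q)).
  have : \sum_(l < n1) b1 (x + l.+1%:Z, r) - n1%:R * e <=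
     \sum_(l < n1) (site_lpp w (x - q%:Z, r - q%:Z) (q + l.+1) q - site_lpp w (x - q%:Z, r - q%:Z) (q + l) q).
    have -> : n1%:R * e = \sum_(l < n1) e by rewrite sumr_const card_ord mulr_natl.
    rewrite -sumrB; apply: ler_sum => l _.
    have := h1 q Jq l (ltn_ord l).
    have -> : absz (q%:Z + l%:Z)%R = (q + l)%N by clear; lia.
    have -> : x + l%:Z + 1 = x + l.+1%:Z by clear; lia.
    by rewrite /lpp_inc ler_norml addnS => /andP[]; lra.
  by move: e1; rewrite /s1 sumrB; lra.
- have Jp : (J2 <= p)%N by move: pq cmp; clear; lia.
  have np : (n2 <= p)%N by move: pq cmp; clear; lia.
  have := left_bound np cu; apply/negP; rewrite -ltNge.
  have tel v j : site_lpp w v p j - site_lpp w v (p - n2) j =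
      \sum_(l < n2) (site_lpp w v (p - l) j - site_lpp w v (p - l.+1) j).
    rewrite -[LHS]opprB -[X in - (_ - site_lpp w v X j)]subn0.
    rewrite -(telescope_ord (fun l => site_lpp w v (p - l) j)) -sumrN.
    by apply: eq_bigr => l _; rewrite opprB.
  have H : site_lpp w (x - p%:Z, r - q%:Z) p q - site_lpp w (x - p%:Z, r - q%:Z) (p - n2) q <=
     site_lpp w (x - p%:Z, r - p%:Z) p p - site_lpp w (x - p%:Z, r - p%:Z) (p - n2) p.
    rewrite !tel; apply: ler_sum => l _.
    have lp : (l < p)%N by rewrite (leq_trans (ltn_ord l)).
    have := lpp_inc_down w (x - p%:Z, r - p%:Z) (p - q) (p - l.+1) q.
    rewrite /lpp_inc -subSn// subSS subnK ?(ltnW cmp)//=.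
    by have -> : r - p%:Z + (p - q)%N%:Z = r - q%:Z by move: cmp; clear; lia.
  apply: le_lt_trans H _; rewrite tel.
  have : \sum_(l < n2) (site_lpp w (x - p%:Z, r - p%:Z) (p - l) p - site_lpp w (x - p%:Z, r - p%:Z) (p - l.+1) p) <=
     \sum_(l < n2) b1 (x - l%:Z, r) + n2%:R * e.
    have -> : n2%:R * e = \sum_(l < n2) e by rewrite sumr_const card_ord mulr_natl.
    rewrite -big_split /=; apply: ler_sum => l _.
    have lp : (l < p)%N by rewrite (leq_trans (ltn_ord l)).
    have := h2 p Jp l (ltn_ord l).
    have -> : absz (p%:Z - l.+1%:Z)%R = (p - l.+1)%N by move: lp; clear; lia.
    have -> : x + - l.+1%:Z + 1 = x - l%:Z by clear; lia.
    by rewrite /lpp_inc -subSn// subSS ler_norml => /andP[]; lra.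
  by move: e2; rewrite /s2 sumrB; lra.
Qed.

End crossing.

Section no_chain.
Context {d} {T : measurableType d} {R : realType} (P : probability T R).

(** No joint law is assumed: averages of U are near 1 and those of 2 V near 2, so along the relation
    one of them is on the wrong side of 3/2. *)
Lemma iidexp_not_double (U V : nat -> T -> R) : iidexp P U -> iidexp P V ->
  P.-negligible [set t | forall l, U l t = 2 * V l t].
Proof.
move=> iU iV; apply: small_negligible; suff main (e : R) : 0 < e -> small P e [set t | forall l, U l t = 2 * V l t] by exact: main.
move=> e0.
(* With th equal to 1/8 and -1/8 both exponents are at most - (n + 1) / 64, and exp(- y) <= 1 / (1 +
   y) turns this into e / 2. *)
pose n := Num.truncn (128 / e).
have ne : 128 / e < n.+1%:R by exact: truncnS_gt.
have q1 : `|8^-1| <= 4^-1 :> R by rewrite ger0_norm; lra.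
have q2 : `|- 8^-1| <= 4^-1 :> R by rewrite normrN ger0_norm; lra.
have us : uniq (iota 0 n.+1) by exact: iota_uniq.
have cU := iidexp_chernoff (n.+1%:R * (3 / 16)) iU us q1.
have cV := iidexp_chernoff (- (n.+1%:R * (3 / 32))) iV us q2.
rewrite size_iota in cU cV.
have half (r : R) : r <= - (n.+1%:R / 64) -> expR r <= e / 2.
  move=> hr; apply: (@le_trans _ _ (expR (- (n.+1%:R / 64)))); first by rewrite ler_expR.
  rewrite expRN invf_ple ?posrE ?expR_gt0 ?divr_gt0// invf_div.
  have h : 1 + n.+1%:R / 64 <= expR (n.+1%:R / 64 : R) by exact: expR_ge1Dx.
  apply: le_trans h; have -> : 2 / e = 64^-1 * (128 / e) by rewrite mulrA; congr (_ / e); lra.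
  by move: ne; move: (128 / e) n.+1%:R => a b; lra.
have mS (X : nat -> T -> R) (th tau : R) : iidexp P X -> measurable [set t | tau <= th * \sum_(k <- iota 0 n.+1) X k t].
  move=> iX; apply: measurable_ge; apply: (measurableT_comp (@mulrl_measurable R setT th)).
  by apply: measurable_sum => k; exact: iX.1.
have sU : small P (e / 2) [set t | n.+1%:R * (3 / 16) <= 8^-1 * \sum_(k <- iota 0 n.+1) U k t].
  apply: small_measurable; first exact: mS.
  by apply: le_trans cU _; rewrite lee_fin; apply: half; have := ler0n R n.+1; move: n.+1%:R => y y0; rewrite expr2; lra.
have sV : small P (e / 2) [set t | - (n.+1%:R * (3 / 32)) <= - 8^-1 * \sum_(k <- iota 0 n.+1) V k t].
  apply: small_measurable; first exact: mS.
  by apply: le_trans cV _; rewrite lee_fin; apply: half; have := ler0n R n.+1; move: n.+1%:R => y y0; rewrite expr2; lra.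
apply: small_le (small_sub _ (smallU sU sV)); first by lra.
move=> t /= h; have eUV : \sum_(k <- iota 0 n.+1) U k t = 2 * \sum_(k <- iota 0 n.+1) V k t.
  by rewrite mulr_sumr; apply: eq_bigr => k _; exact: h.
apply: contrapT => /not_orP[/negP + /negP]; rewrite -!ltNge eUV.
by move: (\sum_(_ <- _) _) => s; lra.
Qed.

Variable W : site -> T -> R.
Hypothesis iW : iidexp P W.

Let iW' := reflected_iidexp iW.
Let a1 t x := bush (reflected W) x t.
Let a2 t x := busv (reflected W) x t.

Let right_walk (x r : int) : P.-negligible [set t | forall n,
  \sum_(l < n) (bush W (x + l.+1%:Z, r) t - a1 t (- x - l%:Z, - r - 1)) <= 0].
Proof.
pose f (k : bool * nat) : bool * int := (k.1, if k.1 then x + k.2.+1%:Z else x + k.2%:Z).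
have fI : injective f by move=> [[] k] [[] l] // [] /addrI []; move=> ->.
apply: negligibleS (symmetric_walk (iidexp_reindex fI (rows_iidexp iW r))) => t h k.
set s := (X in X <= 0); have -> : s = 2^-1 * \sum_(l < k) (bush W (x + l.+1%:Z, r) t - a1 t (- x - l%:Z, - r - 1)).
  rewrite mulr_sumr; apply: eq_bigr => l _; rewrite mulrBr /f /= /a1.
  by have -> : - (x + (l : nat)%:Z) = - x - (l : nat)%:Z by rewrite opprD.
by rewrite pmulr_rle0 ?invr_gt0//; exact: h.
Qed.

Let left_walk (x r : int) : P.-negligible [set t | forall n,
  \sum_(l < n) (a1 t (- x + l.+1%:Z, - r - 1) - bush W (x - l%:Z, r) t) <= 0].
Proof.
pose f (k : bool * nat) : bool * int := (~~ k.1, if k.1 then x - k.2.+1%:Z else x - k.2%:Z).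
have fI : injective f.
  by move=> [[] k] [[] l] //= [] h; congr (_, _); move: h; clear; lia.
apply: negligibleS (symmetric_walk (iidexp_reindex fI (rows_iidexp iW r))) => t h k.
set s := (X in X <= 0); have -> : s = 2^-1 * \sum_(l < k) (a1 t (- x + l.+1%:Z, - r - 1) - bush W (x - l%:Z, r) t).
  rewrite mulr_sumr; apply: eq_bigr => l _; rewrite mulrBr /f /= /a1.
  by have -> : - (x - l.+1%:Z) = - x + l.+1%:Z by rewrite opprB addrC.
by rewrite pmulr_rle0 ?invr_gt0//; exact: h.
Qed.

(** Excludes chains that never step up: along such a ray, Busemann increments of mean 2 would
    coincide with weights of mean 1. *)
Let flat (x : site) : P.-negligible [set t | forall l : nat,
  a1 t (x.1 + l%:Z, x.2) = reflected W (x.1 + l%:Z, x.2) t].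
Proof.
have f1 : injective (fun l : nat => (x.1 + l%:Z, x.2) : site) by move=> k l [] /addrI [].
have f2 : injective (fun l : nat => (true, x.1 + l%:Z) : bool * int) by move=> k l [] /addrI [].
apply: negligibleS (iidexp_not_double (iidexp_reindex f1 iW') (iidexp_reindex f2 (rows_iidexp iW' x.2))).
by move=> t h l /=; rewrite -h mulrA divff ?mul1r.
Qed.

Definition backward_chain (s : site -> site) (c : nat -> site) := forall k, s (c k.+1) = c k.

(** A chain that steps up somewhere makes one of two symmetric walks stay nonpositive by [crossing],
    and there are countably many places for that step. A chain that never does is excluded by
    [flat]. *)
Theorem no_backward_chain :
  P.-negligible [set t | exists c, backward_chain (up_step (a1 t) (a2 t)) c].
Proof.
apply: (@negligibleS _ _ _ _ (((([set t | ~ no_ties (W^~ t)] `|`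
  [set t | ~ busemann (W^~ t) ((bush W)^~ t) ((busv W)^~ t)]) `|`
  ([set t | ~ busemann ((reflected W)^~ t) (a1 t) (a2 t)] `|` [set t | exists x, a1 t x = a2 t x])) `|`
  ([set t | exists p : int * int, forall n,
     \sum_(l < n) (bush W (p.1 + l.+1%:Z, p.2) t - a1 t (- p.1 - l%:Z, - p.2 - 1)) <= 0] `|`
   [set t | exists p : int * int, forall n,
     \sum_(l < n) (a1 t (- p.1 + l.+1%:Z, - p.2 - 1) - bush W (p.1 - l%:Z, p.2) t) <= 0])) `|`
  [set t | exists x : site, forall l : nat,
     a1 t (x.1 + l%:Z, x.2) = reflected W (x.1 + l%:Z, x.2) t])); last first.
  apply: negligibleU; [apply: negligibleU; [apply: negligibleU; apply: negligibleU|apply: negligibleU]|].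
  - exact: no_ties_ae iW.
  - exact: busemann_ae iW.
  - exact: busemann_ae iW'.
  - exact: busemann_ties iW'.
  - by apply: negligible_countable => p; exact: right_walk.
  - by apply: negligible_countable => p; exact: left_walk.
  - exact: negligible_countable flat.
move=> t [c chain]; apply: contrapT.
move=> /not_orP[/not_orP[/not_orP[/not_orP[/contrapT nt /contrapT bus] /not_orP[/contrapT bus' ties]]
  /not_orP[nright nleft]] nflat].
have {}ties x : a1 t x <> a2 t x by move=> e; apply: ties; exists x.
have [[k vk]|nv] := pselect (exists k, bus_dir (a1 t) (a2 t) (- c k.+1) = true).
  have e0 : c k = ((c k.+1).1, (c k.+1).2 + 1).
    by rewrite -chain /up_step vk; apply: injective_projections => /=; rewrite ?addr0.
  have [h|h] := crossing nt bus (bus' : busemann (opp_weights (W^~ t)) _ _) ties chain (surjective_pairing _) e0.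
    by apply: nright; exists (c k.+1).
  by apply: nleft; exists (c k.+1).
have hk k : bus_dir (a1 t) (a2 t) (- c k.+1) = false by apply/negP => h; apply: nv; exists k.
have ck k : - c k.+1 = ((- c 1%N).1 + k%:Z, (- c 1%N).2).
  elim: k => [|k ih]; first by rewrite addr0; case: (- c 1%N).
  have := chain k.+1; rewrite /up_step hk => /(canRL (addrK _)) ->.
  by rewrite opprB addrC ih; apply: injective_projections => /=; lia.
apply: nflat; exists (- c 1%N) => l; rewrite -!ck.
have := busemann_min bus' (- c l.+1); have := hk l; rewrite /bus_dir => /negbT; rewrite -leNgt => le.
by rewrite min_l.
Qed.

End no_chain.

(** * The dual tree *)

Lemma max_level (x : site) (l : seq site) :
  exists2 y, y \in x :: l & forall z, z \in x :: l -> level z <= level y.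
Proof.
elim: l x => [|x' l ih] x.
  by exists x; rewrite ?mem_head// => z; rewrite inE => /eqP ->.
have [y yl hy] := ih x'; case: (leP (level x) (level y)) => h.
  by exists y => [|z]; rewrite in_cons ?yl ?orbT// => /predU1P[->//|]; exact: hy.
exists x; rewrite ?mem_head// => z; rewrite inE => /predU1P[->//|zl].
exact: le_trans (hy _ zl) (ltW h).
Qed.

Section dual_tree.
Variable s : site -> bool.

Let up (y : site) : site := y + unit_vec (s y).
Let down := back_step s.
Let E : set edge := [set f | s (f.1 + unit_vec f.2) = f.2].

Lemma adj_dualE u v : adj E u v = (v == down u) || (u == down v).
Proof.
apply/asboolP/orP => [[[z i]]|].
  rewrite /E /joins /= => si [[-> ->]|[-> ->]]; [right|left];
    by rewrite /down /back_step si addrK.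
by case=> /eqP ->; [exists (down u, s u)|exists (down v, s v)] => //;
  rewrite ?/E ?/joins /down /back_step /= subrK//; [right|left].
Qed.

Lemma adj_dual_sym : symmetric (adj E).
Proof. by move=> u v; rewrite !adj_dualE orbC. Qed.

Let level_down u : level (down u) = level u - 1.
Proof. exact: level_sub_unit_vec. Qed.

(** Each site has a single neighbour below it. The two neighbours of the highest site of a cycle
    would both be that one. *)
Lemma dual_acyclic : acyclic_graph E.
Proof.
move=> c; wlog [y [c' [ec hy]]] : c / exists y c', c = y :: c' /\ forall z, z \in c -> level z <= level y.
  move=> main c2 cc uc.
  have [y yc hy] : exists2 y, y \in c & forall z, z \in c -> level z <= level y.
    by case: c c2 {cc uc} => // x l _; exact: max_level.
  have [i c' er] := rot_to yc.
  apply: (main (rot i c)); rewrite ?size_rot ?rot_cycle ?rot_uniq//.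
  by exists y, c'; split=> // z; rewrite mem_rot; exact: hy.
subst c; case: c' hy => [//|z [//|z' c]] hy _.
have top v : v \in [:: y, z, z' & c] -> adj E y v -> v = down y.
  move=> /hy hv; rewrite adj_dualE => /orP[/eqP //|/eqP e].
  by move: hv; rewrite e level_down; lia.
rewrite [cycle _ _]/= => /andP[yz /andP[zz']]; rewrite rcons_path => /andP[_ ly].
have e1 := top _ _ yz; rewrite adj_dual_sym in ly; have e2 := top _ _ ly.
have zin : z \in [:: y, z, z' & c] by rewrite in_cons mem_head orbT.
have lin : last z' c \in [:: y, z, z' & c] by rewrite 2!in_cons mem_last !orbT.
have zl : last z' c = z := etrans (e2 lin) (esym (e1 zin)).
by move=> /and3P[_ /negP nz _]; apply: nz; rewrite -[X in X \in _]zl mem_last.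
Qed.

Let conn u v := exists2 p, path (adj E) u p & last u p = v.

Let conn_trans v u z : conn u v -> conn v z -> conn u z.
Proof.
move=> [p pp lp] [q qq lq]; exists (p ++ q); last by rewrite last_cat lp.
by rewrite cat_path pp lp.
Qed.

Let conn_sym u v : conn u v -> conn v u.
Proof.
move=> [p pp <-]; exists (rev (belast u p)).
  rewrite rev_path; apply: sub_path pp => a b; by rewrite adj_dual_sym.
by case: p pp => //= a p _; rewrite rev_cons last_rcons.
Qed.

Let conn_down n u : conn u (iter n down u).
Proof.
elim: n => [|n ih]; first by exists [::].
apply: conn_trans ih _; exists [:: iter n.+1 down u] => //.
by rewrite /= andbT adj_dualE eqxx.
Qed.

Hypothesis nochain : ~ exists c, backward_chain up c.

(* If the dual paths from two neighbours never met, the sites strictly between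
   them would all have ancestors at every level, hence an infinite one. *)
Section trapped.
Variable z : site.
Let z' : site := (z.1 + 1, z.2 - 1).
Hypothesis nomeet : forall n, iter n down z <> iter n down z'.

(** The dual vertex with index y stands at y + (1/2, 1/2), one level higher than y. Hence the shift
    by 1 in the level, and the half-open range of first coordinates strictly between the two dual
    vertices. *)
Let B n (p : site) := level p = level z - n%:Z + 1 /\
  (iter n down z).1 < p.1 <= (iter n down z').1.

Let levelz n : level (iter n down z) = level z - n%:Z.
Proof. exact: level_iter. Qed.

Let levelz' n : level (iter n down z') = level z - n%:Z.
Proof. by rewrite level_iter /level /=; lia. Qed.

Let site_eq (p q : site) : level p = level q -> p.1 = q.1 -> p = q.
Proof. by case: p q => a b [c d]; rewrite /level /= => h e; congr (_, _); lia. Qed.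

Let down1 p : (down p).1 = p.1 - (~~ s p : nat)%:Z.
Proof. exact: sub_unit_vec1. Qed.

Let ordered n : (iter n down z).1 < (iter n down z').1.
Proof.
elim: n => [|n ih]; first by rewrite /=; lia.
have := @nomeet n.+1; rewrite !iterS !down1.
case e : (down (iter n down z) == down (iter n down z')); first by move/eqP: e.
move/eqP: e => ne _; have : (down (iter n down z)).1 <> (down (iter n down z')).1.
  by move=> h; apply: ne; apply: site_eq => //; rewrite !level_down levelz levelz'.
by rewrite !down1; case: (s _); case: (s _) => /=; lia.
Qed.

Let up_trapped n p : B n.+1 p -> B n (up p).
Proof.
move=> [lp /andP[]]; rewrite !iterS !down1 => h1 h2; split.
  by rewrite /up level_add_unit_vec lp; lia.
(* A site with the same index as a vertex of a dual path steps in the same direction as that path,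
   hence does not cross it. *)
have e1 : p.1 = (iter n down z).1 -> s p = s (iter n down z).
  by move=> e; congr s; apply: site_eq => //; rewrite levelz lp; lia.
have e2 : p.1 = (iter n down z').1 -> s p = s (iter n down z').
  by move=> e; congr s; apply: site_eq => //; rewrite levelz' lp; lia.
have -> : (up p).1 = p.1 + (~~ s p : nat)%:Z by rewrite /up; case: (s p) => /=; lia.
move: h1 h2 e1 e2; case: (s p); case: (s (iter n down z)); case: (s (iter n down z')) => /= h1 h2 e1 e2;
  by apply/andP; split; rewrite ltNge || rewrite leNgt; apply/negP => h; lia || (have := e1 ltac:(lia)) || (have := e2 ltac:(lia)).
Qed.

Let iter_trapped n m q : B (n + m) q -> B n (iter m up q).
Proof.
elim: m q => [|m ih] q; first by rewrite addn0.
by rewrite addnS iterSr => /up_trapped /ih.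
Qed.

Let good n p := B n p /\ forall m, exists2 q, B (n + m) q & iter m up q = p.

Let good0 : exists p, good 0 p.
Proof.
have B0 p : B 0 p -> p = (z.1 + 1, z.2).
  rewrite /B /= => -[lp /andP[h1 h2]]; apply: site_eq; rewrite ?lp /level /=; lia.
have ne n : exists q, B n q.
  have := ordered n; move=> o.
  exists ((iter n down z').1, level z - n%:Z + 1 - (iter n down z').1).
  by split; rewrite /level /= ?o ?lexx//; lia.
exists (z.1 + 1, z.2); split.
  by rewrite /B /level /=; split; lia.
move=> m; have [q Bq] := ne m; exists q => //.
by apply: B0; apply: iter_trapped.
Qed.

(** As in König's lemma: p has only two possible predecessors, and if the ancestry of each stopped
    at some depth, that of p would stop as well. *)
Let good_pred n p : good n p -> exists2 q, good n.+1 q & up q = p.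
Proof.
move=> [Bp hp]; apply: contrapT => nq.
have late i : exists M, forall m q, (M <= m)%N -> B (n.+1 + m) q -> up (iter m up q) = p ->
    iter m up q <> p - unit_vec i.
  have [ei|ni] := pselect (up (p - unit_vec i) = p); last first.
    by exists 0%N => m q _ _ e e'; apply: ni; rewrite -e' e.
  have [gi|] := pselect (good n.+1 (p - unit_vec i)); first by case: nq; exists (p - unit_vec i).
  move=> /not_andP[nB|/existsNP[M hM]].
    by exists 0%N => m q _ Bq _ e; apply: nB; rewrite -e; exact: iter_trapped.
  exists M => m q Mm Bq _ e; apply: hM; exists (iter (m - M) up q).
    by apply: iter_trapped; rewrite -addnA subnKC.
  by rewrite -iterD subnKC.
have [M1 h1] := late false; have [M2 h2] := late true.
pose m := maxn M1 M2; have [q Bq eq] := hp m.+1.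
have Bq' : B (n.+1 + m) q by rewrite addSnnS.
rewrite iterS in eq; have e : iter m up q = p - unit_vec (s (iter m up q)).
  by rewrite -eq /up addrK.
case: (s _) e; [apply: h2|apply: h1] => //; rewrite ?leq_maxl ?leq_maxr//.
Qed.

Lemma trapped_absurd : False.
Proof.
pose G := {np : nat * site | good np.1 np.2}.
pose next (g g' : G) := (sval g').1 = (sval g).1.+1 /\ up (sval g').2 = (sval g).2.
have step (g : G) : {g' | next g g'}.
  apply: cid; case: g => -[n p] /= gp; have [q gq eq] := good_pred gp.
  by exists (exist _ (n.+1, q) gq).
have [p0 g0] := good0.
have [f [f0 hf]] := dependent_choice step (exist _ (0%N, p0) g0).
by apply: nochain; exists (fun k => (sval (f k)).2) => k; exact: (hf k).2.
Qed.

End trapped.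

Let conn_diag (k : nat) (z : site) : conn z (z.1 + k%:Z, z.2 - k%:Z).
Proof.
elim: k => [|k ih]; first by exists [::] => //=; rewrite addr0 subr0; case: z.
apply: conn_trans ih _; set y := (_, _).
have -> : (z.1 + k.+1%:Z, z.2 - k.+1%:Z) = (y.1 + 1, y.2 - 1) by rewrite /y /=; congr (_, _); lia.
have [[n e]|nm] := pselect (exists n, iter n down y = iter n down (y.1 + 1, y.2 - 1)); last first.
  by case: (@trapped_absurd y) => n e; apply: nm; exists n.
apply: conn_trans (conn_down n y) _; rewrite e; exact: conn_sym (conn_down _ _).
Qed.

Let conn_level (u v : site) : level u = level v -> conn u v.
Proof.
wlog h : u v / u.1 <= v.1.
  move=> main e; case: (leP u.1 v.1) => h; first exact: main.
  by apply: conn_sym; apply: main => //; exact: ltW.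
move=> e; have := conn_diag (absz (v.1 - u.1)) u.
by have -> : (u.1 + (absz (v.1 - u.1))%:Z, u.2 - (absz (v.1 - u.1))%:Z) = v
  by move: h e; case: (u) (v) => a b [c d]; rewrite /level /= => h e; congr (_, _); lia.
Qed.

Lemma dual_connected : connected_graph E.
Proof.
move=> u v; wlog h : u v / level v <= level u.
  move=> main; case: (leP (level v) (level u)) => h; first exact: main.
  by apply: conn_sym; apply: main; exact: ltW.
apply: (@conn_trans _ u v (conn_down (absz (level u - level v)) u)).
by apply: conn_level; rewrite level_iter; lia.
Qed.

End dual_tree.

Lemma up_step_of_joins (s : site -> bool) (y y' : site) :
  upstep y y' -> (forall e : edge, joins e y y' -> s e.1 = e.2) -> y' = y + unit_vec (s y).
Proof.
have h i : joins (y, i) y (y + unit_vec i) by left.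
by move=> /orP[]/eqP -> /(_ _ (h _)) /= ->.
Qed.

(** * The dual system and the trees of the given weights *)

Section final.
Context {d} {T : measurableType d} {R : realType} (P : probability T R).

Lemma iid_exponential_iidexp (W : site -> {RV P >-> R}) :
  iid_exponential W -> iidexp P (fun x t => W x t).
Proof.
move=> [law indep]; split=> [x|s A us mA]; first exact: measurable_funP.
rewrite cylinder_bigsetI (indep s A us mA); apply: eq_bigr => x _.
by rewrite -(law x _ (mA x)).
Qed.

Variable W : site -> T -> R.
Hypothesis iW : iidexp P W.

Let iW' := reflected_iidexp iW.
(** Up-right geodesics of W are the reflections of down-left geodesics of the reflected weights. The
    dual weights of the latter, reflected back, are the i.i.d. field whose down-left tree is the
    dual system. *)
Let V (x : site) t := reflected_dual (reflected W) t x.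

Let iV : iidexp P V.
Proof.
apply: (iidexp_reindex (f := fun x : site => (- x.1, - x.2) : site) _ (dual_iidexp iW')).
by move=> [a b] [a' b'] /= [/oppr_inj -> /oppr_inj ->].
Qed.

Let a1 t x := bush (reflected W) x t.
Let a2 t x := busv (reflected W) x t.

Let regular : P.-negligible [set t | ~ [/\ no_ties (opp_weights (W^~ t)),
  busemann (opp_weights (W^~ t)) (a1 t) (a2 t), forall x, a1 t x <> a2 t x &
  ~ exists c, backward_chain (up_step (a1 t) (a2 t)) c]].
Proof.
apply: (@negligibleS _ _ _ _ (([set t | ~ no_ties ((reflected W)^~ t)] `|`
  [set t | ~ busemann ((reflected W)^~ t) (a1 t) (a2 t)]) `|`
  ([set t | exists x, a1 t x = a2 t x] `|` [set t | exists c, backward_chain (up_step (a1 t) (a2 t)) c]))).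
  move=> t /= nreg; apply: contrapT => /not_orP[/not_orP[/contrapT h1 /contrapT h2] /not_orP[h3 h4]].
  by apply: nreg; split=> // x e; apply: h3; exists x.
apply: negligibleU; apply: negligibleU.
- exact: no_ties_ae iW'.
- exact: busemann_ae iW'.
- exact: busemann_ties iW'.
- exact: no_backward_chain iW.
Qed.

Lemma down_tree_ae : {ae P, forall t, down_geodesic_tree (W^~ t) = lim_tree (W^~ t)}.
Proof.
apply: (@negligibleS _ _ _ _ (([set t | ~ no_ties (W^~ t)] `|`
  [set t | ~ busemann (W^~ t) ((bush W)^~ t) ((busv W)^~ t)]) `|`
  [set t | exists x, bush W x t = busv W x t])); last first.
  apply: negligibleU; [apply: negligibleU|].
  - exact: no_ties_ae iW.
  - exact: busemann_ae iW.
  - exact: busemann_ties iW.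
move=> t /= ne; apply: contrapT => /not_orP[/not_orP[/contrapT nt /contrapT bus] ties].
have {}ties x : bush W x t <> busv W x t by move=> e; apply: ties; exists x.
by apply: ne; rewrite (down_geodesic_treeE bus ties nt) (lim_treeE bus ties).
Qed.

(** By [busemann_rel], the difference of the two increments arriving at the upper-right corner of a
    plaquette equals the difference of those leaving its lower-left corner. The first pair decides
    the step in the tree of W, the second the step in the tree of V, so the two directions
    coincide. *)
Lemma dual_tree_ae : {ae P, forall t, dual_system (geodesic_tree (W^~ t)) = lim_tree (V^~ t)}.
Proof.
apply: (negligibleS _ (negligibleU regular (dual_busemann iW'))).
move=> t /= ne; apply: contrapT => /not_orP[/contrapT[nt bus ties _] /contrapT busV].
apply: ne; rewrite (dual_geodesic_treeE bus ties nt).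
have rel x := busemann_rel bus (- x).
have tiesV x : bush (reflected W) (- x.1, - x.2 - 1) t <> busv (reflected W) (- x.1 - 1, - x.2) t.
  by move=> e; apply: (ties (- x)); have := rel x; rewrite /a1 /a2 /= e; lra.
rewrite (lim_treeE busV tiesV); apply/seteqP.
have dirE x : bus_dir (a1 t) (a2 t) (- x) = bus_dir
   (fun x => bush (reflected W) (- x.1, - x.2 - 1) t) (fun x => busv (reflected W) (- x.1 - 1, - x.2) t) x.
  by rewrite /bus_dir; have := rel x; rewrite /a1 /a2 /= => e; apply/idP/idP; lra.
by split=> f /=; rewrite dirE.
Qed.

Theorem dual_tree_law : eq_in_distribution P
  (fun t => dual_system (geodesic_tree (W^~ t))) (fun t => down_geodesic_tree (W^~ t)).
Proof.
exists (mkmfun (measurable_iid_lim_tree iV)), (mkmfun (measurable_iid_lim_tree iW)).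
split=> [||S mS]; [exact: dual_tree_ae|exact: down_tree_ae|].
exact: (lim_tree_same_law iV iW mS).
Qed.

Theorem dual_is_tree : {ae P, forall t, is_tree (dual_system (geodesic_tree (W^~ t)))}.
Proof.
apply: negligibleS regular => t /=; apply: contra_not => -[nt bus ties nochain].
rewrite (dual_geodesic_treeE bus ties nt).
split; last exact: (@dual_acyclic (fun x => bus_dir (a1 t) (a2 t) (- x))).
exact: (@dual_connected (fun x => bus_dir (a1 t) (a2 t) (- x)) nochain).
Qed.

(** The nonpositive times of a bi-infinite path of the tree, read backwards, form a backward
    chain. *)
Theorem no_biinfinite_path : {ae P, forall t,
  ~ exists g : int -> site, biinfinite_path_in (geodesic_tree (W^~ t)) g}.
Proof.
apply: negligibleS regular => t /=; apply: contra_not => -[nt bus ties nochain] [g [gup gE]].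
apply: nochain; exists (fun k => g (- k%:Z)) => k.
have e : - k.+1%:Z + 1 = - k%:Z by lia.
have := gup (- k.+1%:Z); rewrite e => st; apply/esym.
apply: (up_step_of_joins (s := fun x => bus_dir (a1 t) (a2 t) (- x)) st) => f jf.
have : geodesic_tree (W^~ t) f by apply: gE; exists (- k.+1%:Z); rewrite e.
by rewrite (geodesic_treeE bus ties nt).
Qed.

End final.

Theorem lemma2 (R : realType) (d : measure_display) (T : measurableType d)
    (P : probability T R) (W : site -> {RV P >-> R})
    (W_iid : iid_exponential W) :
  let w (t : T) (x : site) : R := W x t in
  [/\ eq_in_distribution P (fun t => dual_system (geodesic_tree (w t)))
                           (fun t => down_geodesic_tree (w t)),
      {ae P, forall t, is_tree (dual_system (geodesic_tree (w t)))} &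
      {ae P, forall t,
        ~ exists g : int -> site, biinfinite_path_in (geodesic_tree (w t)) g}].
Proof.
move=> w; have iW := iid_exponential_iidexp W_iid.
by split; [exact: dual_tree_law iW|exact: dual_is_tree iW|exact: no_biinfinite_path iW].
Qed.
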